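(* Consider the closed-loop linear delay system with gain $K$, the supply rate function $\mathsf s$, and the decomposition data ($\boldsymbol f_i,\boldsymbol\varphi_i,\boldsymbol\phi_i,M_i,\widehat A_i,\widehat B_i,\widehat C_i,\widehat{\mathfrak B}_i$, $i\in\mathbb{N}_\nu$) described in the context, and assume the decomposition data are given. Let $d=\sum_{i=1}^\nu d_i$, $\varrho=nd$, and let real numbers $\{\alpha_i\}_{i=1}^\beta\subset\mathbb{R}$ be given. Suppose there exist $X,\acute P_1\in\mathbb{S}^n$, $\acute P_2\in\mathbb{R}^{n\times\varrho}$, $\acute P_3\in\mathbb{S}^{\varrho}$, $\acute Q_i,\acute R_i\in\mathbb{S}^n$ ($i\in\mathbb{N}_\nu$) and $V\in\mathbb{R}^{p\times n}$ such that $$\begin{bmatrix}\acute P_1&\acute P_2\\ \acute P_2^\top&\acute P_3\end{bmatrix}+\Big[\mathsf O_n\oplus\Big(\operatorname{diag}_{i=1}^\nu (I_{d_i}\otimes\acute Q_i)\Big)\Big]\succ0,$$ $$\acute{\mathbf Q}=\operatorname{diag}_{i=1}^\nu\acute Q_i\succ0,\qquad\acute{\mathbf R}=\operatorname{diag}_{i=1}^\nu\acute R_i\succ0,$$ $$\mathsf{Sy}\left(\begin{bmatrix}I_n\\ [\alpha_iI_n]_{i=1}^\beta\\ \mathsf O_{(q+m),n}\end{bmatrix}\begin{bmatrix}-X&\acute{\boldsymbol\Pi}\end{bmatrix}\right)+\begin{bmatrix}\mathsf O_n&\acute{\mathbf P}\\ \acute{\mathbf P}^\top&\acute{\boldsymbol\Phi}\end{bmatrix}\prec0,$$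 where, with the matrices $\mathbf A,\mathbf B_1,\mathbf C,\mathbf B_2,\widehat I,\mathbf M$ and dimensions $\beta,\varkappa,\mu,\kappa$ of the context, $$\acute{\mathbf P}=\begin{bmatrix}\acute P_1&\mathsf O_{n,\nu n}&\acute P_2\widehat I&\mathsf O_{n,(n\mu+q+m)}\end{bmatrix},$$ $$\acute{\boldsymbol\Pi}=\begin{bmatrix}\mathbf A[(I_\beta\otimes X)\oplus I_q]+\mathbf B_1[(I_\beta\otimes V)\oplus\mathsf O_q]&\mathsf O_{n,m}\end{bmatrix},$$ $$\acute{\boldsymbol\Sigma}=\mathbf C[(I_\beta\otimes X)\oplus I_q]+\mathbf B_2[(I_\beta\otimes V)\oplus\mathsf O_q],$$ $$\acute{\boldsymbol\Phi}=\mathsf{Sy}\left(\begin{bmatrix}\acute P_2\\ \mathsf O_{\nu n,dn}\\ \widehat I^\top\acute P_3\\ \mathsf O_{(\mu n+q+m),dn}\end{bmatrix}\begin{bmatrix}\mathbf M\otimes I_n&\mathsf O_{dn,(\mu n+q+m)}\end{bmatrix}+\begin{bmatrix}\mathsf O_{(\beta n),m}\\ -J_2^\top\\ \widetilde J\end{bmatrix}\begin{bmatrix}\acute{\boldsymbol\Sigma}&\mathsf O_m\end{bmatrix}\right)+(\acute\Xi\oplus J_1),$$ $$\acute\Xi=\big[(\acute{\mathbf Q}+\acute{\mathbf R}\Lambda)\oplus\mathsf O_n\oplus\mathsf O_{\kappa n}\oplus\mathsf O_q\big]-\Big[\mathsf O_n\oplus\acute{\mathbf Q}\oplus\big[\operatorname{diag}_{i=1}^\nu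 (I_{\varkappa_i}\otimes\acute R_i)\big]\oplus\big[\operatorname{diag}_{i=1}^\nu (I_{\mu_i}\otimes\acute R_i)\big]\oplus J_3\Big],$$ $$\Lambda=\operatorname{diag}_{i=1}^\nu(r_i-r_{i-1})I_n.$$ Then, with the controller gain $K=VX^{-1}$, the closed-loop system is dissipative with respect to $\mathsf s$, and the origin of the closed-loop system with $\boldsymbol w(t)\equiv\mathbf 0_q$ is globally exponentially stable.
   Context: Notation. $\mathbb{S}^k$ is the set of real symmetric $k\times k$ matrices; $\succ0,\prec0,\preceq0$ denote positive definite, negative definite, negative semidefinite; $\mathsf{Sy}(X)=X+X^\top$; $\otimes$ is the Kronecker product; $X\oplus Y$ is the block-diagonal matrix with blocks $X,Y$ and $\operatorname{diag}_{i=1}^\nu X_i=X_1\oplus\cdots\oplus X_\nu$ (also for non-square blocks, including column vectors); $[\![X_i]\!]_{i=1}^{\nu}=[X_1\ \cdots\ X_\nu]$ and $[X_i]_{i=1}^\nu$ denote row-wise and column-wise concatenation; $\mathsf O_{a,b}$ is the $a\times b$ zero matrix, $\mathsf O_a=\mathsf O_{a,a}$, $\mathbf 0_a=\mathsf O_{a,1}$. Matrices with a zero dimension are empty and are omitted. $\mathbb{N}_\nu=\{1,\dots,\nu\}$. $\mathscr{L}^2$ denotes square-integrable measurable functions and $\mathscr{W}^{1,2}$ the $\mathscr{L}^2$ functions with weak derivative in $\mathscr{L}^2$ (the continuous representative is used for point values). System. Let $n,m,p,q,\nu\in\mathbb{N}$, $0=r_0<r_1<\cdots<r_\nu=r$,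 $\mathcal{J}=[-r,0]$, $\mathcal{I}_i=[-r_i,-r_{i-1}]$, $t_0\in\mathbb{R}$. Given are constant matrices $A_i\in\mathbb{R}^{n\times n}$, $B_i\in\mathbb{R}^{n\times p}$, $C_i\in\mathbb{R}^{m\times n}$, $\mathfrak B_i\in\mathbb{R}^{m\times p}$ ($i=0,\dots,\nu$), $D_1\in\mathbb{R}^{n\times q}$, $D_2\in\mathbb{R}^{m\times q}$ and functions $\widetilde A_i\in\mathscr{L}^2(\mathcal{I}_i;\mathbb{R}^{n\times n})$, $\widetilde B_i\in\mathscr{L}^2(\mathcal{I}_i;\mathbb{R}^{n\times p})$, $\widetilde C_i\in\mathscr{L}^2(\mathcal{I}_i;\mathbb{R}^{m\times n})$, $\widetilde{\mathfrak B}_i\in\mathscr{L}^2(\mathcal{I}_i;\mathbb{R}^{m\times p})$ ($i\in\mathbb{N}_\nu$). For $K\in\mathbb{R}^{p\times n}$ the closed-loop system (obtained from the open-loop delay system with state feedback $\boldsymbol u(t)=K\boldsymbol x(t)$) is $$\dot{\boldsymbol x}(t)=\sum_{i=0}^\nu(A_i+B_iK)\boldsymbol x(t-r_i)+\sum_{i=1}^\nu\int_{\mathcal{I}_i}(\widetilde A_i(\tau)+\widetilde B_i(\tau)K)\boldsymbol x(t+\tau)\,\mathrm d\tau+D_1\boldsymbol w(t),$$ $$\boldsymbol z(t)=\sum_{i=0}^\nu(C_i+\mathfrak B_iK)\boldsymbol x(t-r_i)+\sum_{i=1}^\nu\int_{\mathcal{I}_i}(\widetilde C_i(\tau)+\widetilde{\mathfrak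 B}_i(\tau)K)\boldsymbol x(t+\tau)\,\mathrm d\tau+D_2\boldsymbol w(t),$$ for almost all $t\ge t_0$, with $\boldsymbol x(t_0+\theta)=\boldsymbol\psi(\theta)$, $\theta\in\mathcal{J}$, $\boldsymbol\psi\in\mathcal{C}(\mathcal{J};\mathbb{R}^n)$ (continuous functions with the sup norm $\|\cdot\|_\infty$), disturbance $\boldsymbol w\in\mathscr{L}^2([t_0,\infty);\mathbb{R}^q)$, and solutions in the sense of Carathéodory. Write $\mathbf x_t(\theta)=\boldsymbol x(t+\theta)$, $\theta\in\mathcal{J}$. Supply rate function. $$\mathsf s(\boldsymbol z,\boldsymbol w)=\begin{bmatrix}\boldsymbol z\\ \boldsymbol w\end{bmatrix}^\top\begin{bmatrix}\widetilde J^\top J_1^{-1}\widetilde J&J_2\\ J_2^\top&J_3\end{bmatrix}\begin{bmatrix}\boldsymbol z\\ \boldsymbol w\end{bmatrix}$$ with given $J_1\in\mathbb{S}^m$, $J_1^{-1}\prec0$, $\widetilde J\in\mathbb{R}^{m\times m}$, $\widetilde J^\top J_1^{-1}\widetilde J\preceq0$, $J_2\in\mathbb{R}^{m\times q}$, $J_3\in\mathbb{S}^q$. Dissipativity and stability. The closed-loop system is dissipative with respect to $\mathsf s$ if there is a continuous storage functional $\mathsf v:\mathcal{C}(\mathcal{J};\mathbb{R}^n)\to[0,\infty)$ with $\mathsf v(0)=0$ such that along all solutions (all $\boldsymbol\psi$, all $\boldsymbol w\in\mathscr{L}^2$) $\mathsf v(\mathbf x_{t_2})-\mathsf v(\mathbf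 x_{t_1})\le\int_{t_1}^{t_2}\mathsf s(\boldsymbol z(t),\boldsymbol w(t))\,\mathrm dt$ for all $t_2\ge t_1\ge t_0$. The origin is globally exponentially stable if there are $c,\lambda>0$ with $\|\boldsymbol x(t)\|_2\le c\,e^{-\lambda(t-t_0)}\|\boldsymbol\psi\|_\infty$ for all $t\ge t_0$ and all $\boldsymbol\psi$. Decomposition data. For each $i\in\mathbb{N}_\nu$: $d_i\in\mathbb{N}$, $\delta_i,\mu_i\in\mathbb{N}\cup\{0\}$, $\varkappa_i=d_i+\delta_i$, $\kappa_i=d_i+\delta_i+\mu_i$; $\boldsymbol f_i\in\mathscr{W}^{1,2}(\mathcal{I}_i;\mathbb{R}^{d_i})$, $\boldsymbol\varphi_i\in\mathscr{L}^2(\mathcal{I}_i;\mathbb{R}^{\delta_i})$, $\boldsymbol\phi_i\in\mathscr{L}^2(\mathcal{I}_i;\mathbb{R}^{\mu_i})$; $\boldsymbol h_i=\begin{bmatrix}\boldsymbol\varphi_i\\ \boldsymbol f_i\end{bmatrix}$, $\boldsymbol g_i=\begin{bmatrix}\boldsymbol\phi_i\\ \boldsymbol h_i\end{bmatrix}$; constant matrices $M_i\in\mathbb{R}^{d_i\times\varkappa_i}$, $\widehat A_i\in\mathbb{R}^{n\times\kappa_in}$, $\widehat B_i\in\mathbb{R}^{n\times\kappa_ip}$, $\widehat C_i\in\mathbb{R}^{m\times\kappa_in}$, $\widehat{\mathfrak B}_i\in\mathbb{R}^{m\times\kappa_ip}$, such that (almost everywhere on $\mathcal{I}_i$) $\widetilde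 A_i=\widehat A_i(\boldsymbol g_i\otimes I_n)$, $\widetilde B_i=\widehat B_i(\boldsymbol g_i\otimes I_p)$, $\widetilde C_i=\widehat C_i(\boldsymbol g_i\otimes I_n)$, $\widetilde{\mathfrak B}_i=\widehat{\mathfrak B}_i(\boldsymbol g_i\otimes I_p)$, $\boldsymbol f_i'=M_i\boldsymbol h_i$ (weak derivative), and $\int_{\mathcal{I}_i}\boldsymbol g_i\boldsymbol g_i^\top\mathrm d\tau\succ0$. Derived matrices. $\mathfrak F_i=\int_{\mathcal{I}_i}\boldsymbol f_i\boldsymbol f_i^\top\mathrm d\tau$, $\mathfrak H_i=\int_{\mathcal{I}_i}\boldsymbol h_i\boldsymbol h_i^\top\mathrm d\tau$, $\Gamma_i=\int_{\mathcal{I}_i}\boldsymbol\phi_i\boldsymbol h_i^\top\mathrm d\tau$, $\boldsymbol\varepsilon_i=\boldsymbol\phi_i-\Gamma_i\mathfrak H_i^{-1}\boldsymbol h_i$, $\mathfrak E_i=\int_{\mathcal{I}_i}\boldsymbol\varepsilon_i\boldsymbol\varepsilon_i^\top\mathrm d\tau$; these Gram matrices $\mathfrak F_i,\mathfrak H_i,\mathfrak E_i$ are positive definite, with Cholesky factors (lower triangular) $\mathfrak F_i=\mathfrak L_{\boldsymbol f_i}\mathfrak L_{\boldsymbol f_i}^\top$, $\mathfrak H_i=\mathfrak L_{\boldsymbol h_i}\mathfrak L_{\boldsymbol h_i}^\top$, $\mathfrak E_i=\mathfrak L_{\boldsymbol\varepsilon_i}\mathfrak L_{\boldsymbol\varepsilon_i}^\top$.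 Put $$T_i=\begin{bmatrix}\Gamma_i\mathfrak L_{\boldsymbol h_i}^{-\top}\\ \mathfrak L_{\boldsymbol h_i}\end{bmatrix}\in\mathbb{R}^{\kappa_i\times\varkappa_i},\qquad \widetilde T_i=\begin{bmatrix}I_{\mu_i}\\ \mathsf O_{\varkappa_i,\mu_i}\end{bmatrix}\mathfrak L_{\boldsymbol\varepsilon_i}\in\mathbb{R}^{\kappa_i\times\mu_i},$$ $\varkappa=\sum_i\varkappa_i$, $\mu=\sum_i\mu_i$, $\kappa=\sum_i\kappa_i$, $d=\sum_id_i$ (sums over $i\in\mathbb{N}_\nu$), $\beta=1+\nu+\kappa$, and $$\mathbf A=\begin{bmatrix}[\![A_i]\!]_{i=0}^\nu&[\![\widehat A_i(T_i\otimes I_n)]\!]_{i=1}^\nu&[\![\widehat A_i(\widetilde T_i\otimes I_n)]\!]_{i=1}^\nu&D_1\end{bmatrix},$$ $$\mathbf B_1=\begin{bmatrix}[\![B_i]\!]_{i=0}^\nu&[\![\widehat B_i(T_i\otimes I_p)]\!]_{i=1}^\nu&[\![\widehat B_i(\widetilde T_i\otimes I_p)]\!]_{i=1}^\nu&\mathsf O_{n,q}\end{bmatrix},$$ $$\mathbf C=\begin{bmatrix}[\![C_i]\!]_{i=0}^\nu&[\![\widehat C_i(T_i\otimes I_n)]\!]_{i=1}^\nu&[\![\widehat C_i(\widetilde T_i\otimes I_n)]\!]_{i=1}^\nu&D_2\end{bmatrix},$$ $$\mathbf B_2=\begin{bmatrix}[\![\mathfrak B_i]\!]_{i=0}^\nu&[\![\widehat{\mathfrak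 B}_i(T_i\otimes I_p)]\!]_{i=1}^\nu&[\![\widehat{\mathfrak B}_i(\widetilde T_i\otimes I_p)]\!]_{i=1}^\nu&\mathsf O_{m,q}\end{bmatrix},$$ $$\widehat I=\Big(\operatorname{diag}_{i=1}^\nu\mathfrak L_{\boldsymbol f_i}^{-1}\begin{bmatrix}\mathsf O_{d_i,\delta_i}&I_{d_i}\end{bmatrix}\mathfrak L_{\boldsymbol h_i}\Big)\otimes I_n,$$ $$\mathbf M=\begin{bmatrix}\operatorname{diag}_{i=1}^\nu\mathfrak L_{\boldsymbol f_i}^{-1}\boldsymbol f_i(-r_{i-1})&\mathbf 0_d&\mathsf O_{d,\varkappa}\end{bmatrix}-\begin{bmatrix}\mathbf 0_d&\operatorname{diag}_{i=1}^\nu\mathfrak L_{\boldsymbol f_i}^{-1}\boldsymbol f_i(-r_i)&\operatorname{diag}_{i=1}^\nu\mathfrak L_{\boldsymbol f_i}^{-1}M_i\mathfrak L_{\boldsymbol h_i}\end{bmatrix}.$$ With these, the closed-loop system reads $\dot{\boldsymbol x}(t)=(\mathbf A+\mathbf B_1[(I_\beta\otimes K)\oplus\mathsf O_q])\boldsymbol\vartheta(t)$, $\boldsymbol z(t)=(\mathbf C+\mathbf B_2[(I_\beta\otimes K)\oplus\mathsf O_q])\boldsymbol\vartheta(t)$, where $\boldsymbol\vartheta(t)$ is the column stacking of $\boldsymbol x(t)$, $[\boldsymbol x(t-r_i)]_{i=1}^\nu$, $\big[\int_{\mathcal{I}_i}(\mathfrak L_{\boldsymbol h_i}^{-1}\boldsymbol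 h_i(\tau)\otimes I_n)\boldsymbol x(t+\tau)\mathrm d\tau\big]_{i=1}^\nu$, $\big[\int_{\mathcal{I}_i}(\mathfrak L_{\boldsymbol\varepsilon_i}^{-1}\boldsymbol\varepsilon_i(\tau)\otimes I_n)\boldsymbol x(t+\tau)\mathrm d\tau\big]_{i=1}^\nu$ and $\boldsymbol w(t)$. *)

(* Defs.v *)
From mathcomp Require Export all_boot all_order all_algebra.
From mathcomp Require Export mxtens.
From mathcomp Require Export all_classical all_reals all_analysis.

Set Implicit Arguments.
Unset Strict Implicit.
Unset Printing Implicit Defensive.

Import Order.TTheory GRing.Theory Num.Theory.
Import numFieldNormedType.Exports.

Local Open Scope classical_set_scope.
Local Open Scope ring_scope.

(* [tensmx] is row-major: row i * c + k of A ⊗ B pairs row i of A with row k *)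
(* of B (c rows)                                                              *)
Notation "A ⊗ B" := (tensmx A B) (at level 40, left associativity) : ring_scope.

Definition mxdsum (R : nmodType) (a b c e : nat)
    (X : 'M[R]_(a, b)) (Y : 'M[R]_(c, e)) : 'M[R]_(a + c, b + e) :=
  block_mx X 0 0 Y.

Notation "X ⊕ Y" := (mxdsum X Y) (at level 45, left associativity) : ring_scope.

Definition Sy (R : nmodType) (k : nat) (X : 'M[R]_k) : 'M[R]_k := X + X^T.

Definition issym (R : Type) (k : nat) (X : 'M[R]_k) : Prop := X^T = X.

Definition posdef (R : realType) (k : nat) (X : 'M[R]_k) : Prop :=
  issym X /\ forall u : 'cV[R]_k, u != 0 -> 0 < (u^T *m X *m u) 0 0.

Definition negdef (R : realType) (k : nat) (X : 'M[R]_k) : Prop :=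
  issym X /\ forall u : 'cV[R]_k, u != 0 -> (u^T *m X *m u) 0 0 < 0.

Definition negsemidef (R : realType) (k : nat) (X : 'M[R]_k) : Prop :=
  issym X /\ forall u : 'cV[R]_k, (u^T *m X *m u) 0 0 <= 0.

(* [is_trig_mx] is lower triangularity *)
Definition is_cholesky (R : realType) (k : nat) (L X : 'M[R]_k) : Prop :=
  [/\ is_trig_mx L, (forall i, 0 < L i i) & X = L *m L^T].

(* Block concatenations.  MathComp gives [\mxrow], [\mxcol], [\mxdiag] the   *)
(* dimension [\sum_i b i]; the casts below only rewrite such a dimension     *)
(* into the product form that Kronecker products have.                       *)

Lemma sum_mulnl (k : nat) (b : 'I_k -> nat) (c : nat) :
  (\sum_i b i * c = (\sum_i b i) * c)%N.
Proof. by rewrite big_distrl. Qed.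

Lemma sum_constn (k c : nat) : (\sum_(i < k) c = k * c)%N.
Proof. by rewrite sum_nat_const card_ord. Qed.

Lemma sum_1n (k : nat) : (\sum_(i < k) 1 = k)%N.
Proof. by rewrite sum_constn muln1. Qed.

Definition row_cat (R : Type) (a c k : nat) (F : 'I_k -> 'M[R]_(a, c)) :
    'M[R]_(a, k * c) :=
  castmx (erefl, sum_constn k c) (\mxrow_(i < k) F i).

Definition row_catn (R : Type) (a c k : nat) (b : 'I_k -> nat)
    (F : forall i, 'M[R]_(a, b i * c)) : 'M[R]_(a, (\sum_i b i) * c) :=
  castmx (erefl, sum_mulnl b c) (\mxrow_(i < k) F i).

Definition col_cat (R : Type) (a c k : nat) (F : 'I_k -> 'M[R]_(a, c)) :
    'M[R]_(k * a, c) :=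
  castmx (sum_constn k a, erefl) (\mxcol_(i < k) F i).

Definition diag_cat (R : nmodType) (c k : nat) (F : 'I_k -> 'M[R]_c) :
    'M[R]_(k * c) :=
  castmx (sum_constn k c, sum_constn k c) (\mxdiag_(i < k) F i).

Definition diag_catn (R : nmodType) (c k : nat) (b : 'I_k -> nat)
    (F : forall i, 'M[R]_(b i * c)) : 'M[R]_((\sum_i b i) * c) :=
  castmx (sum_mulnl b c, sum_mulnl b c) (\mxdiag_(i < k) F i).

(* [\mxdiag] for rectangular blocks; on the diagonal the dimensions agree    *)
(* and [conform_mx 0 (F i)] is [F i]                                         *)
Definition mxdiagr (R : nmodType) (k : nat) (a b : 'I_k -> nat)
    (F : forall i, 'M[R]_(a i, b i)) : 'M[R]_(\sum_i a i, \sum_i b i) :=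
  \mxblock_(i < k, j < k) (if i == j then conform_mx 0 (F i) else 0).

Definition diag_col (R : nmodType) (k : nat) (a : 'I_k -> nat)
    (F : forall i, 'cV[R]_(a i)) : 'M[R]_(\sum_i a i, k) :=
  castmx (erefl, sum_1n k) (mxdiagr F).

(* g ⊗ I_c for a column vector g *)
Definition tenscolI (R : pzRingType) (k c : nat) (g : 'cV[R]_k) :
    'M[R]_(k * c, c) :=
  castmx (erefl, mul1n c) (g ⊗ (1%:M : 'M[R]_c)).

Definition mxint (R : realType) (a b : nat) (D : set R)
    (F : R -> 'M[R]_(a, b)) : 'M[R]_(a, b) :=
  \matrix_(i, j) (\int[lebesgue_measure]_(t in D) F t i j).

(* [f \_ D] extends f by 0 outside D *)
Definition L2 (R : realType) (a b : nat) (D : set R)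
    (F : R -> 'M[R]_(a, b)) : Prop :=
  forall i j, ((fun t => F t i j) \_ D) \in Lfun (@lebesgue_measure R) 2%:E.

(* C^1 functions with compact support in the open interval ]a, b[ *)
Definition test_function (R : realType) (a b : R) (eta : R -> R) : Prop :=
  [/\ (forall t, derivable eta t 1), continuous (derive1 eta) &
      exists a' b' : R, [/\ a < a', b' < b &
        forall t, ~ `[a', b']%classic t -> eta t = 0]].

Definition weak_derivative (R : realType) (k : nat) (a b : R)
    (f f' : R -> 'cV[R]_k) : Prop :=
  forall eta, test_function a b eta ->
    mxint `[a, b] (fun t => derive1 eta t *: f t) =
    - mxint `[a, b] (fun t => eta t *: f' t).

(* the continuous representative is taken, as point values are used *)
Definition W12 (R : realType) (k : nat) (a b : R) (f : R -> 'cV[R]_k) : Prop :=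
  [/\ L2 `[a, b] f, {within `[a, b], continuous f} &
      exists2 f', L2 `[a, b] f' & weak_derivative a b f f'].

Definition abs_continuous (R : realType) (a b : R) (f : R -> R) : Prop :=
  forall e : R, 0 < e -> exists2 del : R, 0 < del &
    forall (N : nat) (u v : 'I_N -> R),
      (forall k, [/\ a <= u k, u k <= v k & v k <= b]) ->
      (forall k l, k != l -> v k <= u l \/ v l <= u k) ->
      \sum_k (v k - u k) < del -> \sum_k `|f (v k) - f (u k)| < e.

Definition enorm (R : realType) (k : nat) (x : 'cV[R]_k) : R :=
  Num.sqrt (\sum_i x i 0 ^+ 2).

(* Index conventions: families over {0..nu} are indexed by 'I_nu.+1, and     *)
(* families over {1..nu} by 'I_nu, with i : 'I_nu standing for i + 1.        *)
(* [E_] is the fraktur B of the output equation.                              *)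
Record plant (R : realType) (n m p q nu : nat) := Plant {
  delay : 'I_nu.+1 -> R;
  A_ : 'I_nu.+1 -> 'M[R]_n;
  B_ : 'I_nu.+1 -> 'M[R]_(n, p);
  C_ : 'I_nu.+1 -> 'M[R]_(m, n);
  E_ : 'I_nu.+1 -> 'M[R]_(m, p);
  D1 : 'M[R]_(n, q);
  D2 : 'M[R]_(m, q);
  At : 'I_nu -> R -> 'M[R]_n;
  Bt : 'I_nu -> R -> 'M[R]_(n, p);
  Ct : 'I_nu -> R -> 'M[R]_(m, n);
  Et : 'I_nu -> R -> 'M[R]_(m, p)
}.

(* r_{i-1} and r_i for i in {1..nu}, and r = r_nu *)
Definition rprev (R : realType) (n m p q nu : nat) (S : plant R n m p q nu)
  (i : 'I_nu) : R := delay S (widen_ord (leqnSn nu) i).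
Definition rcur (R : realType) (n m p q nu : nat) (S : plant R n m p q nu)
  (i : 'I_nu) : R := delay S (lift ord0 i).
Definition rmax (R : realType) (n m p q nu : nat) (S : plant R n m p q nu) : R :=
  delay S ord_max.

Definition Iset (R : realType) (n m p q nu : nat) (S : plant R n m p q nu)
  (i : 'I_nu) : set R := `[- rcur S i, - rprev S i]%classic.

Definition Jset (R : realType) (n m p q nu : nat) (S : plant R n m p q nu) :
  set R := `[- rmax S, 0]%classic.

Definition is_plant (R : realType) (n m p q nu : nat)
    (S : plant R n m p q nu) : Prop :=
  [/\ delay S ord0 = 0, (forall i, rprev S i < rcur S i) &
      forall i, [/\ L2 (Iset S i) (At S i), L2 (Iset S i) (Bt S i),
                    L2 (Iset S i) (Ct S i) & L2 (Iset S i) (Et S i)]].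

Definition closed_loop_field (R : realType) (n m p q nu : nat)
    (S : plant R n m p q nu) (K : 'M[R]_(p, n))
    (x : R -> 'cV[R]_n) (w : R -> 'cV[R]_q) (t : R) : 'cV[R]_n :=
  \sum_(i < nu.+1) (A_ S i + B_ S i *m K) *m x (t - delay S i) +
  \sum_(i < nu) mxint (Iset S i)
     (fun tau => (At S i tau + Bt S i tau *m K) *m x (t + tau)) +
  D1 S *m w t.

Definition closed_loop_output (R : realType) (n m p q nu : nat)
    (S : plant R n m p q nu) (K : 'M[R]_(p, n))
    (x : R -> 'cV[R]_n) (w : R -> 'cV[R]_q) (t : R) : 'cV[R]_m :=
  \sum_(i < nu.+1) (C_ S i + E_ S i *m K) *m x (t - delay S i) +
  \sum_(i < nu) mxint (Iset S i)
     (fun tau => (Ct S i tau + Et S i tau *m K) *m x (t + tau)) +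
  D2 S *m w t.

Definition CJ (R : realType) (n m p q nu : nat) (S : plant R n m p q nu)
    (psi : R -> 'cV[R]_n) : Prop := {within Jset S, continuous psi}.

Definition supnorm (R : realType) (n m p q nu : nat) (S : plant R n m p q nu)
    (psi : R -> 'cV[R]_n) : R := sup [set enorm (psi th) | th in Jset S].

(* Caratheodory solution on [t0, +oo); values of x before t0 - r are irrelevant *)
Definition is_solution (R : realType) (n m p q nu : nat)
    (S : plant R n m p q nu) (K : 'M[R]_(p, n)) (t0 : R)
    (psi : R -> 'cV[R]_n) (w : R -> 'cV[R]_q) (x : R -> 'cV[R]_n) : Prop :=
  [/\ (forall th, Jset S th -> x (t0 + th) = psi th),
      (forall t1 i, t0 < t1 -> abs_continuous t0 t1 (fun t => x t i 0)) &
      {ae @lebesgue_measure R, forall t, t0 <= t ->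
         is_derive t 1 x (closed_loop_field S K x w t)}].

Definition hist (R : realType) (n : nat) (x : R -> 'cV[R]_n) (t : R) :
  R -> 'cV[R]_n := fun th => x (t + th).

Definition supply (R : realType) (m q : nat) (J1 Jt : 'M[R]_m)
    (J2 : 'M[R]_(m, q)) (J3 : 'M[R]_q) (z : 'cV[R]_m) (w : 'cV[R]_q) : R :=
  ((col_mx z w)^T *m block_mx (Jt^T *m invmx J1 *m Jt) J2 J2^T J3
     *m col_mx z w) 0 0.

(* Functionals on C(J; R^n) are represented on total functions and only      *)
(* considered on those continuous on J; sup-norm continuity forces them to   *)
(* depend on the restriction to J alone.                                     *)
Definition storage_functional (R : realType) (n m p q nu : nat)
    (S : plant R n m p q nu) (v : (R -> 'cV[R]_n) -> R) : Prop :=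
  [/\ (forall phi, CJ S phi -> 0 <= v phi),
      v (fun=> 0) = 0 &
      forall phi, CJ S phi -> forall e : R, 0 < e ->
        exists2 del : R, 0 < del & forall psi, CJ S psi ->
          supnorm S (fun th => psi th - phi th) < del -> `|v psi - v phi| < e].

Definition dissipative (R : realType) (n m p q nu : nat)
    (S : plant R n m p q nu) (K : 'M[R]_(p, n)) (t0 : R)
    (s : 'cV[R]_m -> 'cV[R]_q -> R) : Prop :=
  exists2 v, storage_functional S v &
    forall psi w x, CJ S psi -> L2 `[t0, +oo[ w ->
      is_solution S K t0 psi w x ->
      forall t1 t2 : R, t0 <= t1 -> t1 <= t2 ->
        v (hist x t2) - v (hist x t1) <=
        \int[lebesgue_measure]_(t in `[t1, t2]) s (closed_loop_output S K x w t) (w t).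

Definition origin_GES (R : realType) (n m p q nu : nat)
    (S : plant R n m p q nu) (K : 'M[R]_(p, n)) (t0 : R) : Prop :=
  exists c lam : R, [/\ 0 < c, 0 < lam &
    forall psi x, CJ S psi -> is_solution S K t0 psi (fun=> 0) x ->
      forall t, t0 <= t ->
        enorm (x t) <= c * expR (- lam * (t - t0)) * supnorm S psi].

(* varkappa_i and kappa_i, in the order of the blocks of h_i and g_i *)
Definition vkap (nu : nat) (d delta : 'I_nu -> nat) (i : 'I_nu) : nat :=
  (delta i + d i)%N.
Definition kap (nu : nat) (d delta mu : 'I_nu -> nat) (i : 'I_nu) : nat :=
  (mu i + vkap d delta i)%N.

Definition beta (nu : nat) (d delta mu : 'I_nu -> nat) : nat :=
  (1 + nu + \sum_i kap d delta mu i)%N.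

(* [Eh_] is the hatted fraktur B *)
Record decomposition (R : realType) (n m p nu : nat)
    (d delta mu : 'I_nu -> nat) := Decomposition {
  f_ : forall i, R -> 'cV[R]_(d i);
  varphi_ : forall i, R -> 'cV[R]_(delta i);
  phi_ : forall i, R -> 'cV[R]_(mu i);
  M_ : forall i, 'M[R]_(d i, vkap d delta i);
  Ah_ : forall i, 'M[R]_(n, kap d delta mu i * n);
  Bh_ : forall i, 'M[R]_(n, kap d delta mu i * p);
  Ch_ : forall i, 'M[R]_(m, kap d delta mu i * n);
  Eh_ : forall i, 'M[R]_(m, kap d delta mu i * p)
}.

Definition h_ (R : realType) (n m p nu : nat) (d delta mu : 'I_nu -> nat)
    (D : decomposition R n m p d delta mu) (i : 'I_nu) (t : R) :
    'cV[R]_(vkap d delta i) := col_mx (varphi_ D i t) (f_ D i t).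

Definition g_ (R : realType) (n m p nu : nat) (d delta mu : 'I_nu -> nat)
    (D : decomposition R n m p d delta mu) (i : 'I_nu) (t : R) :
    'cV[R]_(kap d delta mu i) := col_mx (phi_ D i t) (h_ D i t).

Definition is_decomposition (R : realType) (n m p q nu : nat)
    (d delta mu : 'I_nu -> nat) (S : plant R n m p q nu)
    (D : decomposition R n m p d delta mu) : Prop :=
  forall i,
  [/\ [/\ W12 (- rcur S i) (- rprev S i) (f_ D i),
          L2 (Iset S i) (varphi_ D i) & L2 (Iset S i) (phi_ D i)],
      {ae @lebesgue_measure R, forall t, Iset S i t ->
         [/\ At S i t = Ah_ D i *m tenscolI n (g_ D i t),
             Bt S i t = Bh_ D i *m tenscolI p (g_ D i t),
             Ct S i t = Ch_ D i *m tenscolI n (g_ D i t) &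
             Et S i t = Eh_ D i *m tenscolI p (g_ D i t)]},
      weak_derivative (- rcur S i) (- rprev S i) (f_ D i)
        (fun t => M_ D i *m h_ D i t) &
      posdef (mxint (Iset S i) (fun t => g_ D i t *m (g_ D i t)^T))].

Definition gramF (R : realType) (n m p q nu : nat) (d delta mu : 'I_nu -> nat)
    (S : plant R n m p q nu) (D : decomposition R n m p d delta mu)
    (i : 'I_nu) : 'M[R]_(d i) :=
  mxint (Iset S i) (fun t => f_ D i t *m (f_ D i t)^T).

Definition gramH (R : realType) (n m p q nu : nat) (d delta mu : 'I_nu -> nat)
    (S : plant R n m p q nu) (D : decomposition R n m p d delta mu)
    (i : 'I_nu) : 'M[R]_(vkap d delta i) :=
  mxint (Iset S i) (fun t => h_ D i t *m (h_ D i t)^T).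

Definition Gam (R : realType) (n m p q nu : nat) (d delta mu : 'I_nu -> nat)
    (S : plant R n m p q nu) (D : decomposition R n m p d delta mu)
    (i : 'I_nu) : 'M[R]_(mu i, vkap d delta i) :=
  mxint (Iset S i) (fun t => phi_ D i t *m (h_ D i t)^T).

Definition eps_ (R : realType) (n m p q nu : nat) (d delta mu : 'I_nu -> nat)
    (S : plant R n m p q nu) (D : decomposition R n m p d delta mu)
    (i : 'I_nu) (t : R) : 'cV[R]_(mu i) :=
  phi_ D i t - Gam S D i *m invmx (gramH S D i) *m h_ D i t.

Definition gramE (R : realType) (n m p q nu : nat) (d delta mu : 'I_nu -> nat)
    (S : plant R n m p q nu) (D : decomposition R n m p d delta mu)
    (i : 'I_nu) : 'M[R]_(mu i) :=
  mxint (Iset S i) (fun t => eps_ S D i t *m (eps_ S D i t)^T).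

Record factors (R : realType) (nu : nat) (d delta mu : 'I_nu -> nat) := Factors {
  Lf : forall i, 'M[R]_(d i);
  Lh : forall i, 'M[R]_(vkap d delta i);
  Le : forall i, 'M[R]_(mu i)
}.

Definition is_factors (R : realType) (n m p q nu : nat)
    (d delta mu : 'I_nu -> nat) (S : plant R n m p q nu)
    (D : decomposition R n m p d delta mu) (L : factors R d delta mu) : Prop :=
  forall i, [/\ is_cholesky (Lf L i) (gramF S D i),
                is_cholesky (Lh L i) (gramH S D i) &
                is_cholesky (Le L i) (gramE S D i)].

Definition T_ (R : realType) (n m p q nu : nat) (d delta mu : 'I_nu -> nat)
    (S : plant R n m p q nu) (D : decomposition R n m p d delta mu)
    (L : factors R d delta mu) (i : 'I_nu) :
    'M[R]_(kap d delta mu i, vkap d delta i) :=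
  col_mx (Gam S D i *m (invmx (Lh L i))^T) (Lh L i).

Definition Tt_ (R : realType) (nu : nat) (d delta mu : 'I_nu -> nat)
    (L : factors R d delta mu) (i : 'I_nu) :
    'M[R]_(kap d delta mu i, mu i) :=
  col_mx 1%:M 0 *m Le L i.

Lemma sum_kap (nu : nat) (d delta mu : 'I_nu -> nat) :
  (\sum_i kap d delta mu i = \sum_i vkap d delta i + \sum_i mu i)%N.
Proof. by rewrite big_split addnC. Qed.

Lemma beta_dim1 (nu c : nat) (d delta mu : 'I_nu -> nat) :
  (nu.+1 * c + (\sum_i vkap d delta i) * c + (\sum_i mu i) * c
   = beta d delta mu * c)%N.
Proof. by rewrite /beta sum_kap addnA mulSn !mulnDl !mul1n. Qed.

Lemma beta_dim2 (nu c : nat) (d delta mu : 'I_nu -> nat) :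
  (c + nu * c + (\sum_i vkap d delta i) * c + (\sum_i mu i) * c
   = beta d delta mu * c)%N.
Proof. by rewrite /beta sum_kap addnA !mulnDl !mul1n. Qed.

Lemma beta_dim3 (nu c : nat) (d delta mu : 'I_nu -> nat) :
  ((1 + nu + \sum_i vkap d delta i) * c + (\sum_i mu i) * c
   = beta d delta mu * c)%N.
Proof. by rewrite /beta sum_kap addnA !mulnDl. Qed.

Lemma beta_dim4 (nu c : nat) (d delta mu : 'I_nu -> nat) :
  (nu * c + c + (\sum_i kap d delta mu i) * c = beta d delta mu * c)%N.
Proof. by rewrite /beta !mulnDl mul1n (addnC c). Qed.

(* common shape of the boldface matrices A, B_1, C, B_2 *)
Definition bold (R : realType) (n m p q nu : nat) (d delta mu : 'I_nu -> nat)
    (S : plant R n m p q nu) (D : decomposition R n m p d delta mu)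
    (L : factors R d delta mu) (a c : nat)
    (X : 'I_nu.+1 -> 'M[R]_(a, c))
    (Xh : forall i, 'M[R]_(a, kap d delta mu i * c)) (Y : 'M[R]_(a, q)) :
    'M[R]_(a, beta d delta mu * c + q) :=
  row_mx (castmx (erefl, beta_dim1 c d delta mu)
    (row_mx (row_mx
       (row_cat X)
       (row_catn (fun i => Xh i *m (T_ S D L i ⊗ (1%:M : 'M[R]_c)))))
       (row_catn (fun i => Xh i *m (Tt_ L i ⊗ (1%:M : 'M[R]_c)))))) Y.

Definition boldA (R : realType) (n m p q nu : nat) (d delta mu : 'I_nu -> nat)
    (S : plant R n m p q nu) (D : decomposition R n m p d delta mu)
    (L : factors R d delta mu) : 'M[R]_(n, beta d delta mu * n + q) :=
  bold S D L (A_ S) (Ah_ D) (D1 S).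

Definition boldB1 (R : realType) (n m p q nu : nat) (d delta mu : 'I_nu -> nat)
    (S : plant R n m p q nu) (D : decomposition R n m p d delta mu)
    (L : factors R d delta mu) : 'M[R]_(n, beta d delta mu * p + q) :=
  bold S D L (B_ S) (Bh_ D) 0.

Definition boldC (R : realType) (n m p q nu : nat) (d delta mu : 'I_nu -> nat)
    (S : plant R n m p q nu) (D : decomposition R n m p d delta mu)
    (L : factors R d delta mu) : 'M[R]_(m, beta d delta mu * n + q) :=
  bold S D L (C_ S) (Ch_ D) (D2 S).

Definition boldB2 (R : realType) (n m p q nu : nat) (d delta mu : 'I_nu -> nat)
    (S : plant R n m p q nu) (D : decomposition R n m p d delta mu)
    (L : factors R d delta mu) : 'M[R]_(m, beta d delta mu * p + q) :=
  bold S D L (E_ S) (Eh_ D) 0.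

Definition Ihat (R : realType) (n nu : nat) (d delta mu : 'I_nu -> nat)
    (L : factors R d delta mu) :
    'M[R]_((\sum_i d i) * n, (\sum_i vkap d delta i) * n) :=
  mxdiagr (fun i => invmx (Lf L i) *m
    (row_mx (0 : 'M[R]_(d i, delta i)) (1%:M : 'M[R]_(d i)) *m Lh L i))
  ⊗ (1%:M : 'M[R]_n).

Definition boldM (R : realType) (n m p q nu : nat) (d delta mu : 'I_nu -> nat)
    (S : plant R n m p q nu) (D : decomposition R n m p d delta mu)
    (L : factors R d delta mu) :
    'M[R]_(\sum_i d i, 1 + nu + \sum_i vkap d delta i) :=
  row_mx (castmx (erefl, addnC nu 1)
    (row_mx (diag_col (fun i => invmx (Lf L i) *m f_ D i (- rprev S i)))
            (0 : 'cV[R]_(\sum_i d i)))) 0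
  - row_mx
    (row_mx (0 : 'cV[R]_(\sum_i d i))
            (diag_col (fun i => invmx (Lf L i) *m f_ D i (- rcur S i))))
    (mxdiagr (fun i => invmx (Lf L i) *m M_ D i *m Lh L i)).

Definition Lam (R : realType) (n m p q nu : nat) (S : plant R n m p q nu) :
    'M[R]_(nu * n) :=
  diag_cat (fun i : 'I_nu => (rcur S i - rprev S i)%:M : 'M[R]_n).

Definition acP (R : realType) (n m q nu : nat) (d delta mu : 'I_nu -> nat)
    (L : factors R d delta mu) (P1 : 'M[R]_n) (P2 : 'M[R]_(n, (\sum_i d i) * n)) :
    'M[R]_(n, beta d delta mu * n + q + m) :=
  row_mx (row_mx (castmx (erefl, beta_dim2 n d delta mu)
    (row_mx (row_mx (row_mx P1 0) (P2 *m Ihat n L)) 0)) 0) 0.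

Definition acSigma (R : realType) (n m p q nu : nat) (d delta mu : 'I_nu -> nat)
    (S : plant R n m p q nu) (D : decomposition R n m p d delta mu)
    (L : factors R d delta mu) (X : 'M[R]_n) (V : 'M[R]_(p, n)) :
    'M[R]_(m, beta d delta mu * n + q) :=
  boldC S D L *m (((1%:M : 'M[R]_(beta d delta mu)) ⊗ X) ⊕ (1%:M : 'M[R]_q))
  + boldB2 S D L *m
    (((1%:M : 'M[R]_(beta d delta mu)) ⊗ V) ⊕ (0 : 'M[R]_q)).

Definition acPi (R : realType) (n m p q nu : nat) (d delta mu : 'I_nu -> nat)
    (S : plant R n m p q nu) (D : decomposition R n m p d delta mu)
    (L : factors R d delta mu) (X : 'M[R]_n) (V : 'M[R]_(p, n)) :
    'M[R]_(n, beta d delta mu * n + q + m) :=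
  row_mx
   (boldA S D L *m (((1%:M : 'M[R]_(beta d delta mu)) ⊗ X) ⊕ (1%:M : 'M[R]_q))
    + boldB1 S D L *m
      (((1%:M : 'M[R]_(beta d delta mu)) ⊗ V) ⊕ (0 : 'M[R]_q))) 0.

Definition acXi (R : realType) (n m p q nu : nat) (d delta mu : 'I_nu -> nat)
    (S : plant R n m p q nu) (Q Rr : 'I_nu -> 'M[R]_n) (J3 : 'M[R]_q) :
    'M[R]_(beta d delta mu * n + q) :=
  castmx (beta_dim4 n d delta mu, beta_dim4 n d delta mu)
    ((diag_cat Q + diag_cat Rr *m Lam S) ⊕ (0 : 'M[R]_n)
      ⊕ (0 : 'M[R]_((\sum_i kap d delta mu i) * n)))
    ⊕ (0 : 'M[R]_q)
  - castmx (beta_dim2 n d delta mu, beta_dim2 n d delta mu)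
    ((0 : 'M[R]_n) ⊕ diag_cat Q
      ⊕ diag_catn (fun i => (1%:M : 'M[R]_(vkap d delta i)) ⊗ Rr i)
      ⊕ diag_catn (fun i => (1%:M : 'M[R]_(mu i)) ⊗ Rr i))
    ⊕ J3.

Definition acPhi (R : realType) (n m p q nu : nat) (d delta mu : 'I_nu -> nat)
    (S : plant R n m p q nu) (D : decomposition R n m p d delta mu)
    (L : factors R d delta mu) (J1 Jt : 'M[R]_m) (J2 : 'M[R]_(m, q))
    (J3 : 'M[R]_q) (X : 'M[R]_n) (P2 : 'M[R]_(n, (\sum_i d i) * n))
    (P3 : 'M[R]_((\sum_i d i) * n)) (Q Rr : 'I_nu -> 'M[R]_n)
    (V : 'M[R]_(p, n)) : 'M[R]_(beta d delta mu * n + q + m) :=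
  Sy (col_mx (col_mx (castmx (beta_dim2 n d delta mu, erefl)
        (col_mx (col_mx (col_mx P2 0) ((Ihat n L)^T *m P3)) 0)) 0) 0
      *m row_mx (row_mx (castmx (erefl, beta_dim3 n d delta mu)
           (row_mx (boldM S D L ⊗ (1%:M : 'M[R]_n)) 0)) 0) 0
      + col_mx (col_mx 0 (- J2^T)) Jt *m row_mx (acSigma S D L X V) 0)
  + (acXi d delta mu S Q Rr J3 ⊕ J1).

(* Main.v *)
Require Import Defs.
From mathcomp Require Import measurable_realfun ring lra.
Set Implicit Arguments.
Unset Strict Implicit.
Unset Printing Implicit Defensive.
Import Order.TTheory GRing.Theory Num.Theory.
Import numFieldNormedType.Exports.
Local Open Scope classical_set_scope.
Local Open Scope ring_scope.

(** Why the theorem holds.  Let [x] be a closed-loop trajectory and [y := X^-1 x];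
[X] is invertible because the leading block of the matrix inequality is [- 2 X]
([lmi_unit]).  The storage functional ([storage]) is the quadratic form of
[P1, P2, P3] in [y(t)] and in the projections of the history of [y] on the
functions [f_i], plus the integrals over [I_i] of
[y(t + s)^T (Q_i + (s + r_i) R_i) y(t + s)].  Integrating by parts with
[f_i' = M_i h_i] expresses its time derivative through [y'(t)], the delayed
states, the projections of the history on orthonormal versions of [h_i], and
minus the integrals of [y(t + s)^T R_i y(t + s)] ([storage_derive]).  The
closed-loop equation and the output are functions of the delayed states, of
these projections, of those on orthonormal versions of [eps_i] and of [w(t)]
([field_stack], [output_stack]).

Now evaluate the quadratic form of the matrix inequality at the vector made of
[y'(t)], the delayed states and projections, [w(t)], and
[zeta = - J1^-1 Jt z(t)].  The term with the multipliers [alpha_i] vanishes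
because the vector satisfies the closed-loop equation ([lmi_stack]), and the
choice of [zeta] turns the last block row into minus the supply rate
([supply_elim]).  What remains is the derivative of the storage, minus the
supply rate, plus the difference between the integrals of
[y(t + s)^T R_i y(t + s)] and the same forms of the projections.  This
difference is nonnegative by Bessel's inequality ([bessel], [kern_bessel]), the
kernels being orthonormal by the choice of the Cholesky factors and of [eps_i].
By strictness and compactness of the unit sphere ([posdef_coercive]) a margin
is left, and since the storage is bounded by [|y(t)|^2] plus the integrals of
[y(t + s)^T R_i y(t + s)] ([storage_upper]), the margin dominates a multiple of
the storage: its derivative is at most the supply rate minus [lam] times the
storage ([dissipation_rate]).  Integration gives dissipativity, and with
[w = 0], where the supply rate is nonpositive, the storage decays exponentially.
It controls [|y(t)|^2] from below ([storage_lower]) by the first positivity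
hypothesis, again through Bessel's inequality, now for the weights [Q_i].

Three analytic points need care.  Solutions are differentiable only almost
everywhere, so the differential inequality is integrated by the fact that an
absolutely continuous function whose derivative is nonpositive almost
everywhere is nonincreasing ([ac_nonincreasing]).  The [f_i] have only weak
derivatives, tested against compactly supported functions; products of a
C^1 function with cut-offs give integration by parts with boundary terms
([weak_ibp]).  Finally a history is merely continuous, so the derivative of
the integral of [f(s) y(t + s)] is found by writing [y] as the derivative of
a C^1 function and moving one derivative to [f] ([conv_derive]). *)

(** * Integrable and square integrable functions on a set of reals *)

Section IntervalIntegral.
Context {R : realType}.
Notation mu := (@lebesgue_measure R).
Implicit Types (a b c : R) (f g F : R -> R) (D : set R).

Let two_ge1 : (1 <= (2%:E : \bar R))%E.
Proof. by rewrite lee_fin ler1n. Qed.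

Definition intg D f := mu.-integrable D (EFin \o f).
Definition sq D f := (f \_ D) \in Lfun mu 2%:E.

Lemma intgD D f g : measurable D -> intg D f -> intg D g -> intg D (fun t => f t + g t).
Proof. move=> mD; exact: (@integrableD _ _ _ mu D mD). Qed.

Lemma intgZ D c f : measurable D -> intg D f -> intg D (fun t => c * f t).
Proof. by move=> mD; exact: (@integrableZl _ _ _ mu D mD). Qed.

Lemma intg_abs D f : intg D f -> intg D (fun t => `|f t|).
Proof. exact: (@integrable_norm _ _ _ mu D f). Qed.

Lemma intgS D D' f : measurable D -> measurable D' -> D' `<=` D -> intg D f -> intg D' f.
Proof. exact: (@integrableS _ _ _ mu). Qed.

Lemma intg_sum D n (F : 'I_n -> R -> R) : measurable D -> (forall i, intg D (F i)) ->
  intg D (fun t => \sum_i F i t).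
Proof.
move=> mD iF; rewrite /intg (_ : EFin \o _ = (fun t => \sum_i (F i t)%:E)%E); last first.
  by apply/funext => t; rewrite /= sumEFin.
by apply: (@integrable_sum _ _ _ mu D mD) => i _; exact: iF.
Qed.

Lemma intg_cont a b f : {within `[a, b], continuous f} -> intg `[a, b] f.
Proof. by move=> cf; apply: continuous_compact_integrable => //; exact: segment_compact. Qed.

Lemma eq_intg D f g : measurable D -> (forall t, D t -> f t = g t) -> intg D f -> intg D g.
Proof.
move=> mD fg; apply: (@eq_integrable _ _ _ mu D mD (EFin \o f)) => t /set_mem Dt.
by rewrite /= fg.
Qed.

Lemma RintZ D c f : measurable D -> intg D f ->
  \int[mu]_(t in D) (c * f t) = c * \int[mu]_(t in D) f t.
Proof. by move=> mD; exact: (@RintegralZl _ _ _ mu). Qed.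

Lemma RintD D f g : measurable D -> intg D f -> intg D g ->
  \int[mu]_(t in D) (f t + g t) = \int[mu]_(t in D) f t + \int[mu]_(t in D) g t.
Proof. by move=> mD; exact: (@RintegralD _ _ _ mu). Qed.

Lemma Rint_sum D n (F : 'I_n -> R -> R) : measurable D -> (forall i, intg D (F i)) ->
  \int[mu]_(t in D) (\sum_i F i t) = \sum_i \int[mu]_(t in D) F i t.
Proof.
move=> mD; elim: n F => [|n IH] F iF.
  rewrite big_ord0; transitivity (\int[mu]_(t in D) (0 : R)).
    by apply: eq_Rintegral => t _; rewrite big_ord0.
  by rewrite (@Rintegral_cst _ _ _ mu D mD) mul0r.
rewrite big_ord_recl -IH // -RintD //; last exact: intg_sum.
by apply: eq_Rintegral => t _; rewrite big_ord_recl.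
Qed.

Lemma Rint_le D f g : measurable D -> intg D f -> intg D g ->
  (forall t, D t -> f t <= g t) ->
  \int[mu]_(t in D) f t <= \int[mu]_(t in D) g t.
Proof. by move=> mD; exact: (@le_Rintegral _ _ _ mu). Qed.

Lemma Rint_eq D f g : (forall t, D t -> f t = g t) ->
  \int[mu]_(t in D) f t = \int[mu]_(t in D) g t.
Proof. by move=> fg; apply: eq_Rintegral => t /set_mem; exact: fg. Qed.

Lemma Rint_norm D f : measurable D -> intg D f ->
  `|\int[mu]_(t in D) f t| <= \int[mu]_(t in D) `|f t|.
Proof. by move=> mD; exact: (@le_normr_Rintegral _ _ _ mu). Qed.

Lemma Rint_cst a b c : a <= b -> \int[mu]_(t in `[a, b]) c = c * (b - a).
Proof.
move=> ab; rewrite Rintegral_cst //= lebesgue_measure_itv /= lte_fin.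
by move: ab; rewrite le_eqVlt => /predU1P[->|->]; rewrite ?ltxx ?subrr //= EFinB.
Qed.

Lemma ae_Rint_eq D f g : measurable D -> intg D f -> intg D g ->
  {ae mu, forall t, D t -> f t = g t} ->
  \int[mu]_(t in D) f t = \int[mu]_(t in D) g t.
Proof.
move=> mD intf intg' fg; congr fine.
apply: (@ae_eq_integral _ _ _ mu D) => //.
- exact: (measurable_int _ intf).
- exact: (measurable_int _ intg').
- have [N [mN N0 sN]] := fg; exists N; split=> // t /= H; apply: sN => /= H'.
  by apply: H => Dt; rewrite H'.
Qed.

Lemma Lfun2_intro (g : R -> R) : measurable_fun setT g ->
  intg setT (fun t => g t ^+ 2) -> g \in Lfun mu 2%:E.
Proof.
move=> mg ig; rewrite inE; apply/andP; split; rewrite inE //= /finite_norm unlock.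
rewrite poweR_lty // (@eq_integral _ _ _ mu setT (fun x => (g x ^+ 2)%:E)); last first.
  move=> x _; by rewrite /= powR_mulrn // real_normK // num_real.
move/integrableP: ig => [_]; congr (_ < _)%E; apply: eq_integral => x _.
by rewrite /= ger0_norm ?sqr_ge0.
Qed.

Lemma sq_meas D f : measurable D -> sq D f -> measurable_fun D f.
Proof.
move=> mD /sub_Lfun_mfun; rewrite inE /= => mf.
exact: (@measurable_restrictT _ _ _ _ D f mD).2.
Qed.

Lemma sq_intro D f : measurable D -> measurable_fun D f ->
  intg D (fun t => f t ^+ 2) -> sq D f.
Proof.
move=> mD mf if2; apply: Lfun2_intro; first exact: (@measurable_restrictT _ _ _ _ D f mD).1.
move: if2 => /(@integrable_mkcond _ _ _ mu D _ mD); rewrite restrict_EFin.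
congr (mu.-integrable _ (EFin \o _)); apply/funext => t.
by rewrite !patchE; case: ifP => //; rewrite expr0n.
Qed.

Lemma sq_sqr D f : measurable D -> sq D f -> intg D (fun t => f t ^+ 2).
Proof.
move=> mD /Lfun2_integrable_sqr H; apply: (@integrable_mkcond _ _ _ mu D _ mD).2.
rewrite restrict_EFin; apply: eq_integrable H => // t _ /=.
by rewrite !patchE; case: ifP => //; rewrite expr0n.
Qed.

Lemma sqS D D' f : measurable D -> measurable D' -> D' `<=` D -> sq D f -> sq D' f.
Proof.
move=> mD mD' sD sf; apply: sq_intro => //.
  exact: measurable_funS (sq_meas mD sf).
exact: (intgS mD mD' sD (sq_sqr mD sf)).
Qed.

Lemma sq_cont a b f : {within `[a, b], continuous f} -> sq `[a, b] f.
Proof.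
move=> cf; apply: sq_intro => //.
  by have /measurable_EFinP := measurable_int _ (intg_cont cf).
apply: intg_cont; rewrite (_ : (fun _ => _) = (fun t => f t * f t)).
  by move=> t; exact: continuousM (cf t) (cf t).
by apply/funext => t; rewrite expr2.
Qed.

Lemma sqM D f g : measurable D -> sq D f -> sq D g -> intg D (fun t => f t * g t).
Proof.
move=> mD sf sg; have /Lfun1_integrable H := Lfun2_mul_Lfun1 sf sg.
apply: (@integrable_mkcond _ _ _ mu D _ mD).2; rewrite restrict_EFin.
apply: eq_integrable H => // t _ /=.
by rewrite !patchE; case: ifP => //; rewrite mul0r.
Qed.

Lemma sq_intg a b f : sq `[a, b] f -> intg `[a, b] f.
Proof.
move=> sf; have s1 : sq `[a, b] (fun=> 1 : R) by apply: sq_cont; exact: cst_continuous.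
by apply: eq_intg (sqM _ sf s1) => // t _; rewrite mulr1.
Qed.

Lemma sqD D f g : sq D f -> sq D g -> sq D (fun t => f t + g t).
Proof.
move=> sf sg; rewrite /sq (_ : _ \_ _ = (f \_ D) + (g \_ D)); first exact: (Lfun_addr_closed mu two_ge1).2.
by apply/funext => t; rewrite addrfctE !patchE; case: ifP => // _; rewrite addr0.
Qed.

Lemma sqZ D c f : sq D f -> sq D (fun t => c * f t).
Proof.
move=> sf; rewrite /sq (_ : _ \_ _ = c *: (f \_ D)); last first.
  by apply/funext => t; rewrite scalrfctE !patchE /=; case: ifP => // _; rewrite scaler0.
have [L0 LZ] := Lfun_submod_closed mu two_ge1.
by have := LZ c _ _ sf L0; rewrite addr0.
Qed.

Lemma sq_sum D n (F : 'I_n -> R -> R) : (forall i, sq D (F i)) ->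
  sq D (fun t => \sum_i F i t).
Proof.
move=> sF; rewrite /sq (_ : _ \_ _ = \sum_i (F i \_ D)); last first.
  apply/funext => t; rewrite fct_sumE patchE; case: ifP => tD.
    by apply: eq_bigr => i _; rewrite patchE tD.
  by rewrite big1 // => i _; rewrite patchE tD.
have [L0 LD] := Lfun_addr_closed mu two_ge1.
by apply: (@big_ind _ (fun h => h \in Lfun mu 2%:E)) => // i _; exact: sF.
Qed.

End IntervalIntegral.

(** * Absolute continuity and monotonicity *)

Section AbsoluteContinuity.
Context {R : realType}.
Notation mu := (@lebesgue_measure R).
Implicit Types (a b : R) (f g F : R -> R).

Lemma is_derive_bound F (t l e : R) : is_derive t 1 F l -> 0 < e ->
  exists2 r, 0 < r & forall h, `|h| < r -> `|F (t + h) - F t - l * h| <= e * `|h|.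
Proof.
move=> [dF <-] e0.
move/cvg_ex: (dF) => [k kE].
have -> : 'D_1 F t = k by apply/cvg_lim => //; exact: norm_hausdorff.
move/cvgrPdist_le: kE => /(_ _ e0).
rewrite /prop_near1 /= => /nbhs_ballP [r /= r0 rP].
exists r => // h hr.
have [->|h0] := eqVneq h 0; first by rewrite addr0 subrr mulr0 subrr normr0 mulr0.
have := rP h; rewrite /ball /= sub0r normrN => /(_ hr h0).
rewrite [h *: 1]mulr1 => H.
rewrite (_ : _ - _ - _ = - (h * (k - h^-1 * (F (h + t) - F t)))); last first.
  by rewrite (addrC h t); field.
rewrite normrN normrM mulrC ler_wpM2r //.
Qed.

(** Sums and products are instances: increments dominated by those of two
    absolutely continuous functions are small together with them. *)
Lemma ac_dominated C a b f g F : abs_continuous a b f -> abs_continuous a b g ->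
  (forall u v, a <= u -> u <= v -> v <= b ->
     `|F v - F u| <= C * (`|f v - f u| + `|g v - g u|)) ->
  abs_continuous a b F.
Proof.
move=> acf acg FC e e0.
pose C' := `|C| + 1; have C0 : 0 < C' by rewrite ltr_pwDr.
have e20 : 0 < e / (2 * C') by rewrite divr_gt0 // mulr_gt0.
have [df df0 fP] := acf _ e20; have [dg dg0 gP] := acg _ e20.
exists (Num.min df dg); first by rewrite lt_min df0.
move=> N u v uv dis; rewrite lt_min => /andP[/(fP _ _ _ uv dis) Sf /(gP _ _ _ uv dis) Sg].
apply: (@le_lt_trans _ _ (C' * (\sum_k `|f (v k) - f (u k)| + \sum_k `|g (v k) - g (u k)|))).
  rewrite -big_split mulr_sumr; apply: ler_sum => k _.
  have [au uvk vb] := uv k.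
  apply: (le_trans (FC _ _ au uvk vb)); apply: ler_wpM2r; first by rewrite addr_ge0.
  by rewrite /C' (le_trans (ler_norm C)) // lerDl.
have -> : e = C' * (e / (2 * C') + e / (2 * C')) by field; lra.
by rewrite ltr_pM2l // ltrD.
Qed.

Lemma ac_subitv a b a' b' f : a <= a' -> b' <= b ->
  abs_continuous a b f -> abs_continuous a' b' f.
Proof.
move=> aa bb acf e /acf [d d0 dP]; exists d => // N u v uv; apply: dP => k.
by have [? ? ?] := uv k; split=> //; [apply: le_trans aa _|apply: le_trans bb].
Qed.

Lemma ac_cst a b (c : R) : abs_continuous a b (fun=> c).
Proof.
move=> e e0; exists 1 => // N u v _ _ _.
by rewrite big1 // => k _; rewrite subrr normr0.
Qed.

Lemma ac_continuous a b f : abs_continuous a b f -> {within `[a, b], continuous f}.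
Proof.
move=> acf; apply/subspace_continuousP => t; rewrite /= in_itv /= => /andP[at_ tb].
apply/cvgrPdist_lt => e /acf [d d0 dP].
near=> s.
have : `[a, b]%classic s by near: s; exact: withinT.
have : `|t - s| < d.
  near: s; rewrite near_withinE; apply/nbhs_ballP; exists d => //.
rewrite /= in_itv /= => ts /andP[as_ sb].
have key u v : a <= u -> u <= v -> v <= b -> v - u < d -> `|f v - f u| < e.
  move=> au uv vb vu; have := dP 1%N (fun=> u) (fun=> v).
  rewrite !big_ord1; apply=> // k l; by rewrite !ord1.
case: (leP s t) => st.
  by apply: key => //; apply: le_lt_trans ts; rewrite ler_norm.
rewrite distrC; apply: key => //; first exact: ltW.
by apply: le_lt_trans ts; rewrite distrC ler_norm.
Unshelve. all: by end_near. Qed.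

Lemma within_bounded a b f : a <= b -> {within `[a, b], continuous f} ->
  exists2 C, 0 < C & forall t, a <= t <= b -> `|f t| <= C.
Proof.
move=> ab cf.
have cn : {within `[a, b], continuous (fun t => `|f t|)}.
  by move=> t; apply: (continuous_comp (cf t)); exact: norm_continuous.
have [c _ cP] := EVT_max ab cn.
exists (`|f c| + 1); first by rewrite ltr_pwDr.
by move=> t tab; rewrite (le_trans (cP t _)) ?lerDl // in_itv.
Qed.

Lemma acD a b f g : abs_continuous a b f -> abs_continuous a b g ->
  abs_continuous a b (fun t => f t + g t).
Proof.
move=> acf acg; apply: (@ac_dominated 1 _ _ _ _ _ acf acg) => u v _ _ _.
by rewrite mul1r opprD addrACA ler_normD.
Qed.

Lemma acM a b f g : a <= b -> abs_continuous a b f -> abs_continuous a b g ->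
  abs_continuous a b (fun t => f t * g t).
Proof.
move=> ab acf acg.
have [Cf Cf0 fP] := within_bounded ab (ac_continuous acf).
have [Cg Cg0 gP] := within_bounded ab (ac_continuous acg).
apply: (@ac_dominated (Cf + Cg) _ _ _ _ _ acf acg) => u v au uv vb.
rewrite (_ : _ - _ = (f v - f u) * g v + f u * (g v - g u)); last by ring.
apply: (le_trans (ler_normD _ _)); rewrite !normrM.
have fu : `|f u| <= Cf by apply: fP; rewrite au (le_trans uv).
have gv : `|g v| <= Cg by apply: gP; rewrite vb (le_trans au).
have := normr_ge0 (f v - f u); have := normr_ge0 (g v - g u).
have := normr_ge0 (f u); have := normr_ge0 (g v).
nra.
Qed.

Lemma ac_lipschitz C a b f :
  (forall u v, a <= u -> u <= v -> v <= b -> `|f v - f u| <= C * (v - u)) ->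
  abs_continuous a b f.
Proof.
move=> fC e e0.
pose C' := `|C| + 1; have C0 : 0 < C' by rewrite ltr_pwDr.
exists (e / C'); first by rewrite divr_gt0.
move=> N u v uv _ H.
apply: (@le_lt_trans _ _ (C' * (\sum_k (v k - u k)))).
  rewrite mulr_sumr; apply: ler_sum => k _.
  have [au uvk vb] := uv k.
  apply: (le_trans (fC _ _ au uvk vb)); apply: ler_wpM2r; first by rewrite subr_ge0.
  by rewrite /C' (le_trans (ler_norm C)) // lerDl.
by rewrite -ltr_pdivlMl // mulrC.
Qed.

Lemma ac_C1 a b f f' : a <= b ->
  (forall t : R, is_derive t 1 f (f' t)) -> {within `[a, b], continuous f'} ->
  abs_continuous a b f.
Proof.
move=> ab df cf'.
have [C C0 fP] := within_bounded ab cf'.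
apply: (@ac_lipschitz C) => u v au uv vb.
move: uv; rewrite le_eqVlt => /predU1P[->|uv]; first by rewrite !subrr normr0 mulr0.
have cf : {within `[u, v], continuous f}.
  apply: derivable_within_continuous => t _; exact: (@ex_derive _ _ _ _ _ _ _ (df t)).
have [c /andP[cu cv] ->] := MVT uv (fun t _ => df t) cf.
rewrite normrM (ger0_norm (_ : 0 <= v - u)); last by rewrite subr_ge0 ltW.
apply: ler_wpM2r; first by rewrite subr_ge0 ltW.
move: cu cv; rewrite !bnd_simp => cu cv.
by apply: fP; rewrite (le_trans au (ltW cu)) (le_trans (ltW cv)).
Qed.

(** Absolute continuity of the integral with respect to the measure of the set
    over which one integrates. *)
Lemma ac_primitive a b g : a <= b -> mu.-integrable `[a, b] (EFin \o g) ->
  abs_continuous a b (fun t => \int[mu]_(s in `[a, t]) g s).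
Proof.
move=> ab ig e e0.
have [d [d0 dP]] : exists d : R, 0 < d /\ forall A, measurable A ->
    (mu A < d%:E)%E -> \int[mu]_(x in A) `|(g \_ `[a, b]) x| < e.
  apply: integral_normr_continuous e0.
  rewrite (_ : EFin \o _ = (EFin \o g) \_ `[a, b]); last by rewrite restrict_EFin.
  exact/(integrable_mkcond _ _).1.
exists d => // N u v uv dis vud.
pose I k := `]u k, v k]%classic.
have mI k : measurable (I k) by exact: measurable_itv.
have Isub k : I k `<=` `[a, b]%classic.
  have [au uvk vb] := uv k.
  by move=> s; rewrite /I /= !in_itv /= => /andP[us sv]; rewrite (le_trans au (ltW us)) (le_trans sv).
have tI : trivIset [set: 'I_N] I.
  apply/trivIsetP => k l _ _ kl; rewrite -subset0 => s [] /=.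
  rewrite /I /= !in_itv /= => /andP[uk vk] /andP[ul vl].
  by have [H|H] := dis _ _ kl; lra.
pose A := \big[setU/set0]_(k < N) I k.
have mA : measurable A by apply: bigsetU_measurable.
have muA : (mu A < d%:E)%E.
  rewrite measure_bigsetU_ord // (eq_bigr (fun k => (v k - u k)%:E)).
    by rewrite sumEFin lte_fin.
  move=> k _; have [_ uvk _] := uv k.
  rewrite /I [LHS]lebesgue_measure_itv /= lte_fin.
  move: uvk; rewrite le_eqVlt => /predU1P[->|->]; last by rewrite EFinB.
  by rewrite ltxx subrr.
have := dP A mA muA; rewrite /Rintegral.
have mg : measurable_fun [set: R] (g \_ `[a, b]).
  have /measurable_EFinP mg := measurable_int _ ig.
  exact/(measurable_restrictT _ _).1.
rewrite ge0_integral_bigsetU //; last 3 first.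
- exact: index_enum_uniq.
- by apply: sub_trivIset tI.
- by apply/measurable_EFinP/measurableT_comp => //; exact: measurable_funTS mg.
have intI k : mu.-integrable (I k) (EFin \o g).
  exact: (@integrableS _ _ _ mu `[a, b]%classic _ _ (measurable_itv _) (mI k) (Isub k)).
have normE k : (\int[mu]_(x in I k) `|(g \_ `[a, b]) x|%:E)%E = (\int[mu]_(x in I k) `|g x|)%:E.
  rewrite /Rintegral fineK; last first.
    exact: (@integrable_fin_num _ _ _ mu (I k) (mI k) _ (intg_abs (intI k))).
  by apply: eq_integral => x /set_mem/Isub xab; rewrite patchE mem_set.
rewrite (eq_bigr _ (fun k _ => normE k)) sumEFin /= => /(le_lt_trans _); apply.
apply: ler_sum => k _; have [au uvk vb] := uv k.
rewrite Rintegral_itvB ?bnd_simp //; first exact: (Rint_norm (mI k) (intI k)).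
apply: intgS ig => //; exact: subset_itvl.
Qed.

(** Cover the null set of exceptional points by an open set [U] of small
    measure. The proof shows, by a supremum argument along the interval,
    that the increment of [F] over [a, t] is at most [eps * (t - a)] plus
    increments over disjoint intervals of total length at most the measure
    of [U]: at a point of [U] the interval is extended inside [U], at any
    other point the derivative bounds the new increment by [eps] times its
    length. Absolute continuity makes the increments inside [U] small. *)
Lemma ac_nonincreasing a b F : a <= b -> abs_continuous a b F ->
  {ae mu, forall t, a < t -> t < b -> exists2 l, is_derive t 1 F l & l <= 0} ->
  F b <= F a.
Proof.
move=> ab acF [N0 [mN0 N00 sN0]].
(* the end points are added, since nothing is known about the derivative there *)
pose N := N0 `|` [set a; b].
have mN : measurable N by apply: measurableU => //; apply: measurableU; exact: measurable_set1.
have null2 A B : measurable A -> measurable B -> mu A = 0 -> mu B = 0 -> mu (A `|` B) = 0.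
  move=> mA mB A0 B0; apply/eqP; rewrite eq_le measure_ge0 andbT.
  by apply: (le_trans (measureU2 _ mA mB)); have {1}-> : 0%E = (mu A + mu B)%E by rewrite A0 B0 adde0.
have Nnull : mu N = 0.
  apply: (null2) => //; first by apply: measurableU; exact: measurable_set1.
  by apply: null2; rewrite ?lebesgue_measure_set1 //; exact: measurable_set1.
apply/ler_addgt0Pl => e e0.
pose eps := e / (2 * (b - a + 1)).
have ba1 : 0 < b - a + 1 by rewrite ltr_wpDl // subr_ge0.
have eps0 : 0 < eps by rewrite divr_gt0 // mulr_gt0.
have e20 : 0 < e / 2 by rewrite divr_gt0.
have [d d0 dP] := acF _ e20.
have [U [oU NU muU]] : exists U : set R, [/\ open U, N `<=` U & (mu U < d%:E)%E].
  have [|U [oU NU UN]] := lebesgue_regularity_outer mN _ d0.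
    by rewrite [X in (X < _)%E]Nnull.
  exists U; split=> //; apply: le_lt_trans UN.
  have mU := open_measurable oU.
  rewrite -[X in (mu X <= _)%E](setDUK NU).
  apply: (le_trans (measureU2 _ mN (measurableD mU mN))).
  by rewrite -[leRHS]add0e -Nnull.
have mU := open_measurable oU.
(* the points up to which the increment of F is controlled *)
pose G t := a <= t <= b /\ exists M (u v : nat -> R),
  [/\ forall k, (k < M)%N -> [/\ a <= u k, u k <= v k & v k <= t],
      forall k l, (k < l < M)%N -> v k <= u l,
      ((\sum_(k < M) (v k - u k))%:E <= mu (U `&` `[a, t]))%E &
      F t - F a <= eps * (t - a) + \sum_(k < M) `|F (v k) - F (u k)|].
have Ga : G a.
  split; first by rewrite lexx.
  exists 0%N, (fun=> 0), (fun=> 0); split=> //.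
  - by rewrite big_ord0.
  - by rewrite big_ord0 !subrr mulr0 addr0.
have step s : a <= s <= b -> exists2 r, 0 < r &
    forall t s', G t -> s - r < t -> t <= s -> s <= s' -> s' <= b -> s' < s + r -> G s'.
  move=> /andP[as_ sb].
  have [Us|nUs] := pselect (U s).
    have [r r0 rU] : exists2 r : R, 0 < r & ball s r `<=` U.
      by apply/nbhs_ballP; exact: open_nbhs_nbhs.
    exists r => // t s' [/andP[at_ tb] [M [u [v [uv dis meas inc]]]]] srt ts ss' s'b s'r.
    have ts' : t <= s' by exact: le_trans ts _.
    split; first by rewrite s'b andbT (le_trans at_).
    exists M.+1, (fun k => if (k < M)%N then u k else t), (fun k => if (k < M)%N then v k else s').
    split.
    - move=> k _; case: ifP => kM; last by split.
      by have [? ? vt] := uv _ kM; split=> //; apply: le_trans vt _.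
    - move=> k l /andP[kl lM]; have kM : (k < M)%N by apply: (leq_trans kl); rewrite -ltnS.
      rewrite kM; case: ifP => lM'; first by apply: dis; rewrite kl.
      by have [_ _] := uv _ kM.
    - rewrite big_ord_recr /= ltnn (eq_bigr (fun k : 'I_M => v k - u k)); last first.
        by move=> k _; rewrite ltn_ord.
      apply: (@le_trans _ _ (mu ((U `&` `[a, t]) `|` `]t, s']))); last first.
        apply: le_measure; rewrite ?inE; [| |].
        - by apply: measurableU => //; exact: measurableI.
        - exact: measurableI.
        - move=> z [[Uz]|] /=; rewrite !in_itv /=.
            by move=> /andP[-> zt]; split=> //; rewrite (le_trans zt).
          move=> /andP[tz zs']; rewrite zs' (le_trans at_ (ltW tz)); split=> //.
          apply: rU; rewrite /ball /= ltr_norml; apply/andP; split; lra.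
      rewrite measureU //; [|exact: measurableI|]; last first.
        rewrite -subset0 => z [[_]] /=; rewrite !in_itv /= => /andP[_ zt] /andP[tz _].
        by move: (lt_le_trans tz zt); rewrite ltxx.
      rewrite EFinD leeD //.
      rewrite [leRHS]lebesgue_measure_itv /= lte_fin.
      move: ts'; rewrite le_eqVlt => /predU1P[->|->]; last by rewrite EFinB.
      by rewrite ltxx subrr.
    - rewrite big_ord_recr /= ltnn (eq_bigr (fun k : 'I_M => `|F (v k) - F (u k)|)); last first.
        by move=> k _; rewrite ltn_ord.
      have := ler_norm (F s' - F t).
      have : eps * (t - a) <= eps * (s' - a) by rewrite ler_pM2l // lerD2r.
      lra.
  have [l dl l0] : exists2 l, is_derive s 1 F l & l <= 0.
    have sN : ~ N s by move/NU.
    apply: contrapT => Hs; apply: sN; left; apply: sN0 => /= H; apply: Hs.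
    apply: H; rewrite lt_neqAle ?as_ ?sb andbT; apply/eqP => E; apply: nUs; apply: NU; right.
      by left.
    by right.
  have [r r0 rP] := is_derive_bound dl eps0.
  exists r => // t s' [/andP[at_ tb] [M [u [v [uv dis meas inc]]]]] srt ts ss' s'b s'r.
  have ts' : t <= s' by exact: le_trans ts _.
  split; first by rewrite s'b andbT (le_trans at_).
  exists M, u, v; split=> //.
  - by move=> k /uv[? ? vt]; split=> //; apply: le_trans vt _.
  - apply: le_trans meas _; apply: le_measure; rewrite ?inE; [exact: measurableI| exact: measurableI|].
    by move=> z [Uz] /=; rewrite !in_itv /= => /andP[-> zt]; split=> //; rewrite (le_trans zt).
  - have := rP (s' - s); rewrite ger0_norm ?subr_ge0 // => /(_ ltac:(lra)).
    rewrite (addrC s) subrK => /(le_trans (ler_norm _)) H1.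
    have := rP (t - s); rewrite ler0_norm ?subr_le0 // => /(_ ltac:(lra)).
    rewrite (addrC s) subrK -normrN => /(le_trans (ler_norm _)) H2.
    have : l * (s' - t) <= 0 by rewrite mulr_le0_ge0 // subr_ge0.
    lra.
have Gsup : has_sup [set t | G t].
  by split; [exists a|exists b => t [/andP[_]]].
pose s := sup [set t | G t].
have sab : a <= s <= b.
  apply/andP; split; first by apply: ub_le_sup => //; case: Gsup.
  by apply: ge_sup; [exists a|move=> t [/andP[_]]].
have [r r0 rP] := step s sab.
have [t Gt st] : exists2 t, G t & s - r < t.
  by have [t Gt] := sup_adherent r0 Gsup; exists t.
have ts : t <= s by apply: ub_le_sup => //; case: Gsup.
have sb : s = b.
  apply/eqP; rewrite eq_le (andP sab).2 /= leNgt; apply/negP => sb.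
  pose s' := Num.min b (s + r / 2).
  have ss' : s < s' by rewrite lt_min sb /= ltrDl divr_gt0.
  have Gs' : G s'.
    apply: (rP t) => //; first exact: ltW.
      by rewrite ge_min lexx.
    by rewrite gt_min; apply/orP; right; rewrite ltrD2l ltr_pdivrMr //; lra.
  have : s' <= s by apply: ub_le_sup => //; case: Gsup.
  by rewrite leNgt ss'.
have [_ [M [u [v [uv dis meas inc]]]]] : G b.
  by rewrite -sb; apply: (rP t) => //; rewrite ?(andP sab).2 // ltrDl.
have vud : \sum_(k < M) (v k - u k) < d.
  rewrite -lte_fin; apply: (le_lt_trans meas); apply: le_lt_trans muU.
  by apply: le_measure; rewrite ?inE //; do ?[exact: measurableI|exact: subIsetl].
have {vud} : \sum_(k < M) `|F (v k) - F (u k)| < e / 2.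
  apply: (dP M (fun k => u k) (fun k => v k)) => //.
  - by move=> k; apply: uv.
  - move=> k l; rewrite neq_ltn => /orP[kl|lk]; [left|right]; apply: dis.
      by rewrite kl ltn_ord.
    by rewrite lk ltn_ord.
have : eps * (b - a) <= e / 2.
  rewrite /eps -mulrA ler_pM2l // invfM mulrAC -mulrA ger_pMr ?invr_gt0 //.
  by rewrite ler_pdivrMr // mul1r lerDl.
lra.
Qed.

End AbsoluteContinuity.

(** * Sliding integrals and integration by parts *)

Section Convolution.
Context {R : realType}.
Notation mu := (@lebesgue_measure R).
Implicit Types (a b c : R) (f g F e y Y : R -> R).

Lemma is_derive_quad F (t l C : R) :
  (forall h, `|F (t + h) - F t - l * h| <= C * h ^+ 2) -> is_derive t 1 F l.
Proof.
move=> FC.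
suff H : (h^-1 *: (F (h *: 1 + t) - F t)) @[h --> 0^'] --> l.
  apply: DeriveDef; first by apply/cvg_ex; exists l.
  by apply/cvg_lim => //; exact: norm_hausdorff.
apply/cvgrPdist_le => e e0.
pose C' := `|C| + 1; have C0 : 0 < C' by rewrite ltr_pwDr.
rewrite /prop_near1 /=; apply/nbhs_ballP; exists (e / C'); first exact: divr_gt0.
move=> h; rewrite /ball /= sub0r normrN => hr h0.
have := FC h; rewrite [h *: 1]mulr1 => H.
rewrite (_ : _ - _ = - (h^-1 * (F (t + h) - F t - l * h))); last first.
  by rewrite (addrC h t) /GRing.scale /=; field.
rewrite normrN normrM normfV ler_pdivrMl ?normr_gt0 //.
apply: (le_trans H); rewrite -(real_normK (num_real h)) expr2 mulrA mulrC.
rewrite ler_pM2l ?normr_gt0 //.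
apply: (@le_trans _ _ (C' * `|h|)).
  by apply: ler_wpM2r => //; rewrite /C' (le_trans (ler_norm C)) // lerDl.
by rewrite -ler_pdivlMl // mulrC ltW.
Qed.

Lemma continuous_within f a b : continuous f -> {within `[a, b], continuous f}.
Proof. exact: continuous_subspaceT. Qed.

Lemma is_derive_continuous F F' : (forall t : R, is_derive t 1 F (F' t)) -> continuous F.
Proof.
move=> dF t; apply: differentiable_continuous.
by apply/derivable1_diffP; exact: (@ex_derive _ _ _ _ _ _ _ (dF t)).
Qed.

Lemma shift_continuous y (t : R) : continuous y -> continuous (fun s => y (t + s)).
Proof.
move=> cy s; apply: (@continuous_comp _ _ _ (fun s => t + s) y); last exact: cy.
by apply: cvgD; [exact: cvg_cst|exact: cvg_id].
Qed.

Lemma is_derive_shift Y (s t l : R) : is_derive ((t + s) : R) 1 Y l ->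
  is_derive t 1 (fun u => Y (u + s)) l.
Proof.
move=> dY.
have H : is_derive t 1 (fun u : R => u + s) 1.
  by have := is_deriveD (is_derive_id t (1 : R)) (is_derive_cst s t (1:R)); rewrite addr0.
by have := @is_derive1_comp R Y (fun u => u + s) t l 1 dY H; rewrite mulr1.
Qed.

Lemma conv_intg a b e y (t : R) : sq `[a, b] e -> continuous y ->
  intg `[a, b] (fun s => e s * y (t + s)).
Proof.
move=> se cy; apply: sqM => //; apply: sq_cont; apply: continuous_within.
exact: shift_continuous.
Qed.

(** A local bound that is uniform in both variables, which is what dominated
    convergence and differentiation under the integral need. *)
Lemma conv_bound a b y (t : R) : a <= b -> continuous y ->
  exists2 C, 0 < C & forall u s, t - 1 < u -> u < t + 1 -> a <= s -> s <= b -> `|y (u + s)| <= C.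
Proof.
move=> ab cy.
have [C C0 CP] := @within_bounded _ (t - 1 + a) (t + 1 + b) y ltac:(lra) (continuous_within cy).
by exists C => // u s tu ut as_ sb; apply: CP; apply/andP; split; lra.
Qed.

Lemma conv_continuous a b e y : a <= b -> sq `[a, b] e -> continuous y ->
  continuous (fun t => \int[mu]_(s in `[a, b]) (e s * y (t + s))).
Proof.
move=> ab se cy t.
have [C C0 CP] := conv_bound t ab cy.
apply: (@continuity_under_integral _ _ _ mu (fun u s => e s * y (u + s)) `[a, b]%classic
   _ (t - 1) (t + 1) _ _ (fun s => C * `|e s|)) => //.
- by move=> u _; exact: conv_intg.
- apply: aeW => s _ u _.
  apply: cvgM; first exact: cvg_cst.
  apply: (@continuous_comp _ _ _ (fun u => u + s) y); last exact: cy.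
  by apply: cvgD; [exact: cvg_id|exact: cvg_cst].
- by apply: intgZ => //; apply: intg_abs; exact: sq_intg.
- move=> u; rewrite /= in_itv /= => /andP[tu ut]; apply: aeW => s.
  rewrite /= in_itv /= => /andP[as_ sb].
  by rewrite normrM mulrC ler_wpM2r // CP.
- by rewrite inE /= in_itv /=; apply/andP; split; lra.
Qed.

Lemma conv_derive_C1 a b e y Y (t : R) : a <= b -> sq `[a, b] e -> continuous y ->
  (forall s : R, is_derive s 1 Y (y s)) ->
  is_derive t 1 (fun t => \int[mu]_(s in `[a, b]) (e s * Y (t + s)))
    (\int[mu]_(s in `[a, b]) (e s * y (t + s))).
Proof.
move=> ab se cy dY.
have [C C0 CP] := conv_bound t ab cy.
have cY := is_derive_continuous dY.
pose f u s := e s * Y (u + s).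
have df (u s : R) : is_derive u 1 (fun u => f u s) (e s * y (u + s)).
  by have := is_deriveZ (e s) (is_derive_shift (dY (u + s))).
have d1E u s : partial1of2 f u s = e s * y (u + s).
  by rewrite partial1of2E; exact: (@derive_val _ _ _ _ _ _ _ (df u s)).
have It : `]t - 1, t + 1[%classic t by rewrite /= in_itv /=; apply/andP; split; lra.
have int_f (u : R) : `]t - 1, t + 1[%classic u -> mu.-integrable `[a, b] (EFin \o f u).
  by move=> _; exact: conv_intg.
have der_f (u s : R) : `]t - 1, t + 1[%classic u -> `[a, b]%classic s -> derivable (f ^~ s) u 1.
  by move=> _ _; exact: (@ex_derive _ _ _ _ _ _ _ (df u s)).
have G0 s : 0 <= C * `|e s| by rewrite mulr_ge0 // ltW.
have iG : intg `[a, b] (fun s => C * `|e s|).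
  by apply: intgZ => //; apply: intg_abs; exact: sq_intg.
have Gub (u s : R) : `]t - 1, t + 1[%classic u -> `[a, b]%classic s ->
    `|partial1of2 f u s| <= C * `|e s|.
  rewrite /= !in_itv /= => /andP[tu ut] /andP[as_ sb].
  by rewrite d1E normrM mulrC ler_wpM2r // CP.
have mab : measurable (`[a, b]%classic : set R) by exact: measurable_itv.
have H1 := @derivable_under_integral _ _ _ mu _ _ mab _ _ _ It int_f der_f _ G0 iG Gub.
have H2 := @differentiation_under_integral _ _ _ mu _ _ mab _ _ _ It int_f der_f _ G0 iG Gub.
apply: DeriveDef; first exact: H1.
rewrite -derive1E H2; apply: Rint_eq => s _; exact: d1E.
Qed.

Lemma FTC2_C1 a b F f : a < b -> (forall t : R, is_derive t 1 F (f t)) -> continuous f ->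
  \int[mu]_(t in `[a, b]) f t = F b - F a.
Proof.
move=> ab dF cf; rewrite /Rintegral (@continuous_FTC2 _ f F) //.
- exact: continuous_within.
- have cF := is_derive_continuous dF.
  split; first by move=> t _; exact: (@ex_derive _ _ _ _ _ _ _ (dF t)).
    by apply: cvg_at_right_filter; exact: cF.
  by apply: cvg_at_left_filter; exact: cF.
- by move=> t _; rewrite derive1E; exact: (@derive_val _ _ _ _ _ _ _ (dF t)).
Qed.

Lemma Rint_split a b c f : a <= c -> c <= b -> intg `[a, b] f ->
  \int[mu]_(t in `[a, b]) f t = \int[mu]_(t in `[a, c]) f t + \int[mu]_(t in `[c, b]) f t.
Proof.
move=> ac cb fi.
have := @Rintegral_itvB R f (BLeft a) (BRight b) c fi; rewrite !bnd_simp => /(_ ac cb).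
rewrite Rintegral_itv_obnd_cbnd; first by move=> <-; rewrite addrC subrK.
by apply: (intgS _ _ _ fi) => //; apply: subset_itvr; rewrite bnd_simp.
Qed.

(** The integrals from [- N] agree up to constants on their common domain;
    normalizing them at 0 makes them fit together as [N] grows. *)
Lemma primitive_exists y : continuous y ->
  exists Y, forall t : R, is_derive t 1 Y (y t).
Proof.
move=> cy.
pose P N (s : R) := \int[mu]_(u in `[- N, s]) y u - \int[mu]_(u in `[- N, 0]) y u.
have ci u v : intg `[u, v] y by apply: intg_cont; exact: continuous_within.
have PE N M s : 0 <= N -> N <= M -> - N <= s -> P N s = P M s.
  move=> N0 NM Ns.
  have key r : - N <= r -> \int[mu]_(u in `[- M, r]) y u =
     \int[mu]_(u in `[- M, - N]) y u + \int[mu]_(u in `[- N, r]) y u.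
    by move=> Nr; apply: Rint_split => //; rewrite lerN2.
  rewrite /P (key s Ns) (key 0) ?oppr_le0 //.
  by rewrite opprD addrACA subrr add0r.
exists (fun s => P (`|s| + 1) s) => t.
pose N := `|t| + 2.
have nN (r : R) : - `|r| <= r by rewrite lerNl -(normrN r) ler_norm.
have tN : - N < t by have := nN t; rewrite /N; lra.
have dP : is_derive t 1 (P N) (y t).
  have [d1 d2] := @continuous_FTC1_closed R y (- N) t (t + 1) ltac:(lra) (ci _ _) tN (cy t).
  have dF : is_derive t 1 (fun s => \int[mu]_(u in `[- N, s]) y u) (y t).
    by apply: DeriveDef; [exact: d1|rewrite -derive1E; exact: d2].
  have := is_deriveB dF (is_derive_cst (\int[mu]_(u in `[- N, 0]) y u) t (1 : R)).
  by rewrite subr0.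
apply: near_eq_is_derive dP; apply/nbhs_ballP; exists 1 => //= s.
rewrite /ball /= => ts; apply/esym; apply: PE.
- by rewrite addr_ge0.
- rewrite /N; have := ler_normB t (t - s); rewrite opprB addrC subrK; lra.
- by have := nN s; lra.
Qed.

Definition C1fun Y y := continuous y /\ forall t : R, is_derive t 1 Y (y t).

(** Integration by parts against every C^1 function: the only consequence of
    absolute continuity of [f], with derivative [f'], that the sliding
    integrals below use. *)
Definition ibp a b f f' := forall Y y, C1fun Y y ->
  \int[mu]_(t in `[a, b]) (f t * y t) = f b * Y b - f a * Y a - \int[mu]_(t in `[a, b]) (f' t * Y t).

Lemma C1_shift Y y (t : R) : C1fun Y y -> C1fun (fun s => Y (t + s)) (fun s => y (t + s)).
Proof.
move=> [cy dY]; split; first exact: shift_continuous.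
move=> s; have -> : (fun s => Y (t + s)) = (fun s => Y (s + t)).
  by apply/funext => u; rewrite addrC.
by rewrite addrC; apply: is_derive_shift; rewrite addrC; exact: dY.
Qed.

(** As [y] need not be differentiable, write it as [Y'] and integrate by parts;
    the resulting expression contains [Y] only and can be differentiated
    under the integral sign. *)
Lemma conv_derive a b f f' y (t : R) : a <= b -> ibp a b f f' -> sq `[a, b] f' -> continuous y ->
  is_derive t 1 (fun t => \int[mu]_(s in `[a, b]) (f s * y (t + s)))
    (f b * y (t + b) - f a * y (t + a) - \int[mu]_(s in `[a, b]) (f' s * y (t + s))).
Proof.
move=> ab fibp sf' cy; have [Y dY] := primitive_exists cy.
have -> : (fun t => \int[mu]_(s in `[a, b]) (f s * y (t + s))) =
  (fun t => f b * Y (t + b) - f a * Y (t + a) - \int[mu]_(s in `[a, b]) (f' s * Y (t + s))).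
  by apply/funext => u; apply: fibp; exact: (C1_shift u (conj cy dY)).
apply: is_deriveB; last exact: conv_derive_C1.
by apply: is_deriveB; apply: is_deriveZ; exact: is_derive_shift.
Qed.

Lemma ibp_C1 a b f f' : a < b -> C1fun f f' -> ibp a b f f'.
Proof.
move=> ab [cf' df] Y y [cy dY].
have der F G : (forall t : R, is_derive t 1 F (G t)) -> derivable_oo_LRcontinuous F a b.
  move=> dF; have cF := is_derive_continuous dF.
  split; first by move=> t _; exact: (@ex_derive _ _ _ _ _ _ _ (dF t)).
    by apply: cvg_at_right_filter; exact: cF.
  by apply: cvg_at_left_filter; exact: cF.
have derE F G : (forall t : R, is_derive t 1 F (G t)) -> {in `]a, b[%R, F^`()%classic =1 G}.
  by move=> dF t _; rewrite derive1E; exact: (@derive_val _ _ _ _ _ _ _ (dF t)).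
apply: Rintegration_by_parts => //; try exact: continuous_within; try exact: derE.
  exact: der df.
exact: der dY.
Qed.

End Convolution.

(** * From weak derivatives to integration by parts *)

Section WeakDerivative.
Context {R : realType}.
Notation mu := (@lebesgue_measure R).
Implicit Types (a b c e t : R) (f g F y Y : R -> R).

Lemma within_eps a b c e g : {within `[a, b], continuous g} -> a <= c <= b -> 0 < e ->
  exists2 r, 0 < r & forall t, a <= t <= b -> `|t - c| < r -> `|g t - g c| <= e.
Proof.
move=> /subspace_continuousP cg acb e0.
have /cg/cvgrPdist_le/(_ _ e0) : `[a, b]%classic c by rewrite /= in_itv.
rewrite near_withinE => /nbhs_ballP[r /= r0 rP]; exists r => // t atb tc.
by rewrite distrC; apply: (rP t); rewrite /= ?in_itv // /ball /= distrC.
Qed.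

Lemma within_contM a b f g : {within `[a, b], continuous f} -> {within `[a, b], continuous g} ->
  {within `[a, b], continuous (fun t => f t * g t)}.
Proof. by move=> cf cg t; exact: continuousM (cf t) (cg t). Qed.

(* the quadratic B-spline step from 0 at c to 1 at c + e, and its derivative *)
Let ppart (x : R) := Num.max 0 x.
Let step c e t := 2 / e ^+ 2 *
  (ppart (t - c) ^+ 2 - 2 * ppart (t - (c + e / 2)) ^+ 2 + ppart (t - (c + e)) ^+ 2).
Let step' c e t := 4 / e ^+ 2 *
  (ppart (t - c) - 2 * ppart (t - (c + e / 2)) + ppart (t - (c + e))).

Let ppart_sqr_deriv c t : is_derive t 1 (fun t => ppart (t - c) ^+ 2) (2 * ppart (t - c)).
Proof.
apply: (@is_derive_quad _ _ _ _ 1) => h; rewrite mul1r.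
have -> : t + h - c = (t - c) + h by ring.
move: (t - c) => u; rewrite /ppart ler_norml.
by case: (leP 0 u) => hu; case: (leP 0 (u + h)) => huh; apply/andP; split; nra.
Qed.

Let ppart_cont c : continuous (fun t => ppart (t - c)).
Proof.
move=> t; apply: (@continuous_comp _ _ _ (fun t => t - c) ppart).
  by apply: cvgB; [exact: cvg_id|exact: cvg_cst].
by apply: continuous_max; [exact: cvg_cst|exact: cvg_id].
Qed.

Let step_deriv c e t : is_derive t 1 (step c e) (step' c e t).
Proof.
have d x := ppart_sqr_deriv x t.
have H := is_deriveZ (2 / e ^+ 2) (is_deriveD (is_deriveB (d c) (is_deriveZ 2 (d (c + e / 2)))) (d (c + e))).
apply: (@is_derive_eq _ _ _ _ _ _ _ _ H).
by rewrite /step' /GRing.scale /=; ring.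
Qed.

Let step'_cont c e : continuous (step' c e).
Proof.
move=> t; apply: cvgM; first exact: cvg_cst.
apply: cvgD; last exact: ppart_cont.
apply: cvgB; first exact: ppart_cont.
by apply: cvgM; [exact: cvg_cst|exact: ppart_cont].
Qed.

Let step_lo c e t : 0 < e -> t <= c -> step c e t = 0.
Proof.
move=> e0 tc; rewrite /step /ppart !max_l; [by ring|lra..].
Qed.

Let step_hi c e t : 0 < e -> c + e <= t -> step c e t = 1.
Proof.
move=> e0 tc; rewrite /step /ppart !max_r; [by field; lra|lra..].
Qed.

Let step_itv c e t : 0 < e -> 0 <= step c e t <= 1.
Proof.
move=> e0; rewrite /step; have e2 : 0 < e ^+ 2 by rewrite exprn_gt0.
have -> : t - (c + e / 2) = (t - c) - e / 2 by ring.
have -> : t - (c + e) = (t - c) - e by ring.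
move: (t - c) => u; rewrite mulrAC divr_ge0 ?(ltW e2) ?ler_pdivrMr // ?mul1r.
  rewrite /ppart; case: (leP 0 u) => h1; case: (leP 0 (u - e / 2)) => h2;
  case: (leP 0 (u - e)) => h3; nra.
rewrite /ppart; case: (leP 0 u) => h1; case: (leP 0 (u - e / 2)) => h2;
  case: (leP 0 (u - e)) => h3; nra.
Qed.

Let step'_ge0 c e t : 0 < e -> 0 <= step' c e t.
Proof.
move=> e0; apply: mulr_ge0; first by rewrite divr_ge0 // exprn_ge0 // ltW.
by rewrite /ppart; case: (leP 0 (t - c)) => h1; case: (leP 0 (t - (c + e / 2))) => h2;
  case: (leP 0 (t - (c + e))) => h3; lra.
Qed.

Let step'_supp c e t : 0 < e -> step' c e t != 0 -> c <= t <= c + e.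
Proof.
move=> e0 H; apply: contraT; rewrite negb_and -!ltNge => /orP[tc|tc]; move: H; rewrite /step' /ppart.
  by rewrite !max_l; [rewrite !mulr0 subr0 addr0 mulr0 eqxx|lra..].
rewrite !max_r; [|lra..].
rewrite (_ : t - c - _ + _ = 0) ?mulr0 ?eqxx //; by field.
Qed.

(** A probability density concentrated where [g] is close to [c] averages [g] to
    a value close to [c]. *)
Lemma mollify a b (K : R -> R) g c e : continuous K -> (forall t, 0 <= K t) ->
  \int[mu]_(t in `[a, b]) K t = 1 -> {within `[a, b], continuous g} ->
  (forall t, a <= t <= b -> K t != 0 -> `|g t - c| <= e) ->
  `|\int[mu]_(t in `[a, b]) (K t * g t) - c| <= e.
Proof.
move=> cK K0 K1 cg ge.
have cKw := @continuous_within R K a b cK.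
have cgc : {within `[a, b], continuous (fun t => g t - c)}.
  by move=> t; apply: cvgB; [exact: cg|exact: cvg_cst].
have mab : measurable (`[a, b]%classic : set R) by exact: measurable_itv.
have -> : \int[mu]_(t in `[a, b]) (K t * g t) - c = \int[mu]_(t in `[a, b]) (K t * (g t - c)).
  rewrite [RHS](@Rint_eq R `[a, b]%classic _ (fun t => K t * g t + (- c) * K t)); last by move=> t _; ring.
  rewrite RintD // ?RintZ // ?K1 ?mulr1 //.
  - exact: intg_cont.
  - by apply: intg_cont; exact: within_contM.
  - by apply: intgZ => //; exact: intg_cont.
have i1 : intg `[a, b] (fun t => K t * (g t - c)) by apply: intg_cont; exact: within_contM.
apply: (le_trans (Rint_norm mab i1)).
rewrite -[leRHS]mulr1 -K1 -RintZ //; last exact: intg_cont.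
apply: Rint_le => //; first exact: intg_abs.
  by apply: intgZ => //; exact: intg_cont.
move=> t; rewrite /= in_itv /= => tab.
rewrite normrM ger0_norm // mulrC.
have [->|Kt] := eqVneq (K t) 0; first by rewrite !mulr0.
by apply: ler_wpM2r => //; exact: ge.
Qed.

(** Test the weak derivative with [eta * Y], where the C^1 cut-off [eta] rises
    from 0 to 1 next to [a] and falls back next to [b]. As the transition
    zones shrink, the terms with [eta'] tend to the boundary values of [f *
    Y] ([mollify]) and the others to integrals over the whole interval. *)
Lemma weak_ibp a b f f' : a < b -> {within `[a, b], continuous f} -> sq `[a, b] f' ->
  (forall eta, test_function a b eta ->
     \int[mu]_(t in `[a, b]) (derive1 eta t * f t) = - \int[mu]_(t in `[a, b]) (eta t * f' t)) ->
  ibp a b f f'.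
Proof.
move=> ab cf sf' wf Y y [cy dY].
have mab : measurable (`[a, b]%classic : set R) by exact: measurable_itv.
have cY := is_derive_continuous dY.
have cYw := @continuous_within R Y a b cY.
have cyw := @continuous_within R y a b cy.
pose g t := f t * Y t.
have cg : {within `[a, b], continuous g} by exact: within_contM.
pose G t := f t * y t + f' t * Y t.
have i1 : intg `[a, b] (fun t => f t * y t) by apply: intg_cont; exact: within_contM.
have i2 : intg `[a, b] (fun t => f' t * Y t) by apply: sqM => //; exact: sq_cont.
have iG : intg `[a, b] G by exact: intgD.
suff H : \int[mu]_(t in `[a, b]) G t = g b - g a.
  by move: H; rewrite /G RintD // => <-; rewrite addrK.
apply/eqP; rewrite -subr_eq0 -normr_le0; apply/ler_addgt0Pl => e0 e00; rewrite addr0.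
pose dl := e0 / 6; have dl0 : 0 < dl by rewrite divr_gt0.
have aab : a <= a <= b by rewrite lexx ltW.
have abb : a <= b <= b by rewrite lexx ltW.
have [ra ra0 raP] := within_eps cg aab dl0.
have [rb rb0 rbP] := within_eps cg abb dl0.
have [rG rG0 rGP] := ac_primitive (ltW ab) (intg_abs iG) dl0.
(* width of the transitions: g is nearly constant next to the end points, the
   integral of |G| over the transitions is small, and they do not overlap *)
pose e := Num.min (Num.min (ra / 3) (rb / 3)) (Num.min (rG / 3) ((b - a) / 5)).
have e_gt0 : 0 < e by rewrite !lt_min !divr_gt0 // subr_gt0.
have [era erb erG eba] : [/\ e <= ra / 3, e <= rb / 3, e <= rG / 3 & e <= (b - a) / 5].
  by split; rewrite !ge_min lexx ?orbT.
have [ab2 aab2 ba2 d1 d2] : [/\ a + 2 * e <= b - 2 * e, a <= a + 2 * e,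
    b - 2 * e <= b, a + 2 * e - a < rG & b - (b - 2 * e) < rG] by split; lra.
have a2b : a + 2 * e <= b by exact: le_trans ab2 ba2.
have ab2' : a <= b - 2 * e by exact: le_trans aab2 ab2.
pose eta t := step (a + e) e t - step (b - 2 * e) e t.
have deta t : is_derive t 1 eta (step' (a + e) e t - step' (b - 2 * e) e t).
  exact: is_deriveB.
have eta_lo t : t <= a + e -> eta t = 0.
  by move=> ta; rewrite /eta !step_lo ?subrr //; lra.
have eta_hi t : b - e <= t -> eta t = 0.
  by move=> tb; rewrite /eta !step_hi ?subrr //; lra.
have eta_mid t : a + 2 * e <= t -> t <= b - 2 * e -> eta t = 1.
  by move=> ta tb; rewrite /eta step_hi ?step_lo ?subr0 //; lra.
have eta_bd t : `|1 - eta t| <= 2.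
  rewrite /eta; have /andP[? ?] := @step_itv (a + e) e t e_gt0.
  have /andP[? ?] := @step_itv (b - 2 * e) e t e_gt0.
  by rewrite ler_norml; apply/andP; split; lra.
have cdeta : continuous (fun t => step' (a + e) e t - step' (b - 2 * e) e t).
  by move=> t; apply: cvgB; exact: step'_cont.
have ceta := is_derive_continuous deta.
have dprod t : is_derive t 1 (fun t => eta t * Y t)
    ((step' (a + e) e t - step' (b - 2 * e) e t) * Y t + eta t * y t).
  apply: (@is_derive_eq _ _ _ _ _ _ _ _ (is_deriveM (deta t) (dY t))).
  by rewrite /GRing.scale /=; ring.
have dprodE : derive1 (fun t => eta t * Y t) =
    (fun t => (step' (a + e) e t - step' (b - 2 * e) e t) * Y t + eta t * y t).
  apply/funext => t; rewrite derive1E; exact: (@derive_val _ _ _ _ _ _ _ (dprod t)).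
have tst : test_function a b (fun t => eta t * Y t).
  split.
  - by move=> t; exact: (@ex_derive _ _ _ _ _ _ _ (dprod t)).
  - rewrite dprodE => t; apply: cvgD; apply: cvgM; [exact: cdeta|exact: cY|exact: ceta|exact: cy].
  - exists (a + e), (b - e); split; [lra|lra|].
    move=> t /= /negP; rewrite in_itv /= negb_and -!ltNge => /orP[H|H].
      by rewrite eta_lo ?mul0r // ltW.
    by rewrite eta_hi ?mul0r // ltW.
have cKa := @step'_cont (a + e) e.
have cKb := @step'_cont (b - 2 * e) e.
have cetaw := @continuous_within R eta a b ceta.
have iKa : intg `[a, b] (fun t => step' (a + e) e t * g t).
  by apply: intg_cont; apply: within_contM => //; exact: continuous_within.
have iKb : intg `[a, b] (fun t => step' (b - 2 * e) e t * g t).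
  by apply: intg_cont; apply: within_contM => //; exact: continuous_within.
have ieG : intg `[a, b] (fun t => eta t * G t).
  apply: (@eq_intg R `[a, b]%classic (fun t => (eta t * f t) * y t + f' t * (eta t * Y t))) => //.
    by move=> t _; rewrite /G; ring.
  apply: intgD => //; first by apply: intg_cont; apply: within_contM => //; exact: within_contM.
  by apply: sqM => //; apply: sq_cont; exact: within_contM.
(* the weak derivative tested with eta * Y *)
have key : \int[mu]_(t in `[a, b]) (step' (a + e) e t * g t) -
    \int[mu]_(t in `[a, b]) (step' (b - 2 * e) e t * g t) +
    \int[mu]_(t in `[a, b]) (eta t * G t) = 0.
  have ief : intg `[a, b] (fun t => eta t * Y t * f' t).
    by apply: sqM => //; apply: sq_cont; exact: within_contM.
  have := wf _ tst; rewrite dprodE => H.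
  have iN := intgZ (-1) mab iKb; have iaN := intgD mab iKa iN.
  rewrite -mulN1r -(RintZ _ mab iKb) -(RintD mab iKa iN) -(RintD mab iaN ieG).
  rewrite (@Rint_eq R `[a, b]%classic _ (fun t =>
    ((step' (a + e) e t - step' (b - 2 * e) e t) * Y t + eta t * y t) * f t + eta t * Y t * f' t)).
    rewrite RintD // ?H ?addNr //.
    apply: intg_cont; apply: within_contM => //; apply: continuous_within.
    by rewrite -dprodE; case: tst.
  by move=> t _; rewrite /g /G; ring.
have Ka1 : \int[mu]_(t in `[a, b]) step' (a + e) e t = 1.
  have := FTC2_C1 ab (step_deriv (a + e) e) (@step'_cont (a + e) e).
  by move=> ->; rewrite step_hi ?step_lo ?subr0 //; lra.
have Kb1 : \int[mu]_(t in `[a, b]) step' (b - 2 * e) e t = 1.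
  have := FTC2_C1 ab (step_deriv (b - 2 * e) e) (@step'_cont (b - 2 * e) e).
  by move=> ->; rewrite step_hi ?step_lo ?subr0 //; lra.
have Ha : `|\int[mu]_(t in `[a, b]) (step' (a + e) e t * g t) - g a| <= dl.
  apply: mollify => // [t|t tab /(step'_supp e_gt0) /andP[t1 t2]]; first exact: step'_ge0.
  by apply: raP => //; rewrite ger0_norm; clear - e_gt0 era t1 t2; lra.
have Hb : `|\int[mu]_(t in `[a, b]) (step' (b - 2 * e) e t * g t) - g b| <= dl.
  apply: mollify => // [t|t tab /(step'_supp e_gt0) /andP[t1 t2]]; first exact: step'_ge0.
  by apply: rbP => //; rewrite ler0_norm; clear - e_gt0 erb t1 t2; lra.
pose Phi t := \int[mu]_(s in `[a, t]) `|G s|.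
have iaG u v : a <= u -> v <= b -> intg `[u, v] (fun t => `|G t|).
  move=> au vb; apply: (intgS _ _ _ (intg_abs iG)) => // t; rewrite /= !in_itv /= => /andP[ut tv].
  by rewrite (le_trans au) // (le_trans tv).
have Phi_small u v : a <= u -> u <= v -> v <= b -> v - u < rG -> \int[mu]_(t in `[u, v]) `|G t| <= dl.
  move=> au uv vb vu.
  have -> : \int[mu]_(t in `[u, v]) `|G t| = Phi v - Phi u.
    by rewrite /Phi (Rint_split au uv (iaG a v (lexx a) vb)) [X in _ = X - _]addrC addrK.
  apply: (le_trans (ler_norm _)); apply: ltW.
  have := rGP 1%N (fun=> u) (fun=> v); rewrite !big_ord1; apply => // k l.
  by rewrite !ord1.
have HG : `|\int[mu]_(t in `[a, b]) G t - \int[mu]_(t in `[a, b]) (eta t * G t)| <= 4 * dl.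
  pose H t := (1 - eta t) * G t.
  have iH : intg `[a, b] H.
    apply: (@eq_intg R `[a, b]%classic (fun t => G t + (-1) * (eta t * G t))) => //.
      by move=> t _; rewrite /H; ring.
    by apply: intgD => //; exact: intgZ.
  have -> : \int[mu]_(t in `[a, b]) G t - \int[mu]_(t in `[a, b]) (eta t * G t) = \int[mu]_(t in `[a, b]) H t.
    rewrite -mulN1r -RintZ // -RintD //; last exact: intgZ.
    by apply: Rint_eq => t _; rewrite /H; ring.
  have iaH u v : a <= u -> v <= b -> intg `[u, v] (fun t => `|H t|).
    move=> au vb; apply: (intgS _ _ _ (intg_abs iH)) => // t; rewrite /= !in_itv /= => /andP[ut tv].
    by rewrite (le_trans au) // (le_trans tv).
  apply: (le_trans (Rint_norm mab iH)).
  rewrite (Rint_split aab2 a2b (iaH _ _ (lexx a) (lexx b))).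
  rewrite (Rint_split ab2 ba2 (iaH _ _ aab2 (lexx b))).
  have -> : \int[mu]_(t in `[a + 2 * e, b - 2 * e]) `|H t| = 0.
    rewrite (@Rint_eq R `[a + 2 * e, b - 2 * e]%classic _ (fun=> 0)).
      by rewrite Rint_cst ?mul0r.
    move=> t; rewrite /= in_itv /= => /andP[t1 t2].
    by rewrite /H eta_mid // subrr mul0r normr0.
  have side u v : a <= u -> u <= v -> v <= b -> v - u < rG -> \int[mu]_(t in `[u, v]) `|H t| <= 2 * dl.
    move=> au uv vb vu; apply: (@le_trans _ _ (\int[mu]_(t in `[u, v]) (2 * `|G t|))).
      apply: Rint_le => //; [exact: iaH|by apply: intgZ => //; exact: iaG|].
      by move=> t _; rewrite normrM ler_wpM2r.
    by rewrite RintZ //; [rewrite ler_pM2l //; exact: Phi_small|exact: iaG].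
  have := lerD (side _ _ (lexx a) aab2 a2b d1) (side _ _ ab2' ba2 (lexx b) d2).
  by rewrite add0r -mulrDl (_ : 2 + 2 = 4 :> R) // -natrD.
move: key Ha Hb HG; rewrite !ler_norml.
move: (\int[mu]_(t in _) (step' (a + e) e t * g t)) (\int[mu]_(t in _) (step' (b - 2 * e) e t * g t)) (\int[mu]_(t in _) (eta t * G t)) (\int[mu]_(t in _) G t) => I1 I2 I3 I4.
rewrite /dl; clear; move=> key /andP[? ?] /andP[? ?] /andP[? ?]; apply/andP; split; lra.
Qed.

End WeakDerivative.

(** * Integrals of matrix-valued functions and the Bessel inequality *)

Section MatrixIntegral.
Context {R : realType}.
Notation mu := (@lebesgue_measure R).

Definition mxintg (k l : nat) (D : set R) (F : R -> 'M[R]_(k, l)) :=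
  forall i j, intg D (fun t => F t i j).

Definition mxcont (k l : nat) (F : R -> 'M[R]_(k, l)) :=
  forall i j, continuous (fun t => F t i j).

Implicit Types (a b : R) (D : set R).

Lemma mxint_eq k l D (F G : R -> 'M[R]_(k, l)) : (forall t, D t -> F t = G t) ->
  mxint D F = mxint D G.
Proof. by move=> FG; apply/matrixP => i j; rewrite !mxE; apply: Rint_eq => t /FG ->. Qed.

Lemma mxintE k l D (F : R -> 'M[R]_(k, l)) i j :
  mxint D F i j = \int[mu]_(t in D) F t i j.
Proof. by rewrite mxE. Qed.

Lemma mxintg_mull k l m D (A : 'M[R]_(k, l)) (F : R -> 'M[R]_(l, m)) : measurable D ->
  mxintg D F -> mxintg D (fun t => A *m F t).
Proof.
move=> mD iF i j; under [X in intg _ X]eq_fun do rewrite mxE.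
by apply: intg_sum => // s; apply: intgZ.
Qed.

Lemma mxint_mull k l m D (A : 'M[R]_(k, l)) (F : R -> 'M[R]_(l, m)) : measurable D ->
  mxintg D F -> mxint D (fun t => A *m F t) = A *m mxint D F.
Proof.
move=> mD iF; apply/matrixP => i j; rewrite !mxE.
under eq_Rintegral do rewrite mxE.
rewrite Rint_sum //; last by move=> s; apply: intgZ.
by apply: eq_bigr => s _; rewrite mxE RintZ.
Qed.

Lemma mxintg_mulr k l m D (A : 'M[R]_(l, m)) (F : R -> 'M[R]_(k, l)) : measurable D ->
  mxintg D F -> mxintg D (fun t => F t *m A).
Proof.
move=> mD iF i j.
have -> : (fun t => (F t *m A) i j) = (fun t => \sum_s A s j * F t i s).
  by apply/funext => t; rewrite mxE; apply: eq_bigr => s _; rewrite mulrC.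
by apply: intg_sum => // s; apply: intgZ.
Qed.

Lemma mxint_mulr k l m D (A : 'M[R]_(l, m)) (F : R -> 'M[R]_(k, l)) : measurable D ->
  mxintg D F -> mxint D (fun t => F t *m A) = mxint D F *m A.
Proof.
move=> mD iF; apply/matrixP => i j; rewrite !mxE.
rewrite (@Rint_eq R D _ (fun t => \sum_s A s j * F t i s)); last first.
  by move=> t _; rewrite mxE; apply: eq_bigr => s _; rewrite mulrC.
rewrite Rint_sum //; last by move=> s; apply: intgZ.
by apply: eq_bigr => s _; rewrite mxE RintZ // mulrC.
Qed.

Lemma mxintD k l D (F G : R -> 'M[R]_(k, l)) : measurable D ->
  mxintg D F -> mxintg D G -> mxint D (fun t => F t + G t) = mxint D F + mxint D G.
Proof.
move=> mD iF iG; apply/matrixP => i j; rewrite !mxE -RintD //.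
by apply: Rint_eq => t _; rewrite mxE.
Qed.

Lemma mxintgN k l D (F : R -> 'M[R]_(k, l)) : measurable D ->
  mxintg D F -> mxintg D (fun t => - F t).
Proof.
move=> mD iF i j.
have -> : (fun t => (- F t) i j) = (fun t => -1 * F t i j) by apply/funext => t; rewrite mxE mulN1r.
exact: intgZ.
Qed.

Lemma mxintN k l D (F : R -> 'M[R]_(k, l)) : measurable D ->
  mxintg D F -> mxint D (fun t => - F t) = - mxint D F.
Proof.
move=> mD iF; apply/matrixP => i j; rewrite !mxE -mulN1r -RintZ //.
by apply: Rint_eq => t _; rewrite mxE mulN1r.
Qed.

Lemma mxint_tr k l D (F : R -> 'M[R]_(k, l)) : mxint D (fun t => (F t)^T) = (mxint D F)^T.
Proof. by apply/matrixP => i j; rewrite !mxE; apply: Rint_eq => t _; rewrite mxE. Qed.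

Lemma mxint_col k k' l D (F : R -> 'M[R]_(k, l)) (G : R -> 'M[R]_(k', l)) :
  mxint D (fun t => col_mx (F t) (G t)) = col_mx (mxint D F) (mxint D G).
Proof.
apply/matrixP => i j; rewrite !mxE; case: (split_ordP i) => s ->.
  by rewrite mxE; apply: Rint_eq => t _; rewrite col_mxEu.
by rewrite mxE; apply: Rint_eq => t _; rewrite col_mxEd.
Qed.

Lemma mxint_row k l l' D (F : R -> 'M[R]_(k, l)) (G : R -> 'M[R]_(k, l')) :
  mxint D (fun t => row_mx (F t) (G t)) = row_mx (mxint D F) (mxint D G).
Proof.
apply/matrixP => i j; rewrite !mxE; case: (split_ordP j) => s ->.
  by rewrite mxE; apply: Rint_eq => t _; rewrite row_mxEl.
by rewrite mxE; apply: Rint_eq => t _; rewrite row_mxEr.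
Qed.

Lemma L2_mull k l m D (A : 'M[R]_(k, l)) (F : R -> 'M[R]_(l, m)) :
  L2 D F -> L2 D (fun t => A *m F t).
Proof.
move=> sF i j.
have -> : (fun t => (A *m F t) i j) = (fun t => \sum_s A i s * F t s j).
  by apply/funext => t; rewrite mxE.
by apply: sq_sum => s; apply: sqZ; exact: sF.
Qed.

Lemma L2_mulr k l m D (A : 'M[R]_(l, m)) (F : R -> 'M[R]_(k, l)) :
  L2 D F -> L2 D (fun t => F t *m A).
Proof.
move=> sF i j.
have -> : (fun t => (F t *m A) i j) = (fun t => \sum_s A s j * F t i s).
  by apply/funext => t; rewrite mxE; apply: eq_bigr => s _; rewrite mulrC.
by apply: sq_sum => s; apply: sqZ; exact: sF.
Qed.

Lemma L2_add k l D (F G : R -> 'M[R]_(k, l)) : L2 D F -> L2 D G -> L2 D (fun t => F t + G t).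
Proof.
move=> sF sG i j; have -> : (fun t => (F t + G t) i j) = (fun t => F t i j + G t i j).
  by apply/funext => t; rewrite mxE.
exact: sqD (sF i j) (sG i j).
Qed.

Lemma L2_opp k l D (F : R -> 'M[R]_(k, l)) : L2 D F -> L2 D (fun t => - F t).
Proof.
move=> sF i j; have -> : (fun t => (- F t) i j) = (fun t => -1 * F t i j).
  by apply/funext => t; rewrite mxE mulN1r.
exact: sqZ (sF i j).
Qed.

Lemma L2_tr k l D (F : R -> 'M[R]_(k, l)) : L2 D F -> L2 D (fun t => (F t)^T).
Proof.
move=> sF i j; have -> : (fun t => ((F t)^T) i j) = (fun t => F t j i).
  by apply/funext => t; rewrite mxE.
exact: sF.
Qed.

Lemma L2_col k k' l D (F : R -> 'M[R]_(k, l)) (G : R -> 'M[R]_(k', l)) :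
  L2 D F -> L2 D G -> L2 D (fun t => col_mx (F t) (G t)).
Proof.
move=> sF sG i j; case: (split_ordP i) => s ->.
  by under [X in X \_ D]eq_fun do rewrite col_mxEu; exact: sF.
by under [X in X \_ D]eq_fun do rewrite col_mxEd; exact: sG.
Qed.

Lemma L2S k l D D' (F : R -> 'M[R]_(k, l)) : measurable D -> measurable D' -> D' `<=` D ->
  L2 D F -> L2 D' F.
Proof. by move=> mD mD' sD sF i j; apply: (sqS mD mD' sD); exact: sF. Qed.

Lemma mxcont_L2 k l a b (F : R -> 'M[R]_(k, l)) : mxcont F -> L2 `[a, b] F.
Proof. by move=> cF i j; apply: sq_cont; apply: continuous_within; exact: cF. Qed.

Lemma L2_mulmx k l m D (F : R -> 'M[R]_(k, l)) (G : R -> 'M[R]_(l, m)) : measurable D ->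
  L2 D F -> L2 D G -> mxintg D (fun t => F t *m G t).
Proof.
move=> mD sF sG i j; under [X in intg _ X]eq_fun do rewrite mxE.
by apply: intg_sum => // s; apply: sqM => //; [exact: sF|exact: sG].
Qed.

Lemma cont_sum (T : topologicalType) n (F : 'I_n -> T -> R) : (forall i, continuous (F i)) ->
  continuous (fun t => \sum_i F i t).
Proof.
elim: n F => [|n IH] F cF.
  by under [X in continuous X]eq_fun do rewrite big_ord0; exact: cst_continuous.
under [X in continuous X]eq_fun do rewrite big_ord_recl.
by move=> t; apply: cvgD; [exact: cF|apply: IH => i; exact: cF].
Qed.

Lemma mxcont_mull k l m (A : 'M[R]_(k, l)) (F : R -> 'M[R]_(l, m)) :
  mxcont F -> mxcont (fun t => A *m F t).
Proof.
move=> cF i j; have -> : (fun t => (A *m F t) i j) = (fun t => \sum_s A i s * F t s j).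
  by apply/funext => t; rewrite mxE.
apply: cont_sum => s t; by apply: cvgM; [exact: cvg_cst|exact: cF].
Qed.

Lemma mxcont_shift k l (F : R -> 'M[R]_(k, l)) (t : R) : mxcont F -> mxcont (fun s => F (t + s)).
Proof. by move=> cF i j; exact: (@shift_continuous R (fun s => F s i j) t (cF i j)). Qed.

Definition qf (k : nat) (A : 'M[R]_k) (u : 'cV[R]_k) : R := (u^T *m A *m u) 0 0.

(** Moving a bilinear form under a trace lets the integral act on the rank-one
    matrix alone. *)
Lemma mx11_tr (k : nat) (u v : 'cV[R]_k) (A : 'M[R]_k) : (u^T *m A *m v) 0 0 = \tr (A *m (v *m u^T)).
Proof. by rewrite mulmxA mxtrace_mulC mulmxA trace_mx11. Qed.

Lemma mxint_bilin D k (A : 'M[R]_k) (F G : R -> 'cV[R]_k) : measurable D -> L2 D F -> L2 D G ->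
  \int[mu]_(t in D) ((F t)^T *m A *m G t) 0 0 = \tr (A *m mxint D (fun t => G t *m (F t)^T)).
Proof.
move=> mD sF sG.
have iGF : mxintg D (fun t => G t *m (F t)^T) by apply: L2_mulmx => //; exact: L2_tr.
rewrite -mxint_mull // /mxtrace.
under [RHS]eq_bigr do rewrite mxE.
rewrite -Rint_sum //; last by move=> i; exact: mxintg_mull.
by apply: Rint_eq => t _; rewrite mx11_tr.
Qed.

Lemma bilin_intg D k l (A : 'M[R]_(k, l)) (F : R -> 'cV[R]_k) (G : R -> 'cV[R]_l) : measurable D ->
  L2 D F -> L2 D G -> intg D (fun t => ((F t)^T *m A *m G t) 0 0).
Proof. by move=> mD sF sG; apply: L2_mulmx => //; apply: L2_mulr; exact: L2_tr. Qed.

Lemma qfB k (A : 'M[R]_k) u v : qf A (u - v) =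
  qf A u + (-1) * (v^T *m A *m u) 0 0 + (-1) * (u^T *m A *m v) 0 0 + qf A v.
Proof.
rewrite /qf [(u - v)^T]raddfD raddfN /= mulmxDl mulmxDl mulmxDr mulmxDr !mulNmx !mulmxN opprK.
have E (a b c e : 'M[R]_1) : (a - b + (- c + e)) 0 0 = a 0 0 - b 0 0 - c 0 0 + e 0 0.
  by rewrite !mxE; ring.
rewrite E; ring.
Qed.

(** Nonnegativity of the integral of the weighted square of the projection error
    [y - Y^T e], where [Y] is the matrix of the coefficients. *)
Lemma bessel a b k n (e : R -> 'cV[R]_k) (y : R -> 'cV[R]_n) (A : 'M[R]_n) :
  A^T = A -> (forall u, 0 <= qf A u) ->
  L2 `[a, b] e -> L2 `[a, b] y ->
  mxint `[a, b] (fun t => e t *m (e t)^T) = 1%:M ->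
  \tr (mxint `[a, b] (fun t => e t *m (y t)^T) *m A *m
      (mxint `[a, b] (fun t => e t *m (y t)^T))^T) <= \int[mu]_(t in `[a, b]) qf A (y t).
Proof.
move=> sA A0 se sy ee; set Y := mxint _ (fun t => e t *m (y t)^T).
have mD : measurable (`[a, b]%classic : set R) by exact: measurable_itv.
have sYe : L2 `[a, b] (fun t => Y^T *m e t) by exact: L2_mull.
have sz : L2 `[a, b] (fun t => y t - Y^T *m e t) by apply: L2_add => //; exact: L2_opp.
have : 0 <= \int[mu]_(t in `[a, b]) qf A (y t - Y^T *m e t).
  by apply: Rintegral_ge0 => t _.
rewrite (@Rint_eq R `[a, b]%classic _ (fun t => qf A (y t) + (-1) * ((Y^T *m e t)^T *m A *m y t) 0 0
  + (-1) * ((y t)^T *m A *m (Y^T *m e t)) 0 0 + qf A (Y^T *m e t))); last first.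
  by move=> t _; exact: qfB.
have i1 := bilin_intg A mD sy sy; have i2 := bilin_intg A mD sYe sy.
have i3 := bilin_intg A mD sy sYe; have i4 := bilin_intg A mD sYe sYe.
rewrite !RintD //; do ?[exact: i1|exact: i4|exact: intgZ|apply: intgD => //].
rewrite !RintZ // !mxint_bilin //.
have key (w : R -> 'cV[R]_n) : L2 `[a, b] w -> mxint `[a, b] (fun t => Y^T *m e t *m (w t)^T) =
    Y^T *m mxint `[a, b] (fun t => e t *m (w t)^T).
  move=> sw; rewrite -mxint_mull //; first by apply: mxint_eq => t _; rewrite mulmxA.
  by apply: L2_mulmx => //; exact: L2_tr.
have -> : mxint `[a, b] (fun t => y t *m (Y^T *m e t)^T) = Y^T *m Y.
  transitivity ((mxint `[a, b] (fun t => Y^T *m e t *m (y t)^T))^T).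
    rewrite -[RHS]mxint_tr; apply: mxint_eq => t _.
    by rewrite [RHS]trmx_mul trmxK.
  by rewrite key // -/Y trmx_mul trmxK.
rewrite key // -/Y key //.
have -> : mxint `[a, b] (fun t => e t *m (Y^T *m e t)^T) = Y.
  rewrite -[RHS]mul1mx -ee -mxint_mulr //; last by apply: L2_mulmx => //; exact: L2_tr.
  by apply: mxint_eq => t _; rewrite trmx_mul trmxK mulmxA.
have -> : \tr (A *m (Y^T *m Y)) = \tr (Y *m A *m Y^T) by rewrite mulmxA mxtrace_mulC mulmxA.
rewrite /qf; lra.
Qed.

End MatrixIntegral.

(** * Vectorization and Kronecker products *)

Section Vectorization.
Context {R : realType}.

(** Row-major stacking, the order of [tensmx]: a Kronecker product acting on a
    stacked matrix is a product on the left and on the right. *)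
Definition vecC (k c : nat) (Y : 'M[R]_(k, c)) : 'cV[R]_(k * c) :=
  \col_i Y (mxtens_unindex i).1 (mxtens_unindex i).2.

Definition rowsof (k c : nat) (y : 'I_k -> 'cV[R]_c) : 'M[R]_(k, c) :=
  \matrix_(i, l) y i l 0.

Lemma sum_mxtens (k c : nat) (F : 'I_(k * c) -> R) :
  \sum_s F s = \sum_(i < k) \sum_(l < c) F (mxtens_index (i, l)).
Proof.
rewrite pair_big /= (reindex (@mxtens_index k c)) /=; first by apply: eq_bigr => -[i l].
by exists (@mxtens_unindex k c) => s _; rewrite (mxtens_indexK, mxtens_unindexK).
Qed.

Lemma vecCE k c (Y : 'M[R]_(k, c)) i l j : vecC Y (mxtens_index (i, l)) j = Y i l.
Proof. by rewrite mxE mxtens_indexK. Qed.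

Lemma tens_vecC k k' c c' (M : 'M[R]_(k', k)) (A : 'M[R]_(c', c)) Y :
  (M ⊗ A) *m vecC Y = vecC (M *m Y *m A^T).
Proof.
apply/matrixP => s j; case: (mxtens_indexP s) => i l.
rewrite vecCE !mxE sum_mxtens; under [RHS]eq_bigr do rewrite !mxE mulr_suml.
rewrite [RHS]exchange_big /=; apply: eq_bigr => i' _; apply: eq_bigr => l' _.
by rewrite tensmxE vecCE; ring.
Qed.

Lemma vecC_inner k c (Y Z : 'M[R]_(k, c)) : ((vecC Y)^T *m vecC Z) 0 0 = \tr (Y *m Z^T).
Proof.
rewrite mxE sum_mxtens /mxtrace; apply: eq_bigr => i _; rewrite mxE.
by apply: eq_bigr => l _; rewrite !mxE !mxtens_indexK.
Qed.

Lemma vecCD k c (Y Z : 'M[R]_(k, c)) : vecC (Y + Z) = vecC Y + vecC Z.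
Proof. by apply/matrixP => i j; rewrite !mxE. Qed.

Lemma mulmx_castmx a b b' c (e e' : b = b') (A : 'M[R]_(a, b)) (v : 'M[R]_(b, c)) :
  castmx (erefl, e) A *m castmx (e', erefl) v = A *m v.
Proof. by case: b' / e e' => e'; rewrite !castmx_id. Qed.

Lemma castmx2_mulmx a a' c (e e' e'' : a = a') (A : 'M[R]_a) (v : 'M[R]_(a, c)) :
  castmx (e, e') A *m castmx (e'', erefl) v = castmx (e, erefl) (A *m v).
Proof. by case: a' / e e' e'' => e' e''; rewrite !castmx_id. Qed.

Lemma castmx_vecC k k' c (e : k = k') (e' : (k * c = k' * c)%N) (Y : 'M[R]_(k, c)) :
  castmx (e', erefl) (vecC Y) = vecC (castmx (e, erefl) Y).
Proof. by case: k' / e e' => e'; rewrite !castmx_id. Qed.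

Lemma castmx_inner a a' c (e e' : a = a') (u : 'cV[R]_a) (v : 'M[R]_(a, c)) :
  (castmx (e, erefl) u)^T *m castmx (e', erefl) v = u^T *m v.
Proof. by case: a' / e e' => e'; rewrite !castmx_id. Qed.

Lemma castmx_irr a a' c (e e' : a = a') (u : 'M[R]_(a, c)) :
  castmx (e, erefl) u = castmx (e', erefl) u.
Proof. by rewrite (eq_irrelevance e e'). Qed.

Lemma col_vecC a b c (e : (a * c + b * c = (a + b) * c)%N) (Y : 'M[R]_(a, c)) (Z : 'M[R]_(b, c)) :
  castmx (e, erefl) (col_mx (vecC Y) (vecC Z)) = vecC (col_mx Y Z).
Proof.
apply/matrixP => s j; case: (mxtens_indexP s) => i l; rewrite vecCE castmxE cast_ord_id.
case: (split_ordP i) => i' ->.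
  rewrite (_ : cast_ord _ _ = lshift _ (mxtens_index (i', l))); last exact: val_inj.
  by rewrite !col_mxEu vecCE.
rewrite (_ : cast_ord _ _ = rshift _ (mxtens_index (i', l))); last first.
  by apply: val_inj; rewrite /= mulnDl addnA.
by rewrite !col_mxEd vecCE.
Qed.

Lemma vecC_rowsof1 c (e : (1 * c = c)%N) (Y : 'M[R]_(1, c)) : castmx (e, erefl) (vecC Y) = Y^T.
Proof.
apply/matrixP => l j; rewrite castmxE cast_ord_id.
rewrite (_ : cast_ord _ _ = mxtens_index (0, l)); last exact: val_inj.
by rewrite vecCE !mxE ord1.
Qed.

Lemma mxcol_Rank k (b : 'I_k -> nat) c (Y : forall i, 'M[R]_(b i, c)) i (j : 'I_(b i)) l :
  (\mxcol_i Y i) (tagnat.Rank i j) l = Y i j l.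
Proof. by have /matrixP/(_ j l) := mxcolK Y i; rewrite mxE. Qed.

Lemma vecC_mxcol k (b : 'I_k -> nat) c e (Y : forall i, 'M[R]_(b i, c)) :
  castmx (e, erefl) (\mxcol_i vecC (Y i)) = vecC (\mxcol_i Y i).
Proof.
apply/matrixP => s j; case: (mxtens_indexP s) => r l; rewrite vecCE castmxE cast_ord_id.
rewrite -[r in RHS]tagnat.sig2K mxcol_Rank.
rewrite (_ : cast_ord _ _ = tagnat.Rank (tagnat.sig1 r) (mxtens_index (tagnat.sig2 r, l))).
  by rewrite mxcol_Rank vecCE.
apply: ord_inj; rewrite [RHS]tagnat.RankEsum /= [X in (X * c)%N]tagnat.rect mulnDl addnA.
by rewrite big_distrl.
Qed.

Lemma vecC_rowsof k c e (y : 'I_k -> 'cV[R]_c) :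
  castmx (e, erefl) (\mxcol_i y i) = vecC (rowsof y).
Proof.
apply/matrixP => s j; case: (mxtens_indexP s) => r l; rewrite vecCE castmxE cast_ord_id [RHS]mxE.
rewrite (_ : cast_ord _ _ = @tagnat.Rank k (fun=> c) r l).
  by rewrite (@mxcol_Rank k (fun=> c)) ord1.
apply: ord_inj; rewrite [RHS](@tagnat.RankEsum k (fun=> c)) /=.
by rewrite (big_ord_narrow (ltnW (ltn_ord r))) sum_nat_const card_ord.
Qed.

Lemma row_cat_vecC a c k (F : 'I_k -> 'M[R]_(a, c)) y :
  row_cat F *m vecC (rowsof y) = \sum_i F i *m y i.
Proof. by rewrite /row_cat -(vecC_rowsof (sum_constn k c)) mulmx_castmx mul_mxrow_mxcol. Qed.

Lemma row_catn_vecC a c k (b : 'I_k -> nat) (F : forall i, 'M[R]_(a, b i * c)) (Y : forall i, 'M[R]_(b i, c)) :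
  row_catn F *m vecC (\mxcol_i Y i) = \sum_i F i *m vecC (Y i).
Proof. by rewrite /row_catn -(vecC_mxcol (sum_mulnl b c)) mulmx_castmx mul_mxrow_mxcol. Qed.

Lemma diag_cat_vecC c k (F : 'I_k -> 'M[R]_c) y :
  diag_cat F *m vecC (rowsof y) = vecC (rowsof (fun i => F i *m y i)).
Proof.
rewrite /diag_cat -(vecC_rowsof (sum_constn k c)) castmx2_mulmx mul_mxdiag_mxcol.
exact: (vecC_rowsof _ (fun i => F i *m y i)).
Qed.

Lemma diag_catn_vecC c k (b : 'I_k -> nat) (A : 'I_k -> 'M[R]_c) (Y : forall i, 'M[R]_(b i, c)) :
  diag_catn (fun i => (1%:M : 'M[R]_(b i)) ⊗ A i) *m vecC (\mxcol_i Y i) =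
  vecC (\mxcol_i (Y i *m (A i)^T)).
Proof.
rewrite /diag_catn -(vecC_mxcol (sum_mulnl b c)) castmx2_mulmx mul_mxdiag_mxcol.
rewrite -(vecC_mxcol (sum_mulnl b c)); congr (castmx _ _); apply: eq_mxcol => i.
by rewrite tens_vecC mul1mx.
Qed.

Lemma mxdiagr_mxcol k (a b : 'I_k -> nat) c (F : forall i, 'M[R]_(a i, b i)) (Y : forall i, 'M[R]_(b i, c)) :
  mxdiagr F *m \mxcol_i Y i = \mxcol_i (F i *m Y i).
Proof.
rewrite /mxdiagr mul_mxblock_mxrow; apply: eq_mxcol => i.
rewrite (bigD1 i) //= eqxx conform_mx_id big1 ?addr0 // => j ji.
by rewrite eq_sym (negbTE ji) mul0mx.
Qed.

Lemma diag_col_rowsof k (a : 'I_k -> nat) c (F : forall i, 'cV[R]_(a i)) (y : 'I_k -> 'cV[R]_c) :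
  diag_col F *m rowsof y = \mxcol_i (F i *m (y i)^T).
Proof.
have -> : rowsof y = castmx (sum_1n k, erefl) (\mxcol_i (y i)^T).
  apply/matrixP => r l; rewrite castmxE cast_ord_id [LHS]mxE.
  rewrite (_ : cast_ord _ _ = @tagnat.Rank k (fun=> 1%N) r 0).
    by rewrite (@mxcol_Rank k (fun=> 1%N)) !mxE.
  apply: ord_inj; rewrite [RHS](@tagnat.RankEsum k (fun=> 1%N)) /= addn0.
  by rewrite (big_ord_narrow (ltnW (ltn_ord r))) sum_nat_const card_ord muln1.
by rewrite /diag_col mulmx_castmx mxdiagr_mxcol.
Qed.

Lemma tr_rowsof k c (y z : 'I_k -> 'cV[R]_c) :
  \tr (rowsof y *m (rowsof z)^T) = \sum_i ((y i)^T *m z i) 0 0.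
Proof.
rewrite /mxtrace; apply: eq_bigr => i _; rewrite !mxE; apply: eq_bigr => l _.
by rewrite !mxE.
Qed.

Lemma trace_mxcol k (b : 'I_k -> nat) c (Y Z : forall i, 'M[R]_(b i, c)) :
  \tr ((\mxcol_i Y i) *m (\mxcol_i Z i)^T) = \sum_i \tr (Y i *m (Z i)^T).
Proof. by rewrite tr_mxcol mul_mxcol_mxrow mxtrace_mxblock. Qed.

Lemma rowsof_mulr k c c' (y : 'I_k -> 'cV[R]_c) (A : 'M[R]_(c', c)) :
  rowsof y *m A^T = rowsof (fun i => A *m y i).
Proof. by apply/matrixP => i l; rewrite !mxE; apply: eq_bigr => s _; rewrite !mxE mulrC. Qed.

Lemma tenscolI_vecC (k c : nat) (g : 'cV[R]_k) (x : 'cV[R]_c) :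
  tenscolI c g *m x = vecC (g *m x^T).
Proof.
have -> : x = castmx (mul1n c, erefl) (vecC x^T) by rewrite vecC_rowsof1 trmxK.
rewrite /tenscolI mulmx_castmx tens_vecC trmx1 mulmx1.
by rewrite vecC_rowsof1 trmxK.
Qed.

End Vectorization.

(** * Quadratic forms of block matrices and the stacked vector *)

Section Forms.
Context {R : realType}.

Lemma qf_Sy (k l : nat) (A : 'M[R]_(k, l)) (B : 'M[R]_(l, k)) u :
  qf (Sy (A *m B)) u = 2 * (u^T *m A *m (B *m u)) 0 0.
Proof.
rewrite /qf /Sy mulmxDr mulmxDl mxE mulmxA.
have -> : (u^T *m (A *m B)^T *m u) 0 0 = (u^T *m A *m B *m u) 0 0.
  rewrite -[in LHS](trmxK u) -trmx_mul -[in LHS]trmx_mul mxE trmxK.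
  by rewrite !mulmxA.
by rewrite -!mulmxA; ring.
Qed.

Lemma qfD k (A B : 'M[R]_k) u : qf (A + B) u = qf A u + qf B u.
Proof. by rewrite /qf mulmxDr mulmxDl mxE. Qed.

Lemma qfN k (A : 'M[R]_k) u : qf (- A) u = - qf A u.
Proof. by rewrite /qf mulmxN mulNmx mxE. Qed.

Lemma SyD k (A B : 'M[R]_k) : Sy (A + B) = Sy A + Sy B.
Proof. by rewrite /Sy linearD /= addrACA. Qed.

Lemma qf_dsum k l (A : 'M[R]_k) (B : 'M[R]_l) u v :
  qf (A ⊕ B) (col_mx u v) = qf A u + qf B v.
Proof.
rewrite /qf /mxdsum tr_col_mx mul_row_block !mulmx0 addr0 add0r mul_row_col mxE.
by [].
Qed.

Lemma mxdsum_col a b c e k (A : 'M[R]_(a, b)) (B : 'M[R]_(c, e)) (u : 'M[R]_(b, k)) v :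
  (A ⊕ B) *m col_mx u v = col_mx (A *m u) (B *m v).
Proof. by rewrite /mxdsum mul_block_col !mul0mx addr0 add0r. Qed.

Lemma qf0 k u : qf (0 : 'M[R]_k) u = 0.
Proof. by rewrite /qf mulmx0 mul0mx mxE. Qed.

Lemma qf_castmx k k' (e1 e2 e3 : k = k') (A : 'M[R]_k) u :
  qf (castmx (e1, e2) A) (castmx (e3, erefl) u) = qf A u.
Proof. by case: k' / e1 e2 e3 => e2 e3; rewrite !castmx_id. Qed.

Lemma qf_offdiag k l (P : 'M[R]_(k, l)) (F : 'M[R]_l) u v :
  qf (block_mx 0 P P^T F) (col_mx u v) = 2 * (u^T *m P *m v) 0 0 + qf F v.
Proof.
rewrite /qf tr_col_mx mul_row_block mul_row_col mulmx0 add0r mulmxDl mxE [X in _ + X]mxE.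
have -> : (v^T *m P^T *m u) 0 0 = (u^T *m P *m v) 0 0.
  have <- : (u^T *m P *m v)^T 0 0 = (u^T *m P *m v) 0 0 by rewrite mxE.
  by rewrite !trmx_mul trmxK mulmxA.
ring.
Qed.

Lemma col_castl a a' b c (e : a = a') (u : 'M[R]_(a, c)) (v : 'M[R]_(b, c)) :
  col_mx (castmx (e, erefl) u) v = castmx (f_equal (addn^~ b) e, erefl) (col_mx u v).
Proof. by case: a' / e; rewrite !castmx_id. Qed.

Lemma col_castr a a' b c (e : a = a') (u : 'M[R]_(a, c)) (v : 'M[R]_(b, c)) :
  col_mx v (castmx (e, erefl) u) = castmx (f_equal (addn b) e, erefl) (col_mx v u).
Proof. by case: a' / e; rewrite !castmx_id. Qed.

Lemma castmx_comp1 a b c l (e1 : a = b) (e2 : b = c) (u : 'M[R]_(a, l)) :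
  castmx (e2, erefl) (castmx (e1, erefl) u) = castmx (etrans e1 e2, erefl) u.
Proof. by case: c / e2; case: b / e1; rewrite !castmx_id. Qed.

Lemma castmx_mulr1 a b l k (e : a = b) (u : 'M[R]_(a, l)) (A : 'M[R]_(l, k)) :
  castmx (e, erefl) u *m A = castmx (e, erefl) (u *m A).
Proof. by case: b / e; rewrite !castmx_id. Qed.

Lemma col_vecC' a b c (Y : 'M[R]_(a, c)) (Z : 'M[R]_(b, c)) :
  col_mx (vecC Y) (vecC Z) = castmx (mulnDl a b c, erefl) (vecC (col_mx Y Z)).
Proof. by rewrite -(col_vecC (esym (mulnDl a b c))) castmx_comp1 castmx_id. Qed.

Lemma col_mxA' a b c l (u : 'M[R]_(a, l)) (v : 'M[R]_(b, l)) (w : 'M[R]_(c, l)) :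
  col_mx u (col_mx v w) = castmx (esym (addnA a b c), erefl) (col_mx (col_mx u v) w).
Proof. by rewrite col_mxA; congr castmx; congr (_, _); exact: eq_irrelevance. Qed.

(** The list of delayed states is read in two ways, as the current state
    followed by the delayed ones and as all but the longest delay followed
    by the longest; hence this lemma and the next. *)
Lemma rowsof_recl k c (y : 'I_k.+1 -> 'cV[R]_c) :
  rowsof y = col_mx (y ord0)^T (rowsof (fun i => y (lift ord0 i))).
Proof.
apply/matrixP => i l; rewrite !mxE; case: (@splitP 1 k i) => j ij.
  by have -> : i = ord0 by [apply: ord_inj; rewrite ij ord1]; rewrite mxE ord1.
by have -> : i = lift ord0 j by [exact: ord_inj]; rewrite mxE.
Qed.

Lemma rowsof_recr k c (y : 'I_k.+1 -> 'cV[R]_c) (e : (k + 1 = k.+1)%N) :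
  rowsof y = castmx (e, erefl) (col_mx (rowsof (fun i => y (widen_ord (leqnSn k) i))) (y ord_max)^T).
Proof.
apply/matrixP => i l; rewrite castmxE !mxE cast_ord_id; case: (splitP _) => j /= ij.
  by rewrite !mxE; congr (y _ _ _); apply: ord_inj; rewrite ij.
by have -> : i = ord_max by [apply: ord_inj; rewrite ij ord1 addn0]; rewrite mxE ord1.
Qed.

Lemma diag_cat_qf c k (F : 'I_k -> 'M[R]_c) y :
  qf (diag_cat F) (vecC (rowsof y)) = \sum_i qf (F i) (y i).
Proof.
rewrite /qf -mulmxA diag_cat_vecC vecC_inner tr_rowsof.
by apply: eq_bigr => i _; rewrite mulmxA.
Qed.

Lemma diag_catn_qf c k (b : 'I_k -> nat) (A : 'I_k -> 'M[R]_c) (Y : forall i, 'M[R]_(b i, c)) :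
  qf (diag_catn (fun i => (1%:M : 'M[R]_(b i)) ⊗ A i)) (vecC (\mxcol_i Y i)) =
  \sum_i \tr (Y i *m A i *m (Y i)^T).
Proof.
rewrite /qf -mulmxA diag_catn_vecC vecC_inner trace_mxcol.
by apply: eq_bigr => i _; rewrite trmx_mul trmxK mulmxA.
Qed.

End Forms.

Section Stack.
Context {R : realType} (n nu : nat) (d delta mu : 'I_nu -> nat).
Notation beta := (beta d delta mu).
Notation vk := (vkap d delta).
Implicit Types (y : 'I_nu.+1 -> 'cV[R]_n).

Lemma stack_dim : (nu.+1 + \sum_i vk i + \sum_i mu i)%N = beta.
Proof. by rewrite /Defs.beta sum_kap addnA. Qed.

(** The state part of the vector at which the matrix inequality is evaluated,
    kept as a matrix so that Kronecker products with identity factors become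
    matrix products. *)
Definition stack y (Yh : forall i, 'M[R]_(vk i, n)) (Ye : forall i, 'M[R]_(mu i, n)) : 'M[R]_(beta, n) :=
  castmx (stack_dim, erefl) (col_mx (col_mx (rowsof y) (\mxcol_i Yh i)) (\mxcol_i Ye i)).

Lemma stack_mulr n' y Yh Ye (A : 'M[R]_(n', n)) : stack y Yh Ye *m A^T =
  castmx (stack_dim, erefl) (col_mx (col_mx (rowsof (fun i => A *m y i)) (\mxcol_i (Yh i *m A^T))) (\mxcol_i (Ye i *m A^T))).
Proof. by rewrite castmx_mulr1 !mul_col_mx rowsof_mulr !mxcol_mul. Qed.

(** The blocks of the matrix inequality group the entries of the vector in four
    ways, matched by the lemmas [stack_dim1] to [stack_dim4]. *)
Lemma stack_dim1 y Yh Ye : vecC (stack y Yh Ye) = castmx (beta_dim1 n d delta mu, erefl)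
  (col_mx (col_mx (vecC (rowsof y)) (vecC (\mxcol_i Yh i))) (vecC (\mxcol_i Ye i))).
Proof.
rewrite !col_vecC' col_castl col_vecC' !castmx_comp1 (castmx_vecC stack_dim).
by [].
Qed.

Lemma stack_dim3 y Yh Ye : vecC (stack y Yh Ye) = castmx (beta_dim3 n d delta mu, erefl)
  (col_mx (vecC (col_mx (rowsof y) (\mxcol_i Yh i))) (vecC (\mxcol_i Ye i))).
Proof. by rewrite !col_vecC' !castmx_comp1 (castmx_vecC stack_dim). Qed.

Lemma stack_dim2 y Yh Ye : vecC (stack y Yh Ye) = castmx (beta_dim2 n d delta mu, erefl)
  (col_mx (col_mx (col_mx (y ord0) (vecC (rowsof (fun i => y (lift ord0 i))))) (vecC (\mxcol_i Yh i)))
     (vecC (\mxcol_i Ye i))).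
Proof.
rewrite -[y ord0 in RHS]trmxK -(vecC_rowsof1 (mul1n n)) !col_castl col_vecC' !col_castl col_vecC'.
rewrite !col_castl col_vecC' !castmx_comp1 (castmx_vecC stack_dim) -rowsof_recl.
by [].
Qed.

Lemma stack_dim4 y Yh Ye : exists z, vecC (stack y Yh Ye) = castmx (beta_dim4 n d delta mu, erefl)
  (col_mx (col_mx (vecC (rowsof (fun i => y (widen_ord (leqnSn nu) i)))) (y ord_max)) z).
Proof.
exists (vecC (castmx (esym (sum_kap d delta mu), erefl) (col_mx (\mxcol_i Yh i) (\mxcol_i Ye i)))).
rewrite -[y ord_max in RHS]trmxK -(vecC_rowsof1 (mul1n n)) !col_castr col_vecC' !col_castl col_vecC'.
rewrite !castmx_comp1 col_castr.
have e : (nu + 1 + (\sum_i vk i + \sum_i mu i) = beta)%N by rewrite addn1 addnA stack_dim.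
have e' : (nu + 1 + \sum_i kap d delta mu i = beta)%N by rewrite /Defs.beta (addnC 1%N).
rewrite (castmx_vecC e') castmx_comp1 col_mxA' castmx_comp1 /stack.
rewrite (rowsof_recr y (addn1 nu)) !col_castl castmx_comp1.
by congr vecC; apply: castmx_irr.
Qed.

End Stack.

(** * The quadratic form of the matrix inequality *)

Section Evaluation.
Context {R : realType} (n m p q nu : nat) (d delta mu : 'I_nu -> nat).
Context (S : plant R n m p q nu) (D : decomposition R n m p d delta mu) (L : factors R d delta mu).
Notation bt := (beta d delta mu).
Notation vk := (vkap d delta).
Implicit Types (y : 'I_nu.+1 -> 'cV[R]_n) (Yh : forall i, 'M[R]_(vk i, n)) (Ye : forall i, 'M[R]_(mu i, n)).

Lemma mulmx_stack_mulr n' (A : 'M[R]_(n', n)) y Yh Ye :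
  ((1%:M : 'M[R]_bt) ⊗ A) *m vecC (stack y Yh Ye) =
  vecC (stack (fun j => A *m y j) (fun i => Yh i *m A^T) (fun i => Ye i *m A^T)).
Proof. by rewrite tens_vecC mul1mx stack_mulr. Qed.

Lemma bold_stack a c (Xc : 'I_nu.+1 -> 'M[R]_(a, c)) (Xh : forall i, 'M[R]_(a, kap d delta mu i * c))
   (Y : 'M[R]_(a, q)) (x : 'I_nu.+1 -> 'cV[R]_c) (Zh : forall i, 'M[R]_(vk i, c))
   (Ze : forall i, 'M[R]_(mu i, c)) (v : 'cV[R]_q) :
  bold S D L Xc Xh Y *m col_mx (vecC (stack x Zh Ze)) v =
  \sum_j Xc j *m x j
  + \sum_i Xh i *m vecC (T_ S D L i *m Zh i + Tt_ L i *m Ze i) + Y *m v.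
Proof.
rewrite /bold mul_row_col stack_dim1 mulmx_castmx !mul_row_col row_cat_vecC.
rewrite !row_catn_vecC; congr (_ + _); rewrite -addrA; congr (_ + _).
rewrite -big_split /=; apply: eq_bigr => i _.
move: (T_ S D L i) (Tt_ L i) => T T'.
by rewrite -!mulmxA -mulmxDr !tens_vecC trmx1 !mulmx1 -vecCD.
Qed.

(** The projections on [f_i] recovered from those on the orthonormalized [h_i],
    since [f_i] is a block of [h_i]. *)
Definition Xi_ Yh i : 'M[R]_(d i, n) :=
  invmx (Lf L i) *m (row_mx (0 : 'M[R]_(d i, delta i)) (1%:M : 'M[R]_(d i)) *m Lh L i) *m Yh i.

(** The time derivative of [Xi_] that integration by parts predicts: boundary
    values of [f_i], and [M_i h_i] under the integral. *)
Definition dXi_ y Yh i : 'M[R]_(d i, n) :=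
  invmx (Lf L i) *m f_ D i (- rprev S i) *m (y (widen_ord (leqnSn nu) i))^T
  - (invmx (Lf L i) *m f_ D i (- rcur S i) *m (y (lift ord0 i))^T
     + invmx (Lf L i) *m M_ D i *m Lh L i *m Yh i).

Lemma Ihat_vecC Yh : Ihat n L *m vecC (\mxcol_i Yh i) = vecC (\mxcol_i Xi_ Yh i).
Proof. by rewrite /Ihat tens_vecC trmx1 mulmx1 mxdiagr_mxcol. Qed.

Lemma acP_stack (P1 : 'M[R]_n) (P2 : 'M[R]_(n, (\sum_i d i) * n)) y Yh Ye (w : 'cV[R]_q) (z : 'cV[R]_m) :
  acP m q L P1 P2 *m col_mx (col_mx (vecC (stack y Yh Ye)) w) z =
  P1 *m y ord0 + P2 *m vecC (\mxcol_i Xi_ Yh i).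
Proof.
rewrite /acP !mul_row_col !mul0mx !addr0 stack_dim2 mulmx_castmx !mul_row_col !mul0mx !addr0.
by rewrite -mulmxA Ihat_vecC.
Qed.

Lemma boldM_stack y Yh : boldM S D L *m col_mx (rowsof y) (\mxcol_i Yh i) = \mxcol_i dXi_ y Yh i.
Proof.
rewrite /boldM mulmxBl !mul_row_col mul0mx addr0.
have -> : castmx (erefl, addnC nu 1) (row_mx (diag_col (fun i => invmx (Lf L i) *m f_ D i (- rprev S i)))
            (0 : 'cV[R]_(\sum_i d i))) *m rowsof y =
   \mxcol_i (invmx (Lf L i) *m f_ D i (- rprev S i) *m (y (widen_ord (leqnSn nu) i))^T).
  by rewrite (rowsof_recr y (addnC nu 1)) mulmx_castmx mul_row_col mul0mx addr0 diag_col_rowsof.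
rewrite rowsof_recl mul_row_col mul0mx add0r diag_col_rowsof mxdiagr_mxcol.
by rewrite -mxcolD -mxcolB.
Qed.

Lemma acXi_stack (Q Rr : 'I_nu -> 'M[R]_n) (J3 : 'M[R]_q) y Yh Ye (w : 'cV[R]_q) :
  qf (acXi d delta mu S Q Rr J3) (col_mx (vecC (stack y Yh Ye)) w) =
  \sum_i qf (Q i + (rcur S i - rprev S i) *: Rr i) (y (widen_ord (leqnSn nu) i))
  - \sum_i qf (Q i) (y (lift ord0 i))
  - \sum_i \tr (Yh i *m Rr i *m (Yh i)^T) - \sum_i \tr (Ye i *m Rr i *m (Ye i)^T) - qf J3 w.
Proof.
rewrite /acXi qfD qfN !qf_dsum qf0 addr0.
have [z ez] := stack_dim4 y Yh Ye; rewrite {1}ez qf_castmx !qf_dsum !qf0 !addr0.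
rewrite stack_dim2 qf_castmx !qf_dsum qf0 add0r.
have E1 : qf (diag_cat Q + diag_cat Rr *m Lam S) (vecC (rowsof (fun i => y (widen_ord (leqnSn nu) i)))) =
    \sum_i qf (Q i + (rcur S i - rprev S i) *: Rr i) (y (widen_ord (leqnSn nu) i)).
  rewrite /qf mulmxDr mulmxDl -!mulmxA /Lam !diag_cat_vecC mxE !vecC_inner !tr_rowsof -big_split /=.
  apply: eq_bigr => i _; rewrite mulmxDr mulmxDl [RHS]mxE mul_scalar_mx !mulmxA.
  by rewrite -!scalemxAr -scalemxAl.
rewrite E1 diag_cat_qf !diag_catn_qf; lra.
Qed.

Lemma acPhi_stack (J1 Jt : 'M[R]_m) (J2 : 'M[R]_(m, q)) (J3 : 'M[R]_q) (X : 'M[R]_n)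
    (P2 : 'M[R]_(n, (\sum_i d i) * n)) (P3 : 'M[R]_((\sum_i d i) * n)) (Q Rr : 'I_nu -> 'M[R]_n)
    (V : 'M[R]_(p, n)) y Yh Ye (w : 'cV[R]_q) (z : 'cV[R]_m) : issym P3 ->
  let th := col_mx (vecC (stack y Yh Ye)) w in
  qf (acPhi S D L J1 Jt J2 J3 X P2 P3 Q Rr V) (col_mx th z) =
  2 * ((P2^T *m y ord0 + P3 *m vecC (\mxcol_i Xi_ Yh i))^T *m vecC (\mxcol_i dXi_ y Yh i)) 0 0
  + 2 * ((z^T *m Jt - w^T *m J2^T) *m (acSigma S D L X V *m th)) 0 0
  + qf (acXi d delta mu S Q Rr J3) th + qf J1 z.
Proof.
move=> sP3 /=; set th := col_mx (vecC _) w.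
rewrite /acPhi SyD [LHS]qfD [X in X + _]qfD !qf_Sy qf_dsum addrA; congr (2 * _ + 2 * _ + _ + _).
  rewrite !tr_col_mx !mul_row_col !mulmx0 !mul0mx !addr0.
  rewrite stack_dim3 mulmx_castmx !mul_row_col mul0mx addr0 tens_vecC trmx1 mulmx1 boldM_stack.
  congr ((_ *m _) 0 0).
  rewrite -stack_dim3 stack_dim2 castmx_inner !tr_col_mx !mul_row_col !mulmx0 !addr0.
  by rewrite linearD /= !trmx_mul trmxK sP3 -Ihat_vecC trmx_mul mulmxA.
rewrite !tr_col_mx !mul_row_col mulmx0 add0r mul0mx addr0.
by congr ((_ *m _) 0 0); rewrite mulmxN addrC.
Qed.

Lemma bold_gain a (Xc : 'I_nu.+1 -> 'M[R]_(a, n)) (Xh : forall i, 'M[R]_(a, kap d delta mu i * n))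
   (Y : 'M[R]_(a, q)) (Uc : 'I_nu.+1 -> 'M[R]_(a, p)) (Uh : forall i, 'M[R]_(a, kap d delta mu i * p))
   (X : 'M[R]_n) (V : 'M[R]_(p, n)) y Yh Ye (w : 'cV[R]_q) :
  (bold S D L Xc Xh Y *m (((1%:M : 'M[R]_bt) ⊗ X) ⊕ (1%:M : 'M[R]_q)) +
   bold S D L Uc Uh 0 *m (((1%:M : 'M[R]_bt) ⊗ V) ⊕ (0 : 'M[R]_q))) *m col_mx (vecC (stack y Yh Ye)) w =
  \sum_j (Xc j *m (X *m y j) + Uc j *m (V *m y j)) +
  \sum_i (Xh i *m vecC ((T_ S D L i *m Yh i + Tt_ L i *m Ye i) *m X^T) +
          Uh i *m vecC ((T_ S D L i *m Yh i + Tt_ L i *m Ye i) *m V^T)) + Y *m w.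
Proof.
have stackT c (W : 'M[R]_(c, n)) i : T_ S D L i *m (Yh i *m W^T) + Tt_ L i *m (Ye i *m W^T) =
    (T_ S D L i *m Yh i + Tt_ L i *m Ye i) *m W^T.
  by move: (T_ S D L i) (Tt_ L i) => T T'; rewrite !mulmxA -mulmxDl.
rewrite mulmxDl -!mulmxA !mxdsum_col !mulmx_stack_mulr mul1mx mul0mx.
rewrite !bold_stack mulmx0 addr0 addrAC [X in X + _]addrACA -!big_split /=.
by congr (_ + _ + _); apply: eq_bigr => i _; rewrite !stackT.
Qed.

Lemma acSigma_stack (X : 'M[R]_n) (V : 'M[R]_(p, n)) y Yh Ye (w : 'cV[R]_q) :
  acSigma S D L X V *m col_mx (vecC (stack y Yh Ye)) w =
  \sum_j (C_ S j *m (X *m y j) + E_ S j *m (V *m y j)) +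
  \sum_i (Ch_ D i *m vecC ((T_ S D L i *m Yh i + Tt_ L i *m Ye i) *m X^T) +
          Eh_ D i *m vecC ((T_ S D L i *m Yh i + Tt_ L i *m Ye i) *m V^T)) + D2 S *m w.
Proof. exact: bold_gain. Qed.

Lemma acPi_stack (X : 'M[R]_n) (V : 'M[R]_(p, n)) y Yh Ye (w : 'cV[R]_q) (z : 'cV[R]_m) :
  acPi S D L X V *m col_mx (col_mx (vecC (stack y Yh Ye)) w) z =
  \sum_j (A_ S j *m (X *m y j) + B_ S j *m (V *m y j)) +
  \sum_i (Ah_ D i *m vecC ((T_ S D L i *m Yh i + Tt_ L i *m Ye i) *m X^T) +
          Bh_ D i *m vecC ((T_ S D L i *m Yh i + Tt_ L i *m Ye i) *m V^T)) + D1 S *m w.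
Proof. by rewrite /acPi mul_row_col mul0mx addr0; exact: bold_gain. Qed.

(** Along vectors that satisfy the closed-loop equation the slack term with the
    multipliers vanishes, whatever the multipliers are. *)
Lemma lmi_stack (J1 Jt : 'M[R]_m) (J2 : 'M[R]_(m, q)) (J3 : 'M[R]_q) (N : 'M[R]_(bt * n + q + m, n))
    (X P1 : 'M[R]_n) (P2 : 'M[R]_(n, (\sum_i d i) * n)) (P3 : 'M[R]_((\sum_i d i) * n)) (Q Rr : 'I_nu -> 'M[R]_n)
    (V : 'M[R]_(p, n)) y Yh Ye (w : 'cV[R]_q) (z : 'cV[R]_m) (u0 : 'cV[R]_n) : issym P3 ->
  let th := col_mx (vecC (stack y Yh Ye)) w in
  X *m u0 = acPi S D L X V *m col_mx th z ->
  qf (Sy (col_mx 1%:M N *m row_mx (- X) (acPi S D L X V))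
     + block_mx 0 (acP m q L P1 P2) (acP m q L P1 P2)^T (acPhi S D L J1 Jt J2 J3 X P2 P3 Q Rr V))
     (col_mx u0 (col_mx th z)) =
  2 * (u0^T *m (P1 *m y ord0 + P2 *m vecC (\mxcol_i Xi_ Yh i))) 0 0
  + 2 * ((P2^T *m y ord0 + P3 *m vecC (\mxcol_i Xi_ Yh i))^T *m vecC (\mxcol_i dXi_ y Yh i)) 0 0
  + 2 * ((z^T *m Jt - w^T *m J2^T) *m (acSigma S D L X V *m th)) 0 0
  + \sum_i qf (Q i + (rcur S i - rprev S i) *: Rr i) (y (widen_ord (leqnSn nu) i))
  - \sum_i qf (Q i) (y (lift ord0 i))
  - \sum_i \tr (Yh i *m Rr i *m (Yh i)^T) - \sum_i \tr (Ye i *m Rr i *m (Ye i)^T) - qf J3 w + qf J1 z.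
Proof.
move=> sP3 th Xu.
rewrite [LHS]qfD qf_Sy mul_row_col mulNmx Xu addNr mulmx0 mxE mulr0 add0r.
rewrite qf_offdiag acPhi_stack // acXi_stack -mulmxA acP_stack.
lra.
Qed.

End Evaluation.

(** * Bounds for quadratic forms *)

Section Coercivity.
Context {R : realType}.

Definition sqn (k : nat) (u : 'cV[R]_k) : R := \sum_i u i 0 ^+ 2.

Lemma sqn_ge0 k (u : 'cV[R]_k) : 0 <= sqn u.
Proof. by apply: sumr_ge0 => i _; rewrite sqr_ge0. Qed.

Lemma sqnE k (u : 'cV[R]_k) : sqn u = (u^T *m u) 0 0.
Proof. by rewrite mxE; apply: eq_bigr => i _; rewrite mxE expr2. Qed.

Lemma sqn_col k l (u : 'cV[R]_k) (v : 'cV[R]_l) : sqn (col_mx u v) = sqn u + sqn v.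
Proof. by rewrite !sqnE tr_col_mx mul_row_col mxE. Qed.

Lemma sqn_vecC k c (Y : 'M[R]_(k, c)) : sqn (vecC Y) = \tr (Y *m Y^T).
Proof. by rewrite sqnE vecC_inner. Qed.

Lemma sqr_le_sqn k (u : 'cV[R]_k) i : u i 0 ^+ 2 <= sqn u.
Proof. by rewrite /sqn (bigD1 i) //= lerDl sumr_ge0 // => j _; rewrite sqr_ge0. Qed.

Lemma qfE k (M : 'M[R]_k) (u : 'cV[R]_k) : qf M u = \sum_j (\sum_i u i 0 * M i j) * u j 0.
Proof.
rewrite /qf mxE; apply: eq_bigr => j _; rewrite mxE; congr (_ * _).
by apply: eq_bigr => i _; rewrite mxE.
Qed.

Lemma qf_le k (M : 'M[R]_k) : exists2 C : R, 0 < C & forall u, `|qf M u| <= C * sqn u.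
Proof.
pose C := 1 + \sum_j \sum_i `|M i j|.
have C0 : 0 < C by rewrite ltr_wpDr // !sumr_ge0 // => j _; rewrite sumr_ge0.
exists C => // u; rewrite qfE.
apply: (@le_trans _ _ (\sum_j \sum_i `|M i j| * sqn u)); last first.
  rewrite /C mulrDl mul1r mulr_suml.
  under [in leRHS]eq_bigr do rewrite mulr_suml.
  by rewrite lerDr sqn_ge0.
apply: (le_trans (ler_norm_sum _ _ _)); apply: ler_sum => j _.
rewrite mulr_suml; apply: (le_trans (ler_norm_sum _ _ _)); apply: ler_sum => i _.
rewrite !normrM mulrAC mulrC; apply: ler_wpM2l => //.
have := sqr_le_sqn u i; have := sqr_le_sqn u j.
rewrite -(real_normK (num_real (u i 0))) -(real_normK (num_real (u j 0))).
have := normr_ge0 (u i 0); have := normr_ge0 (u j 0).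
move: `|u i 0| `|u j 0| (sqn u) => a b s; nra.
Qed.

Lemma qfZ k (M : 'M[R]_k) (a : R) (u : 'cV[R]_k) : qf M (a *: u) = a ^+ 2 * qf M u.
Proof. rewrite !qfE mulr_sumr; apply: eq_bigr => j _; rewrite mxE.
under eq_bigr do rewrite mxE -mulrA.
by rewrite -mulr_sumr; ring. Qed.

Lemma sqnZ k (a : R) (u : 'cV[R]_k) : sqn (a *: u) = a ^+ 2 * sqn u.
Proof. by rewrite /sqn mulr_sumr; apply: eq_bigr => i _; rewrite mxE exprMn. Qed.

Lemma sqn_eq0 k (u : 'cV[R]_k) : (sqn u == 0) = (u == 0).
Proof.
apply/eqP/eqP => [u0|->]; last by rewrite /sqn big1 // => i _; rewrite mxE expr0n.
apply/matrixP => i j; rewrite ord1 mxE; apply/eqP; rewrite -sqrf_eq0 eq_le sqr_ge0 andbT.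
by rewrite -u0 sqr_le_sqn.
Qed.

(** A positive definite form attains a positive minimum on the unit sphere. *)
Lemma posdef_coercive k (M : 'M[R]_k) : (forall u : 'cV[R]_k, u != 0 -> 0 < qf M u) ->
  exists2 c : R, 0 < c & forall u, c * sqn u <= qf M u.
Proof.
move=> M0.
pose K := [set v : 'rV[R]_k | sqn v^T = 1].
have cK : continuous (fun v : 'rV[R]_k => sqn v^T).
  apply: cont_sum => i v; rewrite /continuous_at.
  have cv : {for v, continuous (fun v : 'rV[R]_k => v^T i 0)}.
    rewrite (_ : (fun v : 'rV[R]_k => v^T i 0) = (fun v => v 0 i)).
      exact: coord_continuous.
    by apply/funext => w; rewrite mxE.
  rewrite (_ : (fun t : 'rV[R]_k => t^T i 0 ^+ 2) = (fun t => t^T i 0 * t^T i 0)); last by apply/funext.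
  exact: (cvgM cv cv).
have cq : continuous (fun v : 'rV[R]_k => qf M v^T).
  rewrite (_ : (fun _ => _) = (fun v : 'rV[R]_k => \sum_j (\sum_i v 0 i * M i j) * v 0 j)).
    apply: cont_sum => j v.
    have cin : continuous (fun v : 'rV[R]_k => \sum_i v 0 i * M i j).
      apply: cont_sum => i w.
      exact: (cvgM (@coord_continuous R 1 k 0 i w) (cvg_cst _)).
    exact: (cvgM (cin v) (@coord_continuous R 1 k 0 j v)).
  apply/funext => v; rewrite qfE; apply: eq_bigr => j _; rewrite mxE; congr (_ * _).
  by apply: eq_bigr => i _; rewrite mxE.
have [K0|K0] := pselect (K !=set0); last first.
  exists 1 => // u; rewrite mul1r.
  suff -> : u = 0 by rewrite /qf sqnE !mulmx0 !mxE.
  apply/eqP; apply: contrapT => /negP u0; apply: K0.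
  have s0 : 0 < sqn u by rewrite lt_neqAle sqn_ge0 andbT eq_sym sqn_eq0.
  exists ((Num.sqrt (sqn u))^-1 *: u)^T; rewrite /K /= trmxK sqnZ exprVn sqr_sqrtr ?sqn_ge0 //.
  by rewrite mulVf // gt_eqF.
have cptK : compact K.
  apply: bounded_closed_compact.
    exists 1; split; first exact: num_real.
    move=> y y1 v Kv; apply: (@le_trans _ _ (mx_norm v)) => //; rewrite mx_normrE; apply: bigmax_le.
      by apply: ltW; apply: lt_trans y1.
    move=> [i j] _ /=; apply: le_trans (ltW y1).
    rewrite -(@expr_le1 _ 2) // real_normK ?num_real // ord1.
    by have := sqr_le_sqn v^T j; rewrite mxE Kv.
  by apply: (@preimage_closed _ _ (fun v : 'rV[R]_k => sqn v^T) [set x | x = 1]) => //; exact: closed_eq.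
have [v Kv vP] := compact_EVT_min K0 cptK (continuous_subspaceT cq).
move/set_mem: Kv => Kv.
have v0 : v^T != 0 by rewrite -sqn_eq0 Kv oner_eq0.
exists (qf M v^T); first exact: M0.
move=> u; have [->|u0] := eqVneq u 0.
  by rewrite /qf sqnE !mulmx0 !mxE mulr0.
have s0 : 0 < sqn u by rewrite lt_neqAle sqn_ge0 andbT eq_sym sqn_eq0.
have := vP ((Num.sqrt (sqn u))^-1 *: u)^T; rewrite trmxK qfZ exprVn sqr_sqrtr ?sqn_ge0 //.
rewrite ler_pdivlMl // mulrC; apply.
rewrite inE /K /= trmxK sqnZ exprVn sqr_sqrtr ?sqn_ge0 //.
by rewrite mulVf // gt_eqF.
Qed.

(** Test with vectors that have a single nonzero block. *)
Lemma diag_cat_coercive c k (F : 'I_k -> 'M[R]_c) : posdef (diag_cat F) ->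
  exists2 a : R, 0 < a & forall i u, a * sqn u <= qf (F i) u.
Proof.
move=> [_ /posdef_coercive [a a0 aP]]; exists a => // i u.
have := aP (vecC (rowsof (fun j => if j == i then u else 0))).
rewrite diag_cat_qf sqn_vecC tr_rowsof (bigD1 i) //= eqxx -sqnE big1 ?addr0; last first.
  by move=> j /negbTE ->; rewrite mulmx0 mxE.
by rewrite (bigD1 i) //= eqxx big1 ?addr0 // => j /negbTE ->; rewrite /qf mulmx0 mxE.
Qed.

Lemma qf_family_le c k (F : 'I_k -> 'M[R]_c) :
  exists2 C : R, 0 < C & forall i u, qf (F i) u <= C * sqn u.
Proof.
have /choice[C CP] : forall i : 'I_k, exists C : R, 0 < C /\ forall u, `|qf (F i) u| <= C * sqn u.
  by move=> i; have [C ? ?] := qf_le (F i); exists C.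
exists (1 + \sum_i C i); first by rewrite ltr_wpDr // sumr_ge0 // => i _; apply: ltW; exact: (CP i).1.
move=> i u; apply: (le_trans (ler_norm _)); apply: (le_trans ((CP i).2 u)).
apply: ler_wpM2r; first exact: sqn_ge0.
rewrite (bigD1 i) //= addrCA lerDl addr_ge0 // sumr_ge0 // => j _; exact: ltW (CP j).1.
Qed.

Lemma tr_qf k c (Y : 'M[R]_(k, c)) (A : 'M[R]_c) :
  \tr (Y *m A *m Y^T) = \sum_i qf A (row i Y)^T.
Proof.
rewrite /mxtrace; apply: eq_bigr => i _; rewrite qfE mxE.
by apply: eq_bigr => j _; rewrite !mxE; congr (_ * _); apply: eq_bigr => l _; rewrite !mxE.
Qed.

Lemma tr_sqn k c (Y : 'M[R]_(k, c)) : \tr (Y *m Y^T) = \sum_i sqn (row i Y)^T.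
Proof.
rewrite /mxtrace; apply: eq_bigr => i _; rewrite mxE.
by apply: eq_bigr => j _; rewrite !mxE expr2.
Qed.

Lemma tr_sqn_ge0 k c (Y : 'M[R]_(k, c)) : 0 <= \tr (Y *m Y^T).
Proof. by rewrite tr_sqn sumr_ge0 // => i _; exact: sqn_ge0. Qed.

Lemma tr_qf_le k c (Y : 'M[R]_(k, c)) (A : 'M[R]_c) C : (forall u, qf A u <= C * sqn u) ->
  \tr (Y *m A *m Y^T) <= C * \tr (Y *m Y^T).
Proof. by move=> AleC; rewrite tr_qf tr_sqn mulr_sumr; apply: ler_sum => i _; exact: AleC. Qed.

End Coercivity.

(** * Derivatives of matrix-valued functions and of sliding integrals *)

Section MatrixCalculus.
Context {R : realType}.
Notation mu := (@lebesgue_measure R).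

Definition mxder (k l : nat) (t : R) (F : R -> 'M[R]_(k, l)) (F' : 'M[R]_(k, l)) :=
  forall i j, is_derive t 1 (fun s => F s i j) (F' i j).

Definition mxac (k l : nat) (a b : R) (F : R -> 'M[R]_(k, l)) :=
  forall i j, abs_continuous a b (fun s => F s i j).

Lemma is_derive_sum_ord n (F : 'I_n -> R -> R) (dF : 'I_n -> R) (t : R) :
  (forall i, is_derive t 1 (F i) (dF i)) ->
  is_derive t 1 (fun s => \sum_i F i s) (\sum_i dF i).
Proof.
move=> H; rewrite (_ : (fun s => _) = \sum_i F i); first exact: is_derive_sum.
by apply/funext => s; rewrite fct_sumE.
Qed.

Lemma ac_sum n (F : 'I_n -> R -> R) (a b : R) : (forall i, abs_continuous a b (F i)) ->
  abs_continuous a b (fun s => \sum_i F i s).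
Proof.
elim: n F => [|n IH] F H.
  rewrite (_ : (fun s => _) = (fun=> 0)); first exact: ac_cst.
  by apply/funext => s; rewrite big_ord0.
rewrite (_ : (fun s => _) = (fun s => F ord0 s + \sum_(i < n) F (lift ord0 i) s)); last first.
  by apply/funext => s; rewrite big_ord_recl.
by apply: acD => //; apply: IH.
Qed.

Lemma is_derive_mul (f g : R -> R) (t df dg : R) : is_derive t 1 f df -> is_derive t 1 g dg ->
  is_derive t 1 (fun s => f s * g s) (df * g t + f t * dg).
Proof.
move=> Hf Hg; apply: (@is_derive_eq _ _ _ _ _ _ _ _ (is_deriveM Hf Hg)).
by rewrite /GRing.scale /=; ring.
Qed.

Lemma mxder_mull k l m (t : R) (A : 'M[R]_(k, l)) (F : R -> 'M[R]_(l, m)) F' :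
  mxder t F F' -> mxder t (fun s => A *m F s) (A *m F').
Proof.
move=> dF i j; rewrite mxE.
rewrite (_ : (fun s => (A *m F s) i j) = (fun s => \sum_r A i r * F s r j)); last first.
  by apply/funext => s; rewrite mxE.
by apply: is_derive_sum_ord => r; exact: is_deriveZ.
Qed.

Lemma mxac_mull k l m (a b : R) (A : 'M[R]_(k, l)) (F : R -> 'M[R]_(l, m)) : a <= b ->
  mxac a b F -> mxac a b (fun s => A *m F s).
Proof.
move=> ab dF i j.
rewrite (_ : (fun s => (A *m F s) i j) = (fun s => \sum_r A i r * F s r j)); last first.
  by apply/funext => s; rewrite mxE.
by apply: ac_sum => r; apply: acM => //; exact: ac_cst.
Qed.

Lemma mxder_col k k' l (t : R) (F : R -> 'M[R]_(k, l)) (G : R -> 'M[R]_(k', l)) F' G' :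
  mxder t F F' -> mxder t G G' -> mxder t (fun s => col_mx (F s) (G s)) (col_mx F' G').
Proof.
move=> dF dG i j; case: (split_ordP i) => r ->.
  by rewrite col_mxEu; under [X in is_derive _ _ X _]eq_fun do rewrite col_mxEu; exact: dF.
by rewrite col_mxEd; under [X in is_derive _ _ X _]eq_fun do rewrite col_mxEd; exact: dG.
Qed.

Lemma mxac_col k k' l (a b : R) (F : R -> 'M[R]_(k, l)) (G : R -> 'M[R]_(k', l)) :
  mxac a b F -> mxac a b G -> mxac a b (fun s => col_mx (F s) (G s)).
Proof.
move=> dF dG i j; case: (split_ordP i) => r ->.
  by under [X in abs_continuous _ _ X]eq_fun do rewrite col_mxEu; exact: dF.
by under [X in abs_continuous _ _ X]eq_fun do rewrite col_mxEd; exact: dG.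
Qed.

Lemma mxder_vec_mxcol k (b : 'I_k -> nat) c (t : R) (F : forall i, R -> 'M[R]_(b i, c)) F' :
  (forall i, mxder t (F i) (F' i)) ->
  mxder t (fun s => vecC (\mxcol_i F i s)) (vecC (\mxcol_i F' i)).
Proof.
move=> dF r j; rewrite !mxE.
by under [X in is_derive _ _ X _]eq_fun do rewrite !mxE; exact: dF.
Qed.

Lemma mxac_vec_mxcol k (b : 'I_k -> nat) c (u v : R) (F : forall i, R -> 'M[R]_(b i, c)) :
  (forall i, mxac u v (F i)) -> mxac u v (fun s => vecC (\mxcol_i F i s)).
Proof.
move=> dF r j; under [X in abs_continuous _ _ X]eq_fun do rewrite !mxE; exact: dF.
Qed.

Lemma qf_derive k (P : 'M[R]_k) (u : R -> 'cV[R]_k) u' (t : R) : P^T = P -> mxder t u u' ->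
  is_derive t 1 (fun s => qf P (u s)) (2 * (u'^T *m P *m u t) 0 0).
Proof.
move=> sP du.
under [X in is_derive _ _ X _]eq_fun do rewrite qfE.
have H : is_derive t 1 (fun s => \sum_j (\sum_i u s i 0 * P i j) * u s j 0)
   (\sum_j ((\sum_i u' i 0 * P i j) * u t j 0 + (\sum_i u t i 0 * P i j) * u' j 0)).
  apply: is_derive_sum_ord => j; apply: is_derive_mul; last exact: du.
  apply: is_derive_sum_ord => i.
  have := is_derive_mul (du i 0) (is_derive_cst (P i j) t (1 : R)).
  by rewrite mulr0 addr0.
apply: (@is_derive_eq _ _ _ _ _ _ _ _ H).
rewrite big_split /= mulr_natl mulr2n; congr (_ + _).
  by rewrite mxE; apply: eq_bigr => j _; rewrite mxE; congr (_ * _); apply: eq_bigr => i _; rewrite mxE.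
rewrite -mulmxA mxE; apply: eq_bigr => j _; rewrite !mxE mulrC; congr (_ * _).
apply: eq_bigr => i _; rewrite mulrC; congr (_ * _).
by rewrite -[in LHS]sP mxE.
Qed.

Lemma qf_ac k (P : 'M[R]_k) (u : R -> 'cV[R]_k) (a b : R) : a <= b -> mxac a b u ->
  abs_continuous a b (fun s => qf P (u s)).
Proof.
move=> ab du.
rewrite (_ : (fun s => _) = (fun s => \sum_j (\sum_i u s i 0 * P i j) * u s j 0)); last first.
  by apply/funext => s; rewrite qfE.
by apply: ac_sum => j; apply: acM => //; apply: ac_sum => i; apply: acM => //; exact: ac_cst.
Qed.

Lemma qf_continuous k (P : 'M[R]_k) (u : R -> 'cV[R]_k) : mxcont u -> continuous (fun s => qf P (u s)).
Proof.
move=> cu; under [X in continuous X]eq_fun do rewrite qfE.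
apply: cont_sum => j s.
have cin : continuous (fun v => \sum_i u v i 0 * P i j).
  by apply: cont_sum => i v; exact: (cvgM (cu i 0 v) (cvg_cst _)).
exact: (cvgM (cin s) (cu j 0 s)).
Qed.

Lemma conv_ac (a b t1 t2 : R) f f' y : a <= b -> t1 <= t2 -> ibp a b f f' -> sq `[a, b] f' -> continuous y ->
  abs_continuous t1 t2 (fun t => \int[mu]_(s in `[a, b]) (f s * y (t + s))).
Proof.
move=> ab t12 fibp sf' cy; apply: ac_C1 => //.
  by move=> t; exact: (conv_derive t ab fibp sf' cy).
apply: continuous_within => t.
have sh c : {for t, continuous (fun t => f c * y (t + c))}.
  apply: cvgM; first exact: cvg_cst.
  have := @shift_continuous R y c cy t.
  by rewrite /continuous_at addrC; under [X in X @ _ --> _]eq_fun do rewrite addrC.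
apply: cvgB; first by apply: cvgB; exact: sh.
exact: (conv_continuous ab sf' cy).
Qed.

Lemma mxconv_derive k n (a b t : R) (f f' : R -> 'cV[R]_k) (y : R -> 'cV[R]_n) : a <= b ->
  (forall i, ibp a b (fun s => f s i 0) (fun s => f' s i 0)) -> L2 `[a, b] f' -> mxcont y ->
  mxder t (fun t => mxint `[a, b] (fun s => f s *m (y (t + s))^T))
    (f b *m (y (t + b))^T - (f a *m (y (t + a))^T + mxint `[a, b] (fun s => f' s *m (y (t + s))^T))).
Proof.
move=> ab fibp sf' cy i j.
have E (u : 'cV[R]_k) (v : 'cV[R]_n) : (u *m v^T) i j = u i 0 * v j 0.
  by rewrite mxE big_ord1 mxE.
have H := conv_derive t ab (fibp i) (sf' i 0) (cy j 0).
rewrite (_ : (fun s => _) = (fun t => \int[mu]_(s in `[a, b]) (f s i 0 * y (t + s) j 0))); last first.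
  by apply/funext => u; rewrite mxE; apply: Rint_eq => s _; rewrite E.
apply: (@is_derive_eq _ _ _ _ _ _ _ _ H).
have EB (A B C : 'M[R]_(k, n)) : (A - (B + C)) i j = A i j - B i j - C i j.
  by rewrite !mxE opprD addrA.
rewrite EB !E mxintE; congr (_ - _).
by apply: Rint_eq => s _; rewrite E.
Qed.

Lemma mxconv_ac k n (a b t1 t2 : R) (f f' : R -> 'cV[R]_k) (y : R -> 'cV[R]_n) : a <= b -> t1 <= t2 ->
  (forall i, ibp a b (fun s => f s i 0) (fun s => f' s i 0)) -> L2 `[a, b] f' -> mxcont y ->
  mxac t1 t2 (fun t => mxint `[a, b] (fun s => f s *m (y (t + s))^T)).
Proof.
move=> ab t12 fibp sf' cy i j.
rewrite (_ : (fun s => _) = (fun t => \int[mu]_(s in `[a, b]) (f s i 0 * y (t + s) j 0))); last first.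
  by apply/funext => u; rewrite mxE; apply: Rint_eq => s _; rewrite mxE big_ord1 mxE.
exact: (conv_ac ab t12 (fibp i) (sf' i 0) (cy j 0)).
Qed.

Lemma mxconv_cont k l n (a b : R) (G : R -> 'M[R]_(k, l)) (y : R -> 'M[R]_(l, n)) : a <= b ->
  L2 `[a, b] G -> mxcont y -> mxcont (fun t => mxint `[a, b] (fun s => G s *m y (t + s))).
Proof.
move=> ab sG cy i j.
rewrite (_ : (fun s => _) = (fun t => \sum_r \int[mu]_(s in `[a, b]) (G s i r * y (t + s) r j))).
  by apply: cont_sum => r; exact: (conv_continuous ab (sG i r) (cy r j)).
apply/funext => t; rewrite mxE -Rint_sum //; last by move=> r; exact: (conv_intg t (sG i r) (cy r j)).
by apply: Rint_eq => s _; rewrite mxE.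
Qed.

(** The weight [s - a] has derivative 1, so that integration by parts leaves
    minus the integral of [th2]; this is where the negative term with [R_i]
    in the derivative of the storage functional comes from. *)
Lemma window_derive (a b t : R) th1 th2 : a < b -> continuous th1 -> continuous th2 ->
  is_derive t 1 (fun t => \int[mu]_(s in `[a, b]) (th1 (t + s) + (s - a) * th2 (t + s)))
    (th1 (t + b) + (b - a) * th2 (t + b) - th1 (t + a) - \int[mu]_(s in `[a, b]) th2 (t + s)).
Proof.
move=> ab c1 c2.
have sq0 (c : R) : sq `[a, b] (fun=> c) by apply: sq_cont; apply: continuous_within; exact: cst_continuous.
have C1a : C1fun (fun=> 1 : R) (fun=> 0 : R).
  by split; [exact: cst_continuous|move=> s; exact: is_derive_cst].
have C1b : C1fun (fun s => s - a) (fun=> 1 : R).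
  split; first exact: cst_continuous.
  by move=> s; have := is_deriveB (is_derive_id s (1 : R)) (is_derive_cst a s (1 : R)); rewrite subr0.
have d1 := conv_derive t (ltW ab) (ibp_C1 ab C1a) (sq0 0) c1.
have d2 := conv_derive t (ltW ab) (ibp_C1 ab C1b) (sq0 1) c2.
rewrite (_ : (fun s => _) = (fun t => \int[mu]_(s in `[a, b]) (1 * th1 (t + s)) + \int[mu]_(s in `[a, b]) ((s - a) * th2 (t + s)))).
  apply: (@is_derive_eq _ _ _ _ _ _ _ _ (is_deriveD d1 d2)).
  rewrite (@Rint_eq R `[a, b]%classic (fun s => 0 * th1 (t + s)) (fun=> 0)); last by move=> s _; rewrite mul0r.
  rewrite Rint_cst ?(ltW ab) // mul0r (@Rint_eq R `[a, b]%classic (fun s => 1 * th2 (t + s)) (fun s => th2 (t + s))).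
    ring.
  by move=> s _; rewrite mul1r.
apply/funext => u; rewrite -RintD //.
- by apply: Rint_eq => s _; rewrite mul1r.
- exact: (conv_intg u (sq0 1) c1).
- apply: conv_intg => //; apply: sq_cont; apply: continuous_within.
  by move=> s; apply: cvgB; [exact: cvg_id|exact: cvg_cst].
Qed.

Lemma window_ac (a b t1 t2 : R) th1 th2 : a < b -> t1 <= t2 -> continuous th1 -> continuous th2 ->
  abs_continuous t1 t2 (fun t => \int[mu]_(s in `[a, b]) (th1 (t + s) + (s - a) * th2 (t + s))).
Proof.
move=> ab t12 c1 c2; apply: ac_C1 => //.
  by move=> t; exact: window_derive.
apply: continuous_within => t.
have sh th c : continuous th -> {for t, continuous (fun t : R => th (t + c) : R)}.
  move=> cth; have := @shift_continuous R th c cth t.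
  by rewrite /continuous_at addrC; under [X in X @ _ --> _]eq_fun do rewrite addrC.
apply: cvgB.
  apply: cvgB; last exact: sh.
  by apply: cvgD; [exact: sh|apply: cvgM; [exact: cvg_cst|exact: sh]].
have sq1 : sq `[a, b] (fun=> 1 : R) by apply: sq_cont; apply: continuous_within; exact: cst_continuous.
have := @conv_continuous R a b (fun=> 1) th2 (ltW ab) sq1 c2 t.
rewrite (_ : (fun t => _) = (fun t => \int[mu]_(s in `[a, b]) th2 (t + s))) //.
by apply/funext => u; apply: Rint_eq => s _; rewrite mul1r.
Qed.

End MatrixCalculus.

(** * Orthonormal kernels of the decomposition *)

Section Plant.
Context {R : realType} (n m p q nu : nat) (d delta mu : 'I_nu -> nat).
Context (S : plant R n m p q nu) (D : decomposition R n m p d delta mu) (L : factors R d delta mu).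
Notation leb := (@lebesgue_measure R).
Notation vk := (vkap d delta).
Hypothesis hS : is_plant S.
Hypothesis hD : is_decomposition S D.
Hypothesis hL : is_factors S D L.
Implicit Types (y : R -> 'cV[R]_n) (i : 'I_nu).

Lemma rprev_lt_rcur i : rprev S i < rcur S i.
Proof. by case: hS. Qed.

(** The delays are only assumed to increase from one index to the next. *)
Lemma delay_le (j k : 'I_nu.+1) : (j <= k)%N -> delay S j <= delay S k.
Proof.
case: k => k hk /=; elim: k hk => [|k IH] hk jk.
  by rewrite (_ : j = Ordinal hk) //; apply: ord_inj; apply/eqP; rewrite -leqn0.
move: jk; rewrite leq_eqVlt => /orP[/eqP jk|jk].
  by rewrite (_ : j = Ordinal hk) //; exact: ord_inj.
have hk' : (k < nu.+1)%N by exact: ltnW.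
apply: (le_trans (IH hk' _)); first by rewrite -ltnS.
have := rprev_lt_rcur (Ordinal (hk : (k < nu)%N)) => /ltW.
by rewrite /rprev /rcur; congr (_ <= _); congr delay; apply: ord_inj.
Qed.

Lemma delay_ge0 j : 0 <= delay S j.
Proof. by case: hS => <- _ _; exact: delay_le. Qed.

Lemma delay_le_rmax j : delay S j <= rmax S.
Proof. by apply: delay_le; rewrite -ltnS ltn_ord. Qed.

Lemma Iset_sub_J i s : Iset S i s -> Jset S s.
Proof.
rewrite /Iset /Jset /= !in_itv /= => /andP[h1 h2]; apply/andP; split.
  by apply: le_trans h1; rewrite lerN2; exact: delay_le_rmax.
by apply: (le_trans h2); rewrite oppr_le0; exact: delay_ge0.
Qed.

Lemma Jset0 : Jset S 0.
Proof. by rewrite /Jset /= in_itv /= lexx andbT oppr_le0; exact: delay_ge0. Qed.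

Let ltI i : - rcur S i < - rprev S i.
Proof. by rewrite ltrN2; exact: rprev_lt_rcur. Qed.

Let leI i : - rcur S i <= - rprev S i. Proof. exact: ltW. Qed.

Let mI i : measurable (Iset S i). Proof. exact: measurable_itv. Qed.

Lemma chol_unit k (T X : 'M[R]_k) : is_cholesky T X -> T \in unitmx.
Proof.
move=> [tT dT _]; rewrite unitmxE det_trig // unitfE; apply/prodf_neq0 => i _.
by rewrite gt_eqF.
Qed.

Let Lfu i : Lf L i \in unitmx. Proof. by case: (hL i) => /chol_unit. Qed.
Let Lhu i : Lh L i \in unitmx. Proof. by case: (hL i) => _ /chol_unit. Qed.
Let Leu i : Le L i \in unitmx. Proof. by case: (hL i) => _ _ /chol_unit. Qed.

Lemma L2_f i : L2 (Iset S i) (f_ D i).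
Proof. by case: (hD i) => [[[]]]. Qed.

Lemma L2_h i : L2 (Iset S i) (h_ D i).
Proof. by apply: L2_col; [case: (hD i) => [[]]|exact: L2_f]. Qed.

Lemma L2_g i : L2 (Iset S i) (g_ D i).
Proof. by apply: L2_col; [case: (hD i) => [[]]|exact: L2_h]. Qed.

Lemma L2_eps i : L2 (Iset S i) (eps_ S D i).
Proof.
apply: L2_add; first by case: (hD i) => [[]].
by apply: L2_opp; apply: L2_mull; exact: L2_h.
Qed.

Lemma f_ibp i r : ibp (- rcur S i) (- rprev S i) (fun s => f_ D i s r 0) (fun s => (M_ D i *m h_ D i s) r 0).
Proof.
have [[[sf cf _] _ _] _ wf _] := hD i.
apply: weak_ibp => //.
- apply: (@within_continuous_comp _ _ _ _ (f_ D i) (fun M : 'cV[R]_(d i) => M r 0)) => // M _; exact: coord_continuous.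
- exact: (L2_mull (M_ D i) (@L2_h i) r 0).
- move=> eta te; have /matrixP/(_ r 0) := wf eta te; rewrite !mxE.
  under eq_Rintegral do rewrite mxE; move=> ->.
  by congr (- _); apply: Rint_eq => s _; rewrite mxE.
Qed.

Definition h_on i s := invmx (Lh L i) *m h_ D i s.
Definition eps_on i s := invmx (Le L i) *m eps_ S D i s.
Definition f_on i s := invmx (Lf L i) *m f_ D i s.

(** Dividing by a Cholesky factor of the Gram matrix orthonormalizes a family. *)
Lemma gram_conj k (T : 'M[R]_k) (v : R -> 'cV[R]_k) i : L2 (Iset S i) v -> T \in unitmx ->
  mxint (Iset S i) (fun s => v s *m (v s)^T) = T *m T^T ->
  mxint (Iset S i) (fun s => (invmx T *m v s) *m (invmx T *m v s)^T) = 1%:M.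
Proof.
move=> sv uT gr.
have ig : mxintg (Iset S i) (fun s => v s *m (v s)^T) by apply: L2_mulmx => //; exact: L2_tr.
rewrite (@mxint_eq _ _ _ _ _ (fun s => invmx T *m (v s *m (v s)^T) *m (invmx T)^T)); last first.
  by move=> s _; rewrite trmx_mul !mulmxA.
rewrite mxint_mulr //; last exact: mxintg_mull.
rewrite mxint_mull // gr !mulmxA mulVmx // mul1mx trmx_inv mulmxV //.
by rewrite unitmx_tr.
Qed.

Lemma f_on_gram i : mxint (Iset S i) (fun s => f_on i s *m (f_on i s)^T) = 1%:M.
Proof. by apply: gram_conj => //; [exact: L2_f|case: (hL i) => [[_ _ <-]]]. Qed.

Lemma h_on_gram i : mxint (Iset S i) (fun s => h_on i s *m (h_on i s)^T) = 1%:M.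
Proof. by apply: gram_conj => //; [exact: L2_h|case: (hL i) => _ [_ _ <-]]. Qed.

Lemma eps_on_gram i : mxint (Iset S i) (fun s => eps_on i s *m (eps_on i s)^T) = 1%:M.
Proof. by apply: gram_conj => //; [exact: L2_eps|case: (hL i) => _ _ [_ _ <-]]. Qed.

Lemma gramH_unit i : gramH S D i \in unitmx.
Proof. by case: (hL i) => _ [_ _ ->] _; rewrite unitmx_mul unitmx_tr Lhu. Qed.

(** [eps_] is the residual of the orthogonal projection of [phi_] on the span of
    [h_]. *)
Lemma eps_h_orth i : mxint (Iset S i) (fun s => eps_ S D i s *m (h_ D i s)^T) = 0.
Proof.
have sphi : L2 (Iset S i) (phi_ D i) by case: (hD i) => [[]].
have sh := @L2_h i.
have i1 : mxintg (Iset S i) (fun s => phi_ D i s *m (h_ D i s)^T) by apply: L2_mulmx => //; exact: L2_tr.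
have i2 : mxintg (Iset S i) (fun s => h_ D i s *m (h_ D i s)^T) by apply: L2_mulmx => //; exact: L2_tr.
pose T := Gam S D i *m invmx (gramH S D i).
rewrite (@mxint_eq _ _ _ _ _ (fun s => phi_ D i s *m (h_ D i s)^T + - (T *m (h_ D i s *m (h_ D i s)^T)))); last first.
  by move=> s _; rewrite /eps_ mulmxBl -/T mulmxA.
rewrite mxintD //; last by apply: mxintgN => //; exact: mxintg_mull.
rewrite mxintN //; last exact: mxintg_mull.
rewrite mxint_mull // -/(gramH S D i) /T mulmxKV ?gramH_unit //.
by rewrite -/(Gam S D i) subrr.
Qed.

Definition kern i s := col_mx (h_on i s) (eps_on i s).

Lemma L2_h_on i : L2 (Iset S i) (h_on i). Proof. by apply: L2_mull; exact: L2_h. Qed.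
Lemma L2_eps_on i : L2 (Iset S i) (eps_on i). Proof. by apply: L2_mull; exact: L2_eps. Qed.
Lemma L2_f_on i : L2 (Iset S i) (f_on i). Proof. by apply: L2_mull; exact: L2_f. Qed.

Lemma kern_gram i : mxint (Iset S i) (fun s => kern i s *m (kern i s)^T) = 1%:M.
Proof.
have eh : mxint (Iset S i) (fun s => eps_on i s *m (h_on i s)^T) = 0.
  rewrite (@mxint_eq _ _ _ _ _ (fun s => invmx (Le L i) *m (eps_ S D i s *m (h_ D i s)^T) *m (invmx (Lh L i))^T)); last first.
    by move=> s _; rewrite trmx_mul !mulmxA.
  have ig : mxintg (Iset S i) (fun s => eps_ S D i s *m (h_ D i s)^T).
    by apply: L2_mulmx => //; [exact: L2_eps|apply: L2_tr; exact: L2_h].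
  rewrite mxint_mulr //; last exact: mxintg_mull.
  by rewrite mxint_mull // eps_h_orth mulmx0 mul0mx.
have he : mxint (Iset S i) (fun s => h_on i s *m (eps_on i s)^T) = 0.
  rewrite -[LHS]trmxK -mxint_tr (@mxint_eq _ _ _ _ _ (fun s => eps_on i s *m (h_on i s)^T)) ?eh ?trmx0 //.
  by move=> s _; rewrite trmx_mul trmxK.
rewrite (@mxint_eq _ _ _ _ _ (fun s => col_mx (row_mx (h_on i s *m (h_on i s)^T) (h_on i s *m (eps_on i s)^T))
   (row_mx (eps_on i s *m (h_on i s)^T) (eps_on i s *m (eps_on i s)^T)))); last first.
  by move=> s _; rewrite /kern tr_col_mx mul_col_mx !mul_mx_row.
rewrite mxint_col !mxint_row h_on_gram eps_on_gram eh he.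
by rewrite -/(block_mx _ _ _ _) -scalar_mx_block.
Qed.

(** The closed loop depends on a history through its point values at the delays
    and the projections [Yh] and [Ye]; the storage functional uses [Yf]. *)
Definition Yh y i := mxint (Iset S i) (fun s => h_on i s *m (y s)^T).
Definition Ye y i := mxint (Iset S i) (fun s => eps_on i s *m (y s)^T).
Definition Yf y i := mxint (Iset S i) (fun s => f_on i s *m (y s)^T).

Lemma mxcontL2 y i : mxcont y -> L2 (Iset S i) y.
Proof. exact: mxcont_L2. Qed.

Lemma kern_bessel y i (A : 'M[R]_n) : mxcont y -> A^T = A -> (forall u, 0 <= qf A u) ->
  \tr (Yh y i *m A *m (Yh y i)^T) + \tr (Ye y i *m A *m (Ye y i)^T) <= \int[leb]_(s in Iset S i) qf A (y s).
Proof.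
move=> cy sA A0.
have sk : L2 (Iset S i) (kern i) by apply: L2_col; [exact: L2_h_on|exact: L2_eps_on].
have := bessel sA A0 sk (mxcontL2 i cy) (kern_gram i).
rewrite (@mxint_eq _ _ _ _ _ (fun s => col_mx (h_on i s *m (y s)^T) (eps_on i s *m (y s)^T))); last first.
  by move=> s _; rewrite mul_col_mx.
rewrite mxint_col -/(Yh y i) -/(Ye y i) tr_col_mx mul_col_mx mul_mx_row !mul_col_mx.
by rewrite -block_mxEh mxtrace_block.
Qed.

Lemma f_on_bessel y i (A : 'M[R]_n) : mxcont y -> A^T = A -> (forall u, 0 <= qf A u) ->
  \tr (Yf y i *m A *m (Yf y i)^T) <= \int[leb]_(s in Iset S i) qf A (y s).
Proof. by move=> cy sA A0; apply: (bessel sA A0 (@L2_f_on i) (mxcontL2 i cy) (f_on_gram i)). Qed.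

Lemma h_of_Yh y i : mxcont y -> Lh L i *m Yh y i = mxint (Iset S i) (fun s => h_ D i s *m (y s)^T).
Proof.
move=> cy; rewrite -mxint_mull //; last by apply: L2_mulmx => //; [exact: L2_h_on|apply: L2_tr; exact: mxcontL2].
by apply: mxint_eq => s _; rewrite /h_on !mulmxA mulmxV // mul1mx.
Qed.

Lemma Xi_Yh y i : mxcont y -> Xi_ L (Yh y) i = Yf y i.
Proof.
move=> cy; rewrite /Xi_ -!mulmxA h_of_Yh // -mxint_mull //; last first.
  by apply: L2_mulmx => //; [exact: L2_h|apply: L2_tr; exact: mxcontL2].
rewrite -mxint_mull //; last first.
  apply: mxintg_mull => //.
  by apply: L2_mulmx => //; [exact: L2_h|apply: L2_tr; exact: mxcontL2].
apply: mxint_eq => s _; rewrite /f_on /h_ !mulmxA; congr (_ *m _).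
by rewrite -mulmxA mul_row_col mul0mx add0r mul1mx.
Qed.

(** [T_] and [Tt_] undo the orthonormalization: [phi_] is [eps_] plus its
    projection on [h_], and the inverse of the Gram matrix of [h_] factors
    through the inverse of its Cholesky factor. *)
Lemma g_of_kern i s : T_ S D L i *m h_on i s + Tt_ L i *m eps_on i s = g_ D i s.
Proof.
rewrite /T_ /Tt_ mul_col_mx -[col_mx 1%:M 0 *m Le L i *m _]mulmxA mul_col_mx mul0mx mul1mx.
rewrite add_col_mx addr0 /g_ /h_on /eps_on; congr col_mx; last by rewrite mulmxA mulmxV // mul1mx.
rewrite [Le L i *m _]mulmxA mulmxV // mul1mx /eps_.
have -> : invmx (gramH S D i) = (invmx (Lh L i))^T *m invmx (Lh L i).
  case: (hL i) => _ [_ _ ->] _.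
  apply: (@row_full_inj _ _ _ _ (Lh L i *m (Lh L i)^T)).
    by rewrite row_full_unit unitmx_mul unitmx_tr Lhu.
  rewrite mulmxV ?unitmx_mul ?unitmx_tr ?Lhu // mulmxA trmx_inv mulmxK ?unitmx_tr //.
  by rewrite mulmxV.
by rewrite !mulmxA addrC subrK.
Qed.

Lemma T_stack y i : mxcont y ->
  T_ S D L i *m Yh y i + Tt_ L i *m Ye y i = mxint (Iset S i) (fun s => g_ D i s *m (y s)^T).
Proof.
move=> cy; have sy := L2_tr (mxcontL2 i cy).
have i1 : mxintg (Iset S i) (fun s => h_on i s *m (y s)^T) by apply: L2_mulmx => //; exact: L2_h_on.
have i2 : mxintg (Iset S i) (fun s => eps_on i s *m (y s)^T) by apply: L2_mulmx => //; exact: L2_eps_on.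
rewrite -!mxint_mull // -mxintD; [|exact: mI|exact: mxintg_mull|exact: mxintg_mull].
apply: mxint_eq => s _; rewrite -g_of_kern; move: (T_ S D L i) (Tt_ L i) => T T'.
by rewrite mulmxDl !mulmxA.
Qed.

End Plant.

(** * The storage functional and its derivative *)

Section Storage.
Context {R : realType} (n m p q nu : nat) (d delta mu : 'I_nu -> nat).
Context (S : plant R n m p q nu) (D : decomposition R n m p d delta mu) (L : factors R d delta mu).
Notation leb := (@lebesgue_measure R).
Notation vk := (vkap d delta).
Hypothesis hS : is_plant S.
Hypothesis hD : is_decomposition S D.
Hypothesis hL : is_factors S D L.
Context (P1 : 'M[R]_n) (P2 : 'M[R]_(n, (\sum_i d i) * n)) (P3 : 'M[R]_((\sum_i d i) * n)) (Q Rr : 'I_nu -> 'M[R]_n).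
Hypothesis sP1 : issym P1.
Hypothesis sP3 : issym P3.
Hypothesis sQ : forall i, issym (Q i).
Hypothesis sR : forall i, issym (Rr i).
Hypothesis posP : posdef (block_mx P1 P2 P2^T P3
  + ((0 : 'M[R]_n) ⊕ diag_catn (fun i => (1%:M : 'M[R]_(d i)) ⊗ Q i))).
Hypothesis posQ : posdef (diag_cat Q).
Hypothesis posR : posdef (diag_cat Rr).
Implicit Types (y : R -> 'cV[R]_n) (i : 'I_nu).

Let ltI i : - rcur S i < - rprev S i.
Proof. by rewrite ltrN2; exact: rprev_lt_rcur. Qed.

Let leI i : - rcur S i <= - rprev S i. Proof. exact: ltW. Qed.

Let mI i : measurable (Iset S i). Proof. exact: measurable_itv. Qed.

Notation blockP := (block_mx P1 P2 P2^T P3).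
Definition proj_state y := col_mx (y 0) (vecC (\mxcol_i Yf S D L y i)).
Definition window y i :=
  \int[leb]_(s in Iset S i) (qf (Q i) (y s) + (s - - rcur S i) * qf (Rr i) (y s)).
Definition storage y := qf blockP (proj_state y) + \sum_i window y i.
Definition energy y := \sum_i \int[leb]_(s in Iset S i) qf (Rr i) (y s).

Lemma qf_ge0 (F : 'I_nu -> 'M[R]_n) : posdef (diag_cat F) -> forall i u, 0 <= qf (F i) u.
Proof.
move=> /diag_cat_coercive[a a0 aP] i u; apply: le_trans (aP i u).
by rewrite mulr_ge0 ?sqn_ge0 // ltW.
Qed.

Let Q0 := qf_ge0 posQ.
Let R0 := qf_ge0 posR.

Lemma qf_intg y i (A : 'M[R]_n) : mxcont y -> intg (Iset S i) (fun s => qf A (y s)).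
Proof. by move=> cy; apply: intg_cont; apply: continuous_within; exact: qf_continuous. Qed.

Lemma sqn_qf1 k (u : 'cV[R]_k) : sqn u = qf 1%:M u.
Proof. by rewrite sqnE /qf mulmx1. Qed.

Lemma weighted_continuous y i (A : 'M[R]_n) : mxcont y ->
  continuous (fun s => (s - - rcur S i) * qf A (y s)).
Proof.
move=> cy t; apply: cvgM; last exact: qf_continuous.
by apply: cvgB; [exact: cvg_id|exact: cvg_cst].
Qed.

Lemma weighted_intg y i (A : 'M[R]_n) : mxcont y ->
  intg (Iset S i) (fun s => (s - - rcur S i) * qf A (y s)).
Proof. by move=> cy; apply: intg_cont; apply: continuous_within; exact: weighted_continuous. Qed.

Lemma energy_ge0 y : 0 <= energy y.
Proof. by apply: sumr_ge0 => i _; apply: Rintegral_ge0 => s _; exact: R0. Qed.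

(** The hypothesis adds [Q_i] to the blocks of [P3]; by Bessel's inequality the
    integrals of [y^T Q_i y] pay for this. *)
Lemma storage_lower : exists2 c : R, 0 < c & forall y, mxcont y -> c * sqn (y 0) <= storage y.
Proof.
have [c c0 cP] := posdef_coercive (proj2 posP); exists c => // y cy.
have := cP (proj_state y); rewrite qfD /proj_state qf_dsum qf0 add0r diag_catn_qf sqn_col.
rewrite -/(proj_state y) => h.
have h1 : \sum_i \tr (Yf S D L y i *m Q i *m (Yf S D L y i)^T) <= \sum_i window y i.
  apply: ler_sum => i _; apply: (le_trans (f_on_bessel hD hL i cy (sQ i) (@Q0 i))).
  apply: Rint_le => //; [exact: qf_intg| |].
    by apply: intgD => //; [exact: qf_intg|exact: weighted_intg].
  move=> s; rewrite /Iset /= in_itv /= => /andP[s1 _].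
  by rewrite lerDl mulr_ge0 ?R0 // subr_ge0.
have h2 : 0 <= c * sqn (vecC (\mxcol_i Yf S D L y i)) by rewrite mulr_ge0 ?sqn_ge0 // ltW.
rewrite mulrDr in h; rewrite /storage; lra.
Qed.

(** The projections are bounded by the integral of [|y|^2], hence, [R_i] being
    positive definite, by [energy]; this makes the margin in the dissipation
    inequality comparable with the storage itself. *)
Lemma storage_upper : exists2 C : R, 0 < C & forall y, mxcont y -> storage y <= C * (sqn (y 0) + energy y).
Proof.
have [C1 C10 C1P] := qf_le blockP.
have [a a0 aP] := diag_cat_coercive posR.
have [C2 C20 C2P] := qf_family_le Q.
exists (C1 + C1 / a + C2 / a + rmax S).
  have : 0 <= rmax S by exact: delay_ge0.
  have := divr_ge0 (ltW C10) (ltW a0); have := divr_ge0 (ltW C20) (ltW a0).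
  lra.
move=> y cy.
have isq i : intg (Iset S i) (fun s => sqn (y s)).
  by apply: eq_intg (qf_intg i (1%:M) cy) => // s _; rewrite -sqn_qf1.
have bnd i : \int[leb]_(s in Iset S i) sqn (y s) <= a^-1 * \int[leb]_(s in Iset S i) qf (Rr i) (y s).
  rewrite -RintZ //; last exact: qf_intg.
  apply: Rint_le => //; [by apply: intgZ => //; exact: qf_intg|].
  by move=> s _; rewrite ler_pdivlMl.
have h1 : sqn (vecC (\mxcol_i Yf S D L y i)) <= a^-1 * energy y.
  rewrite sqn_vecC trace_mxcol mulr_sumr; apply: ler_sum => i _; apply: le_trans (bnd i).
  under eq_Rintegral do rewrite sqn_qf1.
  rewrite -[X in \tr (X *m _)]mulmx1; apply: f_on_bessel => //; first by rewrite trmx1.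
  by move=> u; rewrite -sqn_qf1 sqn_ge0.
have h2 : \sum_i window y i <= (C2 / a + rmax S) * energy y.
  rewrite mulr_sumr; apply: ler_sum => i _; rewrite mulrDl -mulrA /window.
  have := qf_intg i (Rr i) cy => iR; have iQ := qf_intg i (Q i) cy.
  rewrite RintD //; last exact: weighted_intg.
  apply: lerD.
    apply: (@le_trans _ _ (C2 * \int[leb]_(s in Iset S i) sqn (y s))).
      rewrite -RintZ //; apply: Rint_le => //; exact: intgZ.
    by rewrite ler_pM2l.
  rewrite -RintZ //; apply: Rint_le => //; [exact: weighted_intg|exact: intgZ|].
  move=> s; rewrite /Iset /= in_itv /= => /andP[_ s2]; apply: ler_wpM2r; first exact: R0.
  rewrite opprK; have : 0 <= rprev S i by exact: delay_ge0.
  have : rcur S i <= rmax S by exact: delay_le_rmax.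
  lra.
have h3 := le_trans (ler_norm _) (C1P (proj_state y)).
have h4 : C1 * sqn (proj_state y) <= C1 * sqn (y 0) + C1 / a * energy y.
  by rewrite /proj_state sqn_col mulrDr lerD2l -mulrA ler_pM2l.
rewrite /storage !mulrDr !mulrDl in h3 h4 h2 *.
have k0 : 0 <= rmax S * sqn (y 0) by rewrite mulr_ge0 ?sqn_ge0 //; exact: delay_ge0.
have k1 : 0 <= C1 / a * sqn (y 0) by rewrite !mulr_ge0 ?sqn_ge0 ?invr_ge0 ?ltW.
have k2 : 0 <= C2 / a * sqn (y 0) by rewrite !mulr_ge0 ?sqn_ge0 ?invr_ge0 ?ltW.
have k3 : 0 <= C1 * energy y by rewrite mulr_ge0 ?energy_ge0 ?ltW.
lra.
Qed.

Lemma Yf_conv y t i : mxcont y ->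
  Yf S D L (hist y t) i = invmx (Lf L i) *m mxint (Iset S i) (fun s => f_ D i s *m (y (t + s))^T).
Proof.
move=> cy; rewrite -mxint_mull //; last first.
  by apply: L2_mulmx => //; [exact: L2_f|apply: L2_tr; apply: mxcont_L2; exact: mxcont_shift].
by apply: mxint_eq => s _; rewrite /f_on /hist mulmxA.
Qed.

Let sM i : L2 (Iset S i) (fun s => M_ D i *m h_ D i s).
Proof. by apply: L2_mull; exact: L2_h. Qed.

(** The weak differential equation of [f_i] enters here. *)
Lemma Yf_derive y t i : mxcont y ->
  mxder t (fun t => Yf S D L (hist y t) i)
    (dXi_ S D L (fun j => y (t - delay S j)) (Yh S D L (hist y t)) i).
Proof.
move=> cy; have := @mxconv_derive _ _ _ _ _ t (f_ D i) (fun s => M_ D i *m h_ D i s) y (leI i) (@f_ibp _ _ _ _ _ _ _ _ _ _ _ hS hD i) (@sM i) cy.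
move=> /(mxder_mull (invmx (Lf L i))) h.
have -> : dXi_ S D L (fun j => y (t - delay S j)) (Yh S D L (hist y t)) i =
   invmx (Lf L i) *m (f_ D i (- rprev S i) *m (y (t + - rprev S i))^T -
     (f_ D i (- rcur S i) *m (y (t + - rcur S i))^T +
      mxint `[- rcur S i, - rprev S i] (fun s => M_ D i *m h_ D i s *m (y (t + s))^T))).
  have ch : mxcont (hist y t) by exact: mxcont_shift.
  rewrite /dXi_ mulmxBr mulmxDr -!mulmxA h_of_Yh // -mxint_mull //; last first.
    by apply: L2_mulmx => //; [exact: L2_h|apply: L2_tr; exact: mxcont_L2].
  congr (_ - (_ + _ *m _)); apply: mxint_eq => s _.
  by rewrite mulmxA.
move=> r c; have := h r c.
rewrite (_ : (fun s => (invmx _ *m _) r c) = (fun s => Yf S D L (hist y s) i r c)) //.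
by apply/funext => s; rewrite Yf_conv.
Qed.

Lemma Yf_ac y t1 t2 i : t1 <= t2 -> mxcont y -> mxac t1 t2 (fun t => Yf S D L (hist y t) i).
Proof.
move=> t12 cy; have := @mxconv_ac _ _ _ _ _ _ _ (f_ D i) (fun s => M_ D i *m h_ D i s) y (leI i) t12 (@f_ibp _ _ _ _ _ _ _ _ _ _ _ hS hD i) (@sM i) cy.
move=> /(mxac_mull (invmx (Lf L i)) t12) h r c.
rewrite (_ : (fun s => _) = (fun s => (invmx (Lf L i) *m mxint (Iset S i) (fun th => f_ D i th *m (y (s + th))^T)) r c)).
  exact: h.
by apply/funext => s; rewrite Yf_conv.
Qed.

Lemma qf_scale k (a : R) (A : 'M[R]_k) u : qf (a *: A) u = a * qf A u.
Proof. by rewrite /qf -scalemxAr -scalemxAl mxE. Qed.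

Lemma trmx_11 (A : 'M[R]_1) : A^T 0 0 = A 0 0. Proof. by rewrite mxE. Qed.

Lemma blockP_bilin (u v : 'cV[R]_n) (u' v' : 'cV[R]_((\sum_i d i) * n)) :
  ((col_mx u u')^T *m blockP *m col_mx v v') 0 0 =
  (u^T *m (P1 *m v + P2 *m v')) 0 0 + ((P2^T *m v + P3 *m v')^T *m u') 0 0.
Proof.
rewrite tr_col_mx -mulmxA mul_block_col mul_row_col mxE; congr (_ + _).
by rewrite -[LHS]trmx_11 trmx_mul trmxK.
Qed.

Definition ydel y t (j : 'I_nu.+1) := y (t - delay S j).

Definition storage_rate y t (y' : 'cV[R]_n) :=
  2 * (y'^T *m (P1 *m y t + P2 *m vecC (\mxcol_i Yf S D L (hist y t) i))) 0 0 +
  2 * ((P2^T *m y t + P3 *m vecC (\mxcol_i Yf S D L (hist y t) i))^T *m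
     vecC (\mxcol_i dXi_ S D L (ydel y t) (Yh S D L (hist y t)) i)) 0 0 +
  \sum_i qf (Q i + (rcur S i - rprev S i) *: Rr i) (y (t - rprev S i)) -
  \sum_i qf (Q i) (y (t - rcur S i)) - energy (hist y t).

Lemma storage_derive y t (y' : 'cV[R]_n) : mxcont y -> mxder t y y' ->
  is_derive t 1 (fun t => storage (hist y t)) (storage_rate y t y').
Proof.
move=> cy dy.
have dproj : mxder t (fun s => proj_state (hist y s))
    (col_mx y' (vecC (\mxcol_i dXi_ S D L (ydel y t) (Yh S D L (hist y t)) i))).
  apply: mxder_col; last by apply: mxder_vec_mxcol => i; exact: Yf_derive.
  by move=> i j; rewrite (_ : (fun s => _) = (fun s => y s i j)) //; apply/funext => s; rewrite /hist addr0.
have sB : blockP^T = blockP by rewrite tr_block_mx trmxK sP1 sP3.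
have h1 := qf_derive sB dproj.
have h2 i : is_derive t 1 (fun s => window (hist y s) i)
   (qf (Q i) (y (t + - rprev S i)) + (- rprev S i - - rcur S i) * qf (Rr i) (y (t + - rprev S i)) -
    qf (Q i) (y (t + - rcur S i)) - \int[leb]_(s in Iset S i) qf (Rr i) (hist y t s)).
  apply: (@window_derive _ _ _ _ (fun s => qf (Q i) (y s)) (fun s => qf (Rr i) (y s))) => //; exact: qf_continuous.
have := is_deriveD h1 (is_derive_sum_ord h2).
rewrite (_ : _ + _ = storage_rate y t y') //.
rewrite blockP_bilin (_ : hist y t 0 = y t); last by rewrite /hist addr0.
rewrite /storage_rate /energy mulrDr -!addrA; congr (_ + (_ + _)).
rewrite -!sumrN -!big_split /=.
apply: eq_bigr => i _; rewrite qfD qf_scale /hist; ring.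
Qed.

Lemma storage_ac y t1 t2 : t1 <= t2 -> mxcont y -> mxac t1 t2 y ->
  abs_continuous t1 t2 (fun t => storage (hist y t)).
Proof.
move=> t12 cy ay; apply: acD; last first.
  apply: ac_sum => i; apply: (@window_ac _ _ _ _ _ (fun s => qf (Q i) (y s)) (fun s => qf (Rr i) (y s))) => //;
    exact: qf_continuous.
apply: qf_ac => //; apply: mxac_col; last by apply: mxac_vec_mxcol => i; exact: Yf_ac.
by move=> i j; rewrite (_ : (fun s => _) = (fun s => y s i j)) //; apply/funext => s; rewrite /hist addr0.
Qed.

End Storage.

(** * Continuity of the storage functional in the uniform norm *)

Section SupNorm.
Context {R : realType} (n m p q nu : nat) (d delta mu : 'I_nu -> nat).
Context (S : plant R n m p q nu) (D : decomposition R n m p d delta mu) (L : factors R d delta mu).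
Notation leb := (@lebesgue_measure R).
Hypothesis hS : is_plant S.
Hypothesis hD : is_decomposition S D.
Hypothesis hL : is_factors S D L.
Context (P1 : 'M[R]_n) (P2 : 'M[R]_(n, (\sum_i d i) * n)) (P3 : 'M[R]_((\sum_i d i) * n)) (Q Rr : 'I_nu -> 'M[R]_n).
Hypothesis sQ : forall i, issym (Q i).
Hypothesis posP : posdef (block_mx P1 P2 P2^T P3
  + ((0 : 'M[R]_n) ⊕ diag_catn (fun i => (1%:M : 'M[R]_(d i)) ⊗ Q i))).
Hypothesis posQ : posdef (diag_cat Q).
Hypothesis posR : posdef (diag_cat Rr).
Implicit Types (y : R -> 'cV[R]_n) (i : 'I_nu).

Let mI i : measurable (Iset S i). Proof. exact: measurable_itv. Qed.
Notation stor := (storage S D L P1 P2 P3 Q Rr).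

Lemma storage_eq y1 y2 : (forall s, Jset S s -> y1 s = y2 s) -> stor y1 = stor y2.
Proof.
move=> e.
have eY : \mxcol_i Yf S D L y1 i = \mxcol_i Yf S D L y2 i.
  by apply/eq_mxcolP => i; apply: mxint_eq => s /(Iset_sub_J hS) /e ->.
have eW : \sum_i window S Q Rr y1 i = \sum_i window S Q Rr y2 i.
  by apply: eq_bigr => i _; apply: Rint_eq => s /(Iset_sub_J hS) /e ->.
by rewrite /storage /proj_state eY eW e //; exact: Jset0.
Qed.

Lemma storage_ge0 y : mxcont y -> 0 <= stor y.
Proof.
move=> cy; have [c c0 cP] := storage_lower hD hL sQ posP posQ posR.
by apply: le_trans (cP y cy); rewrite mulr_ge0 ?sqn_ge0 // ltW.
Qed.

(** A quadratic polynomial in [s] is determined by its values at 0 and 1 and its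
    leading coefficient; written this way, the mixed term need not be named. *)
Lemma qf_pencil k (A : 'M[R]_k) (u v : 'cV[R]_k) (s : R) :
  qf A (u + s *: v) = (1 - s) * qf A u + s * qf A (u + v) + (s ^+ 2 - s) * qf A v.
Proof.
have E (r : R) : qf A (u + r *: v) = qf A u + r * ((u^T *m A *m v) 0 0 + (v^T *m A *m u) 0 0) + r ^+ 2 * qf A v.
  have tz : (u + r *: v)^T = u^T + r *: v^T by rewrite linearD linearZ.
  rewrite /qf tz !(mulmxDl, mulmxDr) -?(scalemxAl, scalemxAr) -?(scalemxAl, scalemxAr) -?(scalemxAl, scalemxAr).
  move: (u^T *m A *m u) (v^T *m A *m u) (u^T *m A *m v) (v^T *m A *m v) => b1 b2 b3 b4.
  by rewrite !mxE; ring.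
by rewrite E -[X in u + X]scale1r E; ring.
Qed.

Lemma mxcont_pencil y1 y2 (s : R) : mxcont y1 -> mxcont y2 -> mxcont (fun t => y1 t + s *: y2 t).
Proof.
move=> c1 c2 i j t; rewrite (_ : (fun t => _) = (fun t => y1 t i j + s * y2 t i j)).
  by apply: cvgD; [exact: c1|apply: cvgM; [exact: cvg_cst|exact: c2]].
by apply/funext => r; rewrite !mxE.
Qed.

Lemma proj_pencil y1 y2 (s : R) : mxcont y1 -> mxcont y2 ->
  proj_state S D L (fun t => y1 t + s *: y2 t) = proj_state S D L y1 + s *: proj_state S D L y2.
Proof.
move=> c1 c2; rewrite /proj_state scale_col_mx add_col_mx; congr col_mx.
have -> : \mxcol_i Yf S D L (fun t => y1 t + s *: y2 t) i =
   \mxcol_i Yf S D L y1 i + s *: \mxcol_i Yf S D L y2 i.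
  have -> : s *: \mxcol_i Yf S D L y2 i = \mxcol_i (Yf S D L y2 i *m s%:M).
    by rewrite -mxcol_mul mul_mx_scalar.
  rewrite -mxcolD; apply/eq_mxcolP => i.
  have ig y : mxcont y -> mxintg (Iset S i) (fun t => f_on D L i t *m (y t)^T).
    by move=> cy; apply: L2_mulmx => //; [exact: L2_f_on|apply: L2_tr; exact: mxcont_L2].
  rewrite /Yf -mxint_mulr //; last exact: ig.
  rewrite -mxintD //; [|exact: ig|by apply: mxintg_mulr => //; exact: ig].
  by apply: mxint_eq => t _; rewrite linearD /= linearZ /= mulmxDr mul_mx_scalar scalemxAr.
by rewrite vecCD; congr (_ + _); apply/matrixP => i j; rewrite !mxE.
Qed.

Lemma storage_pencil y1 y2 (s : R) : mxcont y1 -> mxcont y2 ->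
  stor (fun t => y1 t + s *: y2 t) =
  (1 - s) * stor y1 + s * stor (fun t => y1 t + y2 t) + (s ^+ 2 - s) * stor y2.
Proof.
move=> c1 c2.
have c12 : mxcont (fun t => y1 t + y2 t).
  by have := @mxcont_pencil _ _ 1 c1 c2; under eq_fun do rewrite scale1r.
have p12 : proj_state S D L (fun t => y1 t + y2 t) = proj_state S D L y1 + proj_state S D L y2.
  have -> : (fun t => y1 t + y2 t) = (fun t => y1 t + 1 *: y2 t) by apply/funext => t; rewrite scale1r.
  by rewrite proj_pencil // scale1r.
have wd i : window S Q Rr (fun t => y1 t + s *: y2 t) i =
  (1 - s) * window S Q Rr y1 i + s * window S Q Rr (fun t => y1 t + y2 t) i + (s ^+ 2 - s) * window S Q Rr y2 i.
  have ig y : mxcont y -> intg (Iset S i) (fun t => qf (Q i) (y t) + (t - - rcur S i) * qf (Rr i) (y t)).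
    by move=> cy; apply: intgD => //; [exact: qf_intg|exact: weighted_intg].
  have [i1 i2 i12] := And3 (ig _ c1) (ig _ c2) (ig _ c12).
  have [j1 j2 j12] := And3 (intgZ (1 - s) (mI i) i1) (intgZ (s ^+ 2 - s) (mI i) i2) (intgZ s (mI i) i12).
  rewrite /window -!RintZ // -!RintD //; last by apply: intgD.
  by apply: Rint_eq => t _; rewrite !qf_pencil; ring.
rewrite /storage proj_pencil // qf_pencil p12 (eq_bigr _ (fun i _ => wd i)) !big_split /= -!mulr_sumr.
by rewrite !mulrDr addrACA [X in X + _]addrACA.
Qed.

(** Nonnegativity of the quadratic polynomial [s |-> stor (y1 + s y2)] at [s =
    1/t] and [s = - 1/t] bounds the mixed term, as in the proof of the
    Cauchy-Schwarz inequality. *)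
Lemma storage_perturb y1 y2 (t : R) : 0 < t -> mxcont y1 -> mxcont y2 ->
  `|stor (fun s => y1 s + y2 s) - stor y1| <= t * stor y1 + (1 + t^-1) * stor y2.
Proof.
move=> t0 c1 c2; have u0 : 0 < t^-1 by rewrite invr_gt0.
have := storage_ge0 (@mxcont_pencil _ _ t^-1 c1 c2); have := storage_ge0 (@mxcont_pencil _ _ (- t^-1) c1 c2).
have := storage_ge0 c2; rewrite !storage_pencil //.
set A := stor y1; set B := stor y2; set C := stor (fun s => y1 s + y2 s) => B0 h1 h2.
have tu : t * t^-1 = 1 by rewrite mulfV // gt_eqF.
have h1' : 0 <= t * ((1 - - t^-1) * A + - t^-1 * C + ((- t^-1) ^+ 2 - - t^-1) * B) by rewrite mulr_ge0 // ltW.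
have h2' : 0 <= t * ((1 - t^-1) * A + t^-1 * C + (t^-1 ^+ 2 - t^-1) * B) by rewrite mulr_ge0 // ltW.
have e1 : t * ((1 - - t^-1) * A + - t^-1 * C + ((- t^-1) ^+ 2 - - t^-1) * B) =
   t * A + (t * t^-1) * A - (t * t^-1) * C + (t * t^-1) * (t^-1 + 1) * B by ring.
have e2 : t * ((1 - t^-1) * A + t^-1 * C + (t^-1 ^+ 2 - t^-1) * B) =
   t * A - (t * t^-1) * A + (t * t^-1) * C + (t * t^-1) * (t^-1 - 1) * B by ring.
rewrite e1 in h1'; rewrite e2 in h2'; rewrite tu !mul1r in h1' h2'.
rewrite ler_norml; apply/andP; split; lra.
Qed.

Lemma storage_sup : exists2 C : R, 0 < C & forall y (eta : R), mxcont y -> 0 <= eta ->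
  (forall s, Jset S s -> sqn (y s) <= eta) -> stor y <= C * eta.
Proof.
have [C C0 CP] := storage_upper hS hD hL P1 P2 P3 Q posR.
have [K K0 KP] := qf_family_le Rr.
pose W := \sum_i (rcur S i - rprev S i).
have W0 : 0 <= W by apply: sumr_ge0 => i _; rewrite subr_ge0 ltW //; exact: rprev_lt_rcur.
exists (C * (1 + K * W)); first by rewrite mulr_gt0 // ltr_wpDr // mulr_ge0 // ltW.
move=> y eta cy e0 le; apply: (le_trans (CP y cy)); rewrite -mulrA ler_pM2l // mulrDl mul1r.
apply: lerD; first by apply: le; exact: Jset0.
rewrite /energy /W mulr_sumr mulr_suml; apply: ler_sum => i _.
have li : - rcur S i <= - rprev S i by rewrite lerN2 ltW //; exact: rprev_lt_rcur.
rewrite (_ : _ * eta = (K * eta) * (- rprev S i - - rcur S i)); last by ring.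
rewrite -Rint_cst //; apply: Rint_le => //; first exact: qf_intg.
  by apply: intg_cont; apply: continuous_within; exact: cst_continuous.
move=> s Is; apply: (le_trans (KP i _)); rewrite ler_pM2l //.
by apply: le; exact: (Iset_sub_J hS Is).
Qed.

Lemma storage_sup_continuous y (e : R) : mxcont y -> 0 < e ->
  exists2 eta : R, 0 < eta & forall y', mxcont y' -> (forall s, Jset S s -> sqn (y' s) <= eta) ->
    `|stor (fun s => y s + y' s) - stor y| < e.
Proof.
move=> cy e0; have [C C0 CP] := storage_sup; have A0 := storage_ge0 cy.
pose t := e / (3 * (1 + stor y)).
have d0 : 0 < 3 * (1 + stor y) by rewrite mulr_gt0 // ltr_pwDl.
have t0 : 0 < t by rewrite divr_gt0.
have k0 : 0 < 3 * ((1 + t^-1) * C) by rewrite !mulr_gt0 // addr_gt0 // invr_gt0.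
pose eta := e / (3 * ((1 + t^-1) * C)).
have eta0 : 0 < eta by rewrite divr_gt0.
exists eta => // y' cy' hy'; apply: (le_lt_trans (storage_perturb t0 cy cy')).
have h1 := CP y' eta cy' (ltW eta0) hy'.
have h2 : (1 + t^-1) * stor y' <= (1 + t^-1) * (C * eta).
  by rewrite ler_pM2l // addr_gt0 // invr_gt0.
have h3 : 3 * ((1 + t^-1) * (C * eta)) = e.
  by rewrite (mulrA _ C) (mulrA 3) /eta mulrC divfK // gt_eqF.
have h4 : t * (3 * (1 + stor y)) = e by rewrite /t divfK // gt_eqF.
have h5 : t * (3 * (1 + stor y)) = 3 * t + 3 * (t * stor y) by ring.
lra.
Qed.

End SupNorm.

(** * Extension of histories and the uniform norm *)

Section Retraction.
Context {R : realType}.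
Implicit Types (a b s t : R) (g : R -> R).

Definition clamp a b s := Num.max a (Num.min s b).

Lemma clamp_itv a b s : a <= b -> a <= clamp a b s <= b.
Proof. by move=> ab; rewrite /clamp le_max lexx /= ge_max ab ge_min lexx orbT. Qed.

Lemma clamp_id a b s : a <= s <= b -> clamp a b s = s.
Proof. by move=> /andP[h1 h2]; rewrite /clamp (min_idPl h2) (max_idPr h1). Qed.

Lemma clamp_lipschitz a b s t : `|clamp a b t - clamp a b s| <= `|t - s|.
Proof.
have h1 := ler_norm (t - s); have h2 := ler_norm (s - t); rewrite distrC in h2.
rewrite /clamp ler_norml; case: (leP s b) => c1; case: (leP t b) => c2; case: (leP a s) => c3;
  case: (leP a t) => c4; case: (leP a b) => c5; apply/andP; split; lra.
Qed.

Lemma clamp_continuous a b g : a <= b -> {within `[a, b], continuous g} ->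
  continuous (fun s => g (clamp a b s)).
Proof.
move=> ab cg s; apply/cvgrPdist_le => e e0.
have [r r0 rP] := within_eps cg (clamp_itv s ab) e0.
apply/nbhs_ballP; exists r => // t; rewrite /ball /= => st.
rewrite distrC; apply: rP; first exact: clamp_itv.
by apply: le_lt_trans (clamp_lipschitz _ _ _ _) _; rewrite distrC.
Qed.

Lemma max_lipschitz a s t : `|Num.max a t - Num.max a s| <= `|t - s|.
Proof.
have h1 := ler_norm (t - s); have h2 := ler_norm (s - t); rewrite distrC in h2.
by rewrite ler_norml; case: (leP a s) => c3; case: (leP a t) => c4; apply/andP; split; lra.
Qed.

(** Near a given point only one of the intervals matters. *)
Lemma ray_continuous a g : (forall b, a < b -> {within `[a, b], continuous g}) ->
  continuous (fun s => g (Num.max a s)).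
Proof.
move=> cg s; apply/cvgrPdist_le => e e0; set c := Num.max a s.
have ac : a <= c by rewrite /c le_max lexx.
have ac1 : a < c + 1 by apply: (le_lt_trans ac); rewrite ltrDl.
have cI : a <= c <= c + 1 by rewrite ac lerDl ler01.
have [r r0 rP] := within_eps (cg (c + 1) ac1) cI e0.
apply/nbhs_ballP; exists (Num.min r 1) => /=; first by rewrite lt_min r0 ltr01.
move=> t; rewrite /ball /= lt_min distrC => /andP[st st1].
have h := max_lipschitz a s t.
rewrite distrC; apply: rP; last exact: le_lt_trans h st.
rewrite le_max lexx /=; have := le_lt_trans h st1; rewrite -/c.
by have := ler_norm (Num.max a t - c); lra.
Qed.

End Retraction.

Section History.
Context {R : realType} (n m p q nu : nat).
Context (S : plant R n m p q nu).
Hypothesis hS : is_plant S.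
Implicit Types psi : R -> 'cV[R]_n.

Let rmax0 : - rmax S <= 0. Proof. by rewrite oppr_le0; exact: (delay_ge0 hS). Qed.

Lemma CJ_entry psi i j : CJ S psi -> {within `[- rmax S, 0], continuous (fun s => psi s i j)}.
Proof.
move=> cpsi.
by apply: (@within_continuous_comp _ _ _ _ psi (fun M : 'cV[R]_n => M i j)) => // M _; exact: coord_continuous.
Qed.

(** Histories are only known on the delay interval; clamping extends a
    continuous one to the whole line, where sliding integrals are defined
    for all times. *)
Definition clampJ psi : R -> 'cV[R]_n := fun s => psi (clamp (- rmax S) 0 s).

Lemma clampJ_cont psi : CJ S psi -> mxcont (clampJ psi).
Proof. by move=> cpsi i j; apply: (@clamp_continuous _ _ _ (fun s => psi s i j) rmax0); exact: CJ_entry. Qed.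

Lemma clampJ_id psi s : Jset S s -> clampJ psi s = psi s.
Proof. by rewrite /Jset /= in_itv /= => sJ; rewrite /clampJ clamp_id. Qed.

Lemma enormE k (u : 'cV[R]_k) : enorm u ^+ 2 = sqn u.
Proof. by rewrite sqr_sqrtr //; exact: sqn_ge0. Qed.

Lemma enorm_supnorm psi s : CJ S psi -> Jset S s -> enorm (psi s) <= supnorm S psi.
Proof.
move=> cpsi sJ; apply: ub_le_sup; last by exists s.
have bnd i : exists C : R, forall t, Jset S t -> psi t i 0 ^+ 2 <= C.
  have [C C0 CP] := within_bounded rmax0 (@CJ_entry _ i 0 cpsi); exists (C ^+ 2) => t.
  by rewrite /Jset /= in_itv /= => /CP h; rewrite -real_normK ?num_real // lerXn2r ?nnegrE // ltW.
have [C CP] := choice bnd; exists (Num.sqrt (\sum_i C i)) => _ [t tJ <-].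
by apply: ler_wsqrtr; apply: ler_sum => i _; exact: CP.
Qed.

Lemma supnorm_ge0 psi : CJ S psi -> 0 <= supnorm S psi.
Proof. by move=> cpsi; apply: le_trans (enorm_supnorm cpsi (Jset0 hS)); exact: sqrtr_ge0. Qed.

Lemma sqn_supnorm psi s : CJ S psi -> Jset S s -> sqn (psi s) <= supnorm S psi ^+ 2.
Proof.
move=> cpsi sJ; rewrite -enormE; apply: lerXn2r; rewrite ?nnegrE ?supnorm_ge0 //.
  exact: sqrtr_ge0.
exact: enorm_supnorm.
Qed.

Lemma sqn_mulmx_le k l (A : 'M[R]_(k, l)) : exists2 C : R, 0 < C & forall u : 'cV[R]_l, sqn (A *m u) <= C * sqn u.
Proof.
have [C C0 CP] := qf_le (A^T *m A); exists C => // u.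
by apply: le_trans (CP u); rewrite sqnE /qf trmx_mul !mulmxA ler_norm.
Qed.

End History.

Section StorageFunctional.
Context {R : realType} (n m p q nu : nat) (d delta mu : 'I_nu -> nat).
Context (S : plant R n m p q nu) (D : decomposition R n m p d delta mu) (L : factors R d delta mu).
Hypothesis hS : is_plant S.
Hypothesis hD : is_decomposition S D.
Hypothesis hL : is_factors S D L.
Context (P1 : 'M[R]_n) (P2 : 'M[R]_(n, (\sum_i d i) * n)) (P3 : 'M[R]_((\sum_i d i) * n)) (Q Rr : 'I_nu -> 'M[R]_n).
Hypothesis sQ : forall i, issym (Q i).
Hypothesis posP : posdef (block_mx P1 P2 P2^T P3
  + ((0 : 'M[R]_n) ⊕ diag_catn (fun i => (1%:M : 'M[R]_(d i)) ⊗ Q i))).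
Hypothesis posQ : posdef (diag_cat Q).
Hypothesis posR : posdef (diag_cat Rr).
Notation stor := (storage S D L P1 P2 P3 Q Rr).

Lemma storage_is_functional (A : 'M[R]_n) :
  storage_functional S (fun phi => stor (fun s => A *m phi s)).
Proof.
have clampE phi : stor (fun s => A *m phi s) = stor (fun s => A *m clampJ S phi s).
  by apply: (storage_eq D L hS) => s sJ; rewrite clampJ_id.
have cA phi : CJ S phi -> mxcont (fun s => A *m clampJ S phi s).
  by move=> cphi; apply: mxcont_mull; exact: clampJ_cont.
have [K K0 KP] := sqn_mulmx_le A.
split.
- by move=> phi cphi; rewrite clampE; apply: (storage_ge0 hD hL sQ posP posQ posR); exact: cA.
- have c0 : mxcont (fun s : R => A *m (0 : 'cV[R]_n)) by move=> i j; exact: cst_continuous.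
  have [C C0 CP] := storage_sup hS hD hL P1 P2 P3 Q posR.
  apply/eqP; rewrite eq_le (storage_ge0 hD hL sQ posP posQ posR c0) andbT.
  rewrite -[leRHS](mulr0 C); apply: CP => // s _.
  by rewrite mulmx0 sqnE mulmx0 mxE.
- move=> phi cphi e e0.
  have [eta eta0 etaP] := storage_sup_continuous hS hD hL sQ posP posQ posR (cA phi cphi) e0.
  (* squaring the uniform norm and passing through A costs the factor K *)
  exists (Num.sqrt (eta / K)); first by rewrite sqrtr_gt0 divr_gt0.
  move=> psi cpsi small.
  have cB : CJ S (fun th => psi th - phi th) by move=> t; apply: cvgB; [exact: cpsi|exact: cphi].
  rewrite (clampE psi) (clampE phi); have := etaP _ (cA _ cB).
  rewrite (_ : (fun s => A *m clampJ S phi s + _) = (fun s => A *m clampJ S psi s)); last first.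
    by apply/funext => s; rewrite -mulmxDr /clampJ addrC subrK.
  apply => s sJ; apply: (le_trans (KP _)); rewrite mulrC -ler_pdivlMr //.
  rewrite clampJ_id //; apply: (le_trans (sqn_supnorm hS cB sJ)).
  rewrite -[leRHS]sqr_sqrtr; last by rewrite ltW // divr_gt0.
  by apply: lerXn2r; rewrite ?nnegrE ?supnorm_ge0 ?sqrtr_ge0 // ltW.
Qed.

End StorageFunctional.

(** * The closed loop in terms of the projections *)

Section AlmostEverywhere.
Context {R : realType}.
Notation leb := (@lebesgue_measure R).

Lemma ae_imp (P Q : R -> Prop) : (forall t, P t -> Q t) ->
  {ae leb, forall t, P t} -> {ae leb, forall t, Q t}.
Proof. by move=> PQ; apply: filterS; first exact: (ae_filter_ringOfSetsType leb). Qed.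

Lemma ae_and (P Q : R -> Prop) :
  {ae leb, forall t, P t} -> {ae leb, forall t, Q t} -> {ae leb, forall t, P t /\ Q t}.
Proof. by move=> hP hQ; apply: filterI => //; exact: (ae_filter_ringOfSetsType leb). Qed.

End AlmostEverywhere.

Section ClosedLoop.
Context {R : realType} (n m p q nu : nat) (d delta mu : 'I_nu -> nat).
Context (S : plant R n m p q nu) (D : decomposition R n m p d delta mu) (L : factors R d delta mu).
Notation leb := (@lebesgue_measure R).
Hypothesis hS : is_plant S.
Hypothesis hD : is_decomposition S D.
Hypothesis hL : is_factors S D L.
Context (X : 'M[R]_n) (V : 'M[R]_(p, n)).
Hypothesis uX : X \in unitmx.
Implicit Types (y : R -> 'cV[R]_n) (i : 'I_nu).

Let mI i : measurable (Iset S i). Proof. exact: measurable_itv. Qed.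

Lemma ae_mxint_eq k l i (F G : R -> 'M[R]_(k, l)) : mxintg (Iset S i) F -> mxintg (Iset S i) G ->
  {ae leb, forall s, Iset S i s -> F s = G s} -> mxint (Iset S i) F = mxint (Iset S i) G.
Proof.
move=> iF iG ae; apply/matrixP => r c; rewrite !mxE; apply: ae_Rint_eq => //.
by apply: ae_imp ae => s h /h ->.
Qed.

Lemma mxint_vecC k l (F : R -> 'M[R]_(k, l)) i :
  mxint (Iset S i) (fun s => vecC (F s)) = vecC (mxint (Iset S i) F).
Proof. by apply/matrixP => r c; rewrite !mxE; apply: Rint_eq => s _; rewrite mxE. Qed.

(** Replace the distributed kernel by its decomposition almost everywhere, and
    [g_] by the orthonormal kernels. *)
Lemma distributed_term a c i (K : R -> 'M[R]_(a, c)) (Kh : 'M[R]_(a, kap d delta mu i * c)) (G : 'M[R]_(c, n)) y :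
  L2 (Iset S i) K -> mxcont y ->
  {ae leb, forall s, Iset S i s -> K s = Kh *m tenscolI c (g_ D i s)} ->
  mxint (Iset S i) (fun s => K s *m (G *m y s)) =
  Kh *m vecC ((T_ S D L i *m Yh S D L y i + Tt_ L i *m Ye S D L y i) *m G^T).
Proof.
move=> sK cy ae; have cGy : mxcont (fun s => G *m y s) by exact: mxcont_mull.
have ig : mxintg (Iset S i) (fun s => g_ D i s *m (G *m y s)^T).
  by apply: L2_mulmx => //; [exact: (L2_g hD)|apply: L2_tr; exact: mxcont_L2].
have iv : mxintg (Iset S i) (fun s => vecC (g_ D i s *m (G *m y s)^T)).
  by move=> r c'; apply: eq_intg (ig (mxtens_unindex r).1 (mxtens_unindex r).2) => // s _; rewrite [RHS]mxE.
rewrite (@ae_mxint_eq _ _ _ _ (fun s => Kh *m vecC (g_ D i s *m (G *m y s)^T))).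
- rewrite mxint_mull // mxint_vecC (T_stack hD hL) // -mxint_mulr //.
    by congr (_ *m vecC _); apply: mxint_eq => s _; rewrite trmx_mul mulmxA.
  by apply: L2_mulmx => //; [exact: (L2_g hD)|apply: L2_tr; exact: mxcont_L2].
- by apply: L2_mulmx => //; exact: mxcont_L2.
- exact: mxintg_mull.
- by apply: ae_imp ae => s h /h ->; rewrite -mulmxA tenscolI_vecC.
Qed.

Notation vstack y t := (vecC (stack (ydel S y t) (Yh S D L (hist y t)) (Ye S D L (hist y t)))).

(** Shared by the state equation and the output: with [x = X y] and gain [V
    X^-1] the gain acts as [V] on [y]. *)
Lemma closed_loop_sum k (a : 'I_nu.+1 -> 'M[R]_(k, n)) (b : 'I_nu.+1 -> 'M[R]_(k, p))
    (at_ : 'I_nu -> R -> 'M[R]_(k, n)) (bt : 'I_nu -> R -> 'M[R]_(k, p))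
    (ah : forall i, 'M[R]_(k, kap d delta mu i * n)) (bh : forall i, 'M[R]_(k, kap d delta mu i * p)) y t :
  (forall i, L2 (Iset S i) (at_ i)) -> (forall i, L2 (Iset S i) (bt i)) ->
  (forall i, {ae leb, forall s, Iset S i s -> at_ i s = ah i *m tenscolI n (g_ D i s)}) ->
  (forall i, {ae leb, forall s, Iset S i s -> bt i s = bh i *m tenscolI p (g_ D i s)}) ->
  mxcont y ->
  \sum_(j < nu.+1) (a j + b j *m (V *m invmx X)) *m (X *m y (t - delay S j)) +
  \sum_(i < nu) mxint (Iset S i) (fun s => (at_ i s + bt i s *m (V *m invmx X)) *m (X *m y (t + s))) =
  \sum_j (a j *m (X *m ydel S y t j) + b j *m (V *m ydel S y t j)) +
  \sum_i (ah i *m vecC ((T_ S D L i *m Yh S D L (hist y t) i + Tt_ L i *m Ye S D L (hist y t) i) *m X^T) +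
          bh i *m vecC ((T_ S D L i *m Yh S D L (hist y t) i + Tt_ L i *m Ye S D L (hist y t) i) *m V^T)).
Proof.
move=> sa sb ea eb cy; have ch : mxcont (hist y t) by exact: mxcont_shift.
have gain k' (B : 'M[R]_(k', p)) u : B *m (V *m invmx X) *m (X *m u) = B *m (V *m u).
  by rewrite -!mulmxA; congr (_ *m (_ *m _)); rewrite mulmxA mulVmx // mul1mx.
congr (_ + _); first by apply: eq_bigr => j _; rewrite mulmxDl gain.
apply: eq_bigr => i _.
rewrite -(distributed_term X (sa i) ch (ea i)) -(distributed_term V (sb i) ch (eb i)) -mxintD //.
- by apply: mxint_eq => s _; rewrite mulmxDl gain.
- by apply: L2_mulmx => //; apply: mxcont_L2; exact: mxcont_mull.
- by apply: L2_mulmx => //; apply: mxcont_L2; exact: mxcont_mull.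
Qed.

Lemma field_stack y (w : R -> 'cV[R]_q) t (z : 'cV[R]_m) : mxcont y ->
  closed_loop_field S (V *m invmx X) (fun s => X *m y s) w t =
  acPi S D L X V *m col_mx (col_mx (vstack y t) (w t)) z.
Proof.
move=> cy; rewrite acPi_stack /closed_loop_field; congr (_ + _).
by apply: closed_loop_sum => // i; case: hS => _ _ /(_ i) [] // ? ? ? ?;
  case: (hD i) => _ ae _ _; apply: ae_imp ae => s h /h [].
Qed.

Lemma output_stack y (w : R -> 'cV[R]_q) t : mxcont y ->
  closed_loop_output S (V *m invmx X) (fun s => X *m y s) w t =
  acSigma S D L X V *m col_mx (vstack y t) (w t).
Proof.
move=> cy; rewrite acSigma_stack /closed_loop_output; congr (_ + _).
by apply: closed_loop_sum => // i; case: hS => _ _ /(_ i) [] // ? ? ? ?;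
  case: (hD i) => _ ae _ _; apply: ae_imp ae => s h /h [].
Qed.

End ClosedLoop.

(** * The dissipation inequality with a margin *)

Section Dissipation.
Context {R : realType} (n m p q nu : nat) (d delta mu : 'I_nu -> nat).
Context (S : plant R n m p q nu) (D : decomposition R n m p d delta mu) (L : factors R d delta mu).
Notation leb := (@lebesgue_measure R).
Hypothesis hS : is_plant S.
Hypothesis hD : is_decomposition S D.
Hypothesis hL : is_factors S D L.
Context (J1 Jt : 'M[R]_m) (J2 : 'M[R]_(m, q)) (J3 : 'M[R]_q) (alpha : 'I_(beta d delta mu) -> R).
Context (X P1 : 'M[R]_n) (P2 : 'M[R]_(n, (\sum_i d i) * n)) (P3 : 'M[R]_((\sum_i d i) * n)) (Q Rr : 'I_nu -> 'M[R]_n)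
  (V : 'M[R]_(p, n)).
Hypothesis sJ1 : issym J1.
Hypothesis uJ1 : J1 \in unitmx.
Hypothesis sX : issym X.
Hypothesis sP3 : issym P3.
Hypothesis sR : forall i, issym (Rr i).
Hypothesis posR : posdef (diag_cat Rr).
Notation Theta := (Sy (col_mx 1%:M
           (col_mx (col_mx (col_cat (fun i => (alpha i)%:M)) (0 : 'M[R]_(q, n)))
                   (0 : 'M[R]_(m, n)))
         *m row_mx (- X) (acPi S D L X V))
     + block_mx 0 (acP m q L P1 P2) (acP m q L P1 P2)^T
         (acPhi S D L J1 Jt J2 J3 X P2 P3 Q Rr V)).
Hypothesis lmi : negdef Theta.
Implicit Types (y : R -> 'cV[R]_n) (i : 'I_nu).
Notation stor := (storage S D L P1 P2 P3 Q Rr).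
Notation vstack y t := (vecC (stack (ydel S y t) (Yh S D L (hist y t)) (Ye S D L (hist y t)))).

(** The leading block of the matrix inequality is [- 2 X]: test with a kernel
    vector of [X], extended by zero. *)
Lemma lmi_unit : X \in unitmx.
Proof.
rewrite -row_free_unit -kermx_eq0; apply/eqP/row_matrixP => i; rewrite row0; apply/eqP.
apply/negPn/negP => u0; pose u : 'cV[R]_n := (row i (kermx X))^T.
have Xu : X *m u = 0.
  by rewrite /u -{1}sX -trmx_mul; have /sub_kermxP -> := row_sub i (kermx X); rewrite trmx0.
have nu0 : col_mx u (0 : 'cV[R]_(beta d delta mu * n + q + m)) != 0.
  by rewrite col_mx_eq0 negb_and trmx_eq0 u0.
case: lmi => _ /(_ _ nu0); rewrite -/(qf _ _) qfD qf_Sy mul_row_col mulNmx Xu oppr0 mulmx0 addr0.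
have q00 k (F : 'M[R]_k) : qf F 0 = 0 by rewrite /qf mulmx0 mxE.
by rewrite mulmx0 mxE mulr0 add0r qf_offdiag q00 mulmx0 mxE mulr0 addr0 ltxx.
Qed.

(** [zeta] is the stationary point of the part of the form that contains it, so
    that the square is completed. *)
Lemma supply_elim (z : 'cV[R]_m) (w : 'cV[R]_q) : let zeta := - (invmx J1 *m (Jt *m z)) in
  2 * ((zeta^T *m Jt - w^T *m J2^T) *m z) 0 0 - qf J3 w + qf J1 zeta = - supply J1 Jt J2 J3 z w.
Proof.
move=> zeta; pose s := ((Jt *m z)^T *m invmx J1 *m (Jt *m z)) 0 0.
have sJi : (invmx J1)^T = invmx J1 by rewrite trmx_inv sJ1.
have zT : zeta^T = - ((Jt *m z)^T *m invmx J1) by rewrite /zeta linearN /= trmx_mul sJi.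
have e1 : (zeta^T *m Jt *m z) 0 0 = - s by rewrite zT !mulNmx mxE /s -!mulmxA.
have e2 : qf J1 zeta = s.
  by rewrite /qf zT /zeta mulmxN mulNmx !mulNmx opprK -(mulmxA (Jt *m z)^T) mulVmx // mulmx1 mulmxA.
have e3 : (w^T *m J2^T *m z) 0 0 = (z^T *m J2 *m w) 0 0.
  by rewrite -[LHS]trmx_11 !trmx_mul !trmxK mulmxA.
have e4 : (z^T *m (Jt^T *m invmx J1 *m Jt) *m z) 0 0 = s by rewrite /s trmx_mul !mulmxA.
rewrite /supply tr_col_mx mul_row_block mul_row_col e2 mulmxBl.
have D1 (a b : 'M[R]_1) : (a + b) 0 0 = a 0 0 + b 0 0 by rewrite mxE.
have N1 (a : 'M[R]_1) : (- a) 0 0 = - a 0 0 by rewrite mxE.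
rewrite !mulmxDl !D1 N1 e1 e3 e4 /qf; lra.
Qed.

Lemma stack_sqn (y : 'I_nu.+1 -> 'cV[R]_n) (Yh : forall i, 'M[R]_(vkap d delta i, n)) (Ye : forall i, 'M[R]_(mu i, n)) :
  sqn (y ord0) + (\sum_i \tr (Yh i *m (Yh i)^T) + \sum_i \tr (Ye i *m (Ye i)^T)) <= sqn (vecC (stack y Yh Ye)).
Proof.
have sqn_cast k k' (e : k = k') (u : 'cV[R]_k) : sqn (castmx (e, erefl) u) = sqn u.
  by case: k' / e; rewrite castmx_id.
rewrite stack_dim2 sqn_cast !sqn_col !sqn_vecC !trace_mxcol -!addrA lerD2l lerDr.
exact: tr_sqn_ge0.
Qed.

(** Pure arithmetic: [BR] are the forms of the projections in [R_i], [BY] their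
    squared norms, [H] the squared norm of the whole vector. Part of the
    margin [e * BY] is traded for [BR], so that a multiple of the full [E]
    survives. *)
Lemma rate_bound (C K e b a r s E N BY BR H W : R) : 0 < C -> 0 < K -> 0 < e -> 0 < b -> 0 < a ->
  b <= 1 -> b <= e / K -> a <= e -> a <= b ->
  e * H <= - (r + E - BR - s) -> N + BY <= H -> BR <= E -> BR <= K * BY -> W <= C * (N + E) ->
  0 <= N -> 0 <= E -> 0 <= BY -> r <= s - a / C * W.
Proof.
move=> C0 K0 e0 b0 a0 b1 bK ae ab h1 h2 h3 h4 h5 N0 E0 B0.
have k1 : e * (N + BY) <= e * H by rewrite ler_pM2l.
have k2 : b * BR <= b * (K * BY) by rewrite ler_pM2l.
have k3 : b * (K * BY) <= e * BY by rewrite mulrA ler_wpM2r // -ler_pdivlMr.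
have k4 : b * (E - BR) <= E - BR by rewrite ler_piMl // subr_ge0.
have k5 : a * N <= e * N by rewrite ler_wpM2r.
have k6 : a * E <= b * E by rewrite ler_wpM2r.
have k7 : a / C * W <= a * (N + E) by rewrite -mulrA ler_pM2l // ler_pdivrMl.
rewrite !mulrDr in k1 k4 k7; lra.
Qed.

Lemma dissipation_rate : exists2 lam : R, 0 < lam & forall y t w (y' : 'cV[R]_n), mxcont y ->
  X *m y' = acPi S D L X V *m col_mx (col_mx (vstack y t) w) 0 ->
  storage_rate S D L P1 P2 P3 Q Rr y t y' <=
  supply J1 Jt J2 J3 (acSigma S D L X V *m col_mx (vstack y t) w) w - lam * stor (hist y t).
Proof.
have [C C0 CP] := storage_upper hS hD hL P1 P2 P3 Q posR.
have [K K0 KP] := qf_family_le Rr.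
have [e e0 eP] : exists2 e : R, 0 < e & forall u, e * sqn u <= - qf Theta u.
  have [e e0 eP] : exists2 e : R, 0 < e & forall u, e * sqn u <= qf (- Theta) u.
    by apply: posdef_coercive => u u0; rewrite qfN oppr_gt0; case: lmi => _; exact.
  by exists e => // u; rewrite -qfN.
(* b keeps a share of the energy after BR has been paid for *)
pose b := Num.min 1 (e / K).
have b0 : 0 < b by rewrite lt_min ltr01 divr_gt0.
pose a := Num.min e b.
have a0 : 0 < a by rewrite lt_min e0 b0.
exists (a / C); first by rewrite divr_gt0.
move=> y t w y' cy Xy'.
have ch : mxcont (hist y t) by exact: mxcont_shift.
set z := acSigma S D L X V *m _.
pose zeta := - (invmx J1 *m (Jt *m z)).
pose vs := vstack y t.
have Xy2 : X *m y' = acPi S D L X V *m col_mx (col_mx vs w) zeta.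
  by rewrite Xy' /acPi !mul_row_col !mul0mx.
have := eP (col_mx y' (col_mx (col_mx vs w) zeta)).
rewrite lmi_stack // -/z.
set H := sqn (col_mx y' _) => h1.
have hy0 : ydel S y t ord0 = y t by rewrite /ydel; case: hS => -> _ _; rewrite subr0.
have hXi : \mxcol_i Xi_ L (Yh S D L (hist y t)) i = \mxcol_i Yf S D L (hist y t) i.
  by apply/eq_mxcolP => i; rewrite (Xi_Yh hD hL).
rewrite hXi hy0 in h1.
have h2 := supply_elim z w; rewrite -/zeta in h2.
pose BY := \sum_i \tr (Yh S D L (hist y t) i *m (Yh S D L (hist y t) i)^T) + \sum_i \tr (Ye S D L (hist y t) i *m (Ye S D L (hist y t) i)^T).
pose BR := \sum_i \tr (Yh S D L (hist y t) i *m Rr i *m (Yh S D L (hist y t) i)^T) + \sum_i \tr (Ye S D L (hist y t) i *m Rr i *m (Ye S D L (hist y t) i)^T).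
have h3 : sqn (y t) + BY <= H.
  rewrite /H !sqn_col -hy0; apply: (le_trans (stack_sqn _ _ _)); rewrite -/vs.
  have := sqn_ge0 y'; have := sqn_ge0 w; have := sqn_ge0 zeta; lra.
have h4 : BR <= energy S Rr (hist y t).
  rewrite /BR -big_split /= /energy; apply: ler_sum => i _.
  by apply: (kern_bessel hD hL) => //; [exact: sR|exact: qf_ge0].
have h5 : BR <= K * BY.
  by rewrite /BR /BY mulrDr !mulr_sumr; apply: lerD; apply: ler_sum => i _; apply: tr_qf_le => u; exact: KP.
have h6 := CP _ ch; rewrite (_ : hist y t 0 = y t) in h6; last by rewrite /hist addr0.
have E0 := energy_ge0 S posR (hist y t).
have BY0 : 0 <= BY by apply: addr_ge0; apply: sumr_ge0 => i _; exact: tr_sqn_ge0.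
have h7 : e * H <= - (storage_rate S D L P1 P2 P3 Q Rr y t y' + energy S Rr (hist y t) - BR - supply J1 Jt J2 J3 z w).
  apply: (le_trans h1); rewrite -[supply J1 Jt J2 J3 z w]opprK -h2 /storage_rate /BR /ydel /rprev /rcur.
  rewrite lerN2 le_eqVlt; apply/orP; left; apply/eqP; ring.
have [b1 bK ae ab] : [/\ b <= 1, b <= e / K, a <= e & a <= b].
  by split; [rewrite /b|rewrite /b|rewrite /a|rewrite /a]; rewrite ge_min lexx ?orbT.
exact: (rate_bound C0 K0 e0 b0 a0 b1 bK ae ab h7 h3 h4 h5 h6 (sqn_ge0 _) E0 BY0).
Qed.

End Dissipation.

(** * Integration of differential inequalities *)

Section IntegratedInequality.
Context {R : realType}.
Notation leb := (@lebesgue_measure R).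

Lemma ae_primitive (a b : R) (g : R -> R) : intg `[a, b] g ->
  {ae leb, forall t, a < t -> t < b ->
     is_derive t 1 (fun t => \int[leb]_(s in `[a, t]) g s) (g t)}.
Proof.
move=> ig; pose f := g \_ `[a, b].
have iT : leb.-integrable setT (EFin \o f).
  rewrite (_ : EFin \o f = (EFin \o g) \_ `[a, b]); last by rewrite restrict_EFin.
  exact/(integrable_mkcond _ _).1.
have iy y : leb.-integrable [set` Interval (BLeft a) (BRight y)] (EFin \o f).
  by apply: (integrableS measurableT) => //; exact: measurable_itv.
have locf : locally_integrable setT f.
  by apply: open_integrable_locally => //; exact: openT.
have := FTC1 iy locf; apply: ae_imp => t ft a_t tb.
have [df ef] := ft (ltac:(by rewrite /= lte_fin)).
have ft' : f t = g t by rewrite /f patchE mem_set //= in_itv /= (ltW a_t) (ltW tb).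
apply: (@near_eq_is_derive _ _ _ (fun t => \int[leb]_(s in `[a, t]) f s)); last first.
  by apply: DeriveDef => //; rewrite -ft' -ef derive1E.
have : \forall s \near t, s < b by exact: lt_nbhsl.
apply: filterS => s sb; apply: Rint_eq => u; rewrite /= in_itv /= => /andP[au us].
by rewrite /f patchE mem_set //= in_itv /= au (le_trans us (ltW sb)).
Qed.

Lemma ac_eq (a b : R) (f g : R -> R) : (forall t, a <= t -> t <= b -> f t = g t) ->
  abs_continuous a b f -> abs_continuous a b g.
Proof.
move=> e af; apply: (@ac_dominated _ 1 _ _ f f) => // u v au uv vb.
by rewrite mul1r -!e ?(le_trans au uv) ?(le_trans uv vb) // lerDl.
Qed.

(** Subtract the primitive of [g] and apply monotonicity; at almost every point
    the primitive has derivative [g] by Lebesgue's theorem. *)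
Lemma ac_dissipation (a b : R) (F g : R -> R) : a <= b -> abs_continuous a b F -> intg `[a, b] g ->
  {ae leb, forall t, a < t -> t < b -> exists2 l, is_derive t 1 F l & l <= g t} ->
  F b - F a <= \int[leb]_(t in `[a, b]) g t.
Proof.
move=> ab aF ig dF; pose G t := \int[leb]_(s in `[a, t]) g s.
have aG : abs_continuous a b (fun t => -1 * G t).
  by apply: acM => //; [exact: ac_cst|exact: ac_primitive].
have := ac_nonincreasing ab (acD aF aG).
have G0 : G a = 0 by rewrite /G set_itv1 Rintegral_set1.
rewrite G0 mulr0 addr0 mulN1r => h.
suff : F b - G b <= F a by rewrite /G; lra.
apply: h; apply: ae_imp (ae_and dF (ae_primitive ig)) => t [h1 h2] a_t tb.
have [l dl le] := h1 a_t tb; have dG := h2 a_t tb.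
exists (l - g t); last by rewrite subr_le0.
rewrite (_ : (fun t => F t + _) = (fun t => F t - G t)); last by apply/funext => s; rewrite mulN1r.
exact: is_deriveB.
Qed.

End IntegratedInequality.

(** * Closed-loop trajectories *)

Section Extension.
Context {R : realType} (n m p q nu : nat).
Context (S : plant R n m p q nu) (K : 'M[R]_(p, n)) (t0 : R) (psi : R -> 'cV[R]_n) (w : R -> 'cV[R]_q) (x : R -> 'cV[R]_n).
Notation leb := (@lebesgue_measure R).
Hypothesis hS : is_plant S.
Hypothesis cpsi : CJ S psi.
Hypothesis sol : is_solution S K t0 psi w x.

Let rmax0 : - rmax S <= 0. Proof. by rewrite oppr_le0; exact: (delay_ge0 hS). Qed.

Lemma delayed_window (x1 x2 : R -> 'cV[R]_n) t : (forall s, Jset S s -> x1 (t + s) = x2 (t + s)) ->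
  closed_loop_field S K x1 w t = closed_loop_field S K x2 w t /\
  closed_loop_output S K x1 w t = closed_loop_output S K x2 w t.
Proof.
move=> e; have ed j : x1 (t - delay S j) = x2 (t - delay S j).
  by apply: e; rewrite /Jset /= in_itv /= lerN2 oppr_le0 (delay_le_rmax hS) (delay_ge0 hS).
rewrite /closed_loop_field /closed_loop_output; split; congr (_ + _ + _).
- by apply: eq_bigr => j _; rewrite ed.
- by apply: eq_bigr => i _; apply: mxint_eq => s /(Iset_sub_J hS) /e ->.
- by apply: eq_bigr => j _; rewrite ed.
- by apply: eq_bigr => i _; apply: mxint_eq => s /(Iset_sub_J hS) /e ->.
Qed.

(** A solution is prescribed on the initial interval only; extending it by a
    constant to the left gives a function that is continuous on the whole
    line. *)
Definition extension s := clampJ S psi (s - t0) + (x (Num.max t0 s) - x t0).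

Lemma extension_eq s : t0 - rmax S <= s -> extension s = x s.
Proof.
have [ini _ _] := sol; move=> hs; rewrite /extension.
have [ts|st] := leP t0 s.
  rewrite /clampJ /clamp (min_idPr _) ?subr_ge0 // (max_idPr rmax0) -ini; last exact: (Jset0 hS).
  by rewrite addr0 addrC subrK.
rewrite subrr addr0 clampJ_id -?ini; last 2 first.
- by rewrite /Jset /= in_itv /= subr_le0 (ltW st) andbT; lra.
- by rewrite /Jset /= in_itv /= subr_le0 (ltW st) andbT; lra.
by rewrite addrC subrK.
Qed.

Lemma extension_window t s : t0 <= t -> Jset S s -> extension (t + s) = x (t + s).
Proof. by move=> tt; rewrite /Jset /= in_itv /= => /andP[h _]; apply: extension_eq; lra. Qed.

Lemma extension_cont : mxcont extension.
Proof.
have [_ acx _] := sol; move=> i j t; rewrite (ord1 j).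
have c1 : continuous (fun s => clampJ S psi (s - t0) i 0).
  rewrite (_ : (fun s => _) = (fun s => clampJ S psi (- t0 + s) i 0)); last first.
    by apply/funext => s; rewrite addrC.
  by apply: (@shift_continuous _ (fun s => clampJ S psi s i 0)); exact: clampJ_cont.
have c2 : continuous (fun s => x (Num.max t0 s) i 0).
  by apply: (@ray_continuous _ t0 (fun s => x s i 0)) => b tb; apply: ac_continuous; exact: acx.
rewrite (_ : (fun s => _) = (fun s => clampJ S psi (s - t0) i 0 + (x (Num.max t0 s) i 0 - x t0 i 0))).
  by apply: cvgD; [exact: c1|apply: cvgB; [exact: c2|exact: cvg_cst]].
by apply/funext => s; rewrite !mxE.
Qed.

Lemma extension_ac t1 t2 : t0 <= t1 -> t1 <= t2 -> mxac t1 t2 extension.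
Proof.
have [_ acx _] := sol; move=> t01 t12 i j; rewrite (ord1 j).
apply: (@ac_eq _ _ _ (fun s => x s i 0)).
  by move=> s s1 _; rewrite extension_eq //; move: rmax0; lra.
by apply: (@ac_subitv _ t0 (t2 + 1)); [|lra|apply: acx; lra].
Qed.

Lemma extension_derive : {ae leb, forall t, t0 < t -> mxder t extension (closed_loop_field S K extension w t)}.
Proof.
have [_ _ dx] := sol; apply: ae_imp dx => t dx tt i j.
rewrite (proj1 (delayed_window (x2 := x) _)); last by move=> s; apply: extension_window; exact: ltW.
have [dv ev] := dx (ltW tt).
apply: (@near_eq_is_derive _ _ _ (fun s => x s i j)).
  have : \forall s \near t, t0 < s by exact: lt_nbhsr.
  by apply: filterS => s ts; rewrite extension_eq //; move: rmax0; lra.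
have dij : derivable (fun s => x s i j) t 1 by move/derivable_mxP: dv.
apply: DeriveDef => //.
by rewrite -ev derive_mx // mxE.
Qed.

End Extension.

Section Trajectories.
Context {R : realType} (n m p q nu : nat) (d delta mu : 'I_nu -> nat).
Context (S : plant R n m p q nu) (D : decomposition R n m p d delta mu) (L : factors R d delta mu).
Notation leb := (@lebesgue_measure R).
Hypothesis hS : is_plant S.
Hypothesis hD : is_decomposition S D.
Hypothesis hL : is_factors S D L.
Context (s : 'cV[R]_m -> 'cV[R]_q -> R) (lam t0 : R).
Context (X P1 : 'M[R]_n) (P2 : 'M[R]_(n, (\sum_i d i) * n)) (P3 : 'M[R]_((\sum_i d i) * n)) (Q Rr : 'I_nu -> 'M[R]_n)
  (V : 'M[R]_(p, n)).
Hypothesis uX : X \in unitmx.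
Hypothesis sP1 : issym P1.
Hypothesis sP3 : issym P3.
Notation stor := (storage S D L P1 P2 P3 Q Rr).
Notation vstack y t := (vecC (stack (ydel S y t) (Yh S D L (hist y t)) (Ye S D L (hist y t)))).
Notation K := (V *m invmx X).
Hypothesis rate : forall (y : R -> 'cV[R]_n) t w (y' : 'cV[R]_n), mxcont y ->
  X *m y' = acPi S D L X V *m col_mx (col_mx (vstack y t) w) 0 ->
  storage_rate S D L P1 P2 P3 Q Rr y t y' <= s (acSigma S D L X V *m col_mx (vstack y t) w) w - lam * stor (hist y t).

(** The storage is evaluated along [y], the transformed extension, which has the
    same histories as the transformed solution. *)
Lemma trajectory psi (w : R -> 'cV[R]_q) x : CJ S psi -> is_solution S K t0 psi w x ->
  exists y, [/\ mxcont y, (forall t th, t0 <= t -> Jset S th -> y (t + th) = invmx X *m x (t + th)),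
    (forall t1 t2, t0 <= t1 -> t1 <= t2 -> abs_continuous t1 t2 (fun t => stor (hist y t))) &
    {ae leb, forall t, t0 < t -> exists2 l, is_derive t 1 (fun t => stor (hist y t)) l &
       l <= s (closed_loop_output S K x w t) (w t) - lam * stor (hist y t)}].
Proof.
move=> cpsi sol; pose xe := extension S t0 psi x; pose y := fun s => invmx X *m xe s.
have cy : mxcont y by apply: mxcont_mull; exact: (extension_cont hS cpsi sol).
have Xy : (fun s => X *m y s) = xe by apply/funext => r; rewrite /y mulmxA mulmxV // mul1mx.
exists y; split => //.
- by move=> t th tt hth; rewrite /y /xe (extension_window hS sol tt hth).
- move=> t1 t2 t01 t12; apply: (storage_ac L hS hD) => //.
  by apply: mxac_mull => //; exact: (extension_ac hS sol).
- apply: ae_imp (extension_derive hS sol) => t dx tt.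
  have dy := mxder_mull (invmx X) (dx tt).
  exists (storage_rate S D L P1 P2 P3 Q Rr y t (invmx X *m closed_loop_field S K xe w t)).
    exact: (storage_derive hS hD hL P2 Q Rr sP1 sP3 cy dy).
  have e : closed_loop_output S K x w t = closed_loop_output S K xe w t.
    by apply: (proj2 (delayed_window K w hS _)) => th hth; rewrite /xe (extension_window hS sol (ltW tt) hth).
  rewrite e -Xy (output_stack hS hD hL _ uX) //; apply: rate => //.
  by rewrite mulmxA mulmxV // mul1mx (field_stack hS hD hL _ uX _ _ 0).
Qed.

Lemma mxcont_add k l (F G : R -> 'M[R]_(k, l)) : mxcont F -> mxcont G -> mxcont (fun t => F t + G t).
Proof.
move=> cF cG i j t; rewrite (_ : (fun t => _) = (fun t => F t i j + G t i j)).
  by apply: cvgD; [exact: cF|exact: cG].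
by apply/funext => r; rewrite mxE.
Qed.

Lemma mxcont_sum N k l (F : 'I_N -> R -> 'M[R]_(k, l)) : (forall j, mxcont (F j)) -> mxcont (fun t => \sum_j F j t).
Proof.
move=> cF i j; rewrite (_ : (fun t => _) = (fun t => \sum_r F r t i j)).
  by apply: cont_sum => r; exact: cF.
by apply/funext => t; rewrite summxE.
Qed.

(** The output is a continuous function plus [D2 w]; this makes the supply rate
    integrable on bounded intervals. *)
Lemma output_L2 psi (w : R -> 'cV[R]_q) x t1 t2 : CJ S psi -> is_solution S K t0 psi w x ->
  L2 `[t0, +oo[ w -> t0 <= t1 -> L2 `[t1, t2] (closed_loop_output S K x w) /\ L2 `[t1, t2] w.
Proof.
move=> cpsi sol sw t01.
have sw' : L2 `[t1, t2] w.
  apply: (L2S _ _ _ sw); [exact: measurable_itv|exact: measurable_itv|].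
  by move=> t; rewrite /= !in_itv /= => /andP[h _]; rewrite andbT (le_trans t01).
split=> //; pose xe := extension S t0 psi x.
have cx : mxcont xe by exact: (extension_cont hS cpsi sol).
have cz : mxcont (fun t => \sum_(i < nu.+1) (C_ S i + E_ S i *m K) *m xe (t - delay S i) +
  \sum_(i < nu) mxint (Iset S i) (fun tau => (Ct S i tau + Et S i tau *m K) *m xe (t + tau))).
  apply: mxcont_add; apply: mxcont_sum => i.
    apply: mxcont_mull => r c; have := @mxcont_shift _ _ _ _ (- delay S i) cx r c.
    by rewrite (_ : (fun s => _) = (fun t => xe (t - delay S i) r c)) //; apply/funext => t; rewrite addrC.
  apply: mxconv_cont => //; first by rewrite lerN2 ltW //; exact: rprev_lt_rcur.
  by case: hS => _ _ /(_ i) [_ _ sc se]; apply: L2_add => //; exact: L2_mulr.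
have := L2_add (mxcont_L2 t1 t2 cz) (L2_mull (D2 S) sw').
move=> h i j; have := h i j.
rewrite (_ : (fun t => _) \_ _ = (fun t => closed_loop_output S K x w t i j) \_ `[t1, t2]) //.
apply/funext => t; rewrite !patchE; case: ifPn => // /set_mem; rewrite /= in_itv /= => /andP[h1 _].
rewrite (proj2 (delayed_window K w hS (x2 := xe) _)) //.
by move=> th hth; rewrite /xe (extension_window hS sol (le_trans t01 h1) hth).
Qed.

End Trajectories.

(** * Dissipativity and exponential stability *)

(** Only the negative semidefinite block of the supply rate is left without
    disturbance. *)
Lemma supply_undisturbed_le0 (R : realType) (m q : nat) (J1 Jt : 'M[R]_m) (J2 : 'M[R]_(m, q)) (J3 : 'M[R]_q) z :
  negsemidef (Jt^T *m invmx J1 *m Jt) -> supply J1 Jt J2 J3 z 0 <= 0.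
Proof.
by move=> [_ h]; rewrite /supply tr_col_mx mul_row_block mul_row_col mulmx0 addr0 trmx0 mul0mx addr0.
Qed.

(** Multiply by the exponential to reduce to monotonicity. *)
Lemma exp_decay (R : realType) (t0 t lam : R) (F : R -> R) : t0 <= t ->
  abs_continuous t0 t F ->
  {ae @lebesgue_measure R, forall s, t0 < s -> exists2 l, is_derive s 1 F l & l <= - lam * F s} ->
  F t <= F t0 * expR (- lam * (t - t0)).
Proof.
move=> t0t aF dF; pose ex s := expR (lam * (s - t0)).
have dex (s : R) : is_derive s 1 ex (lam * ex s).
  have h1 : is_derive s 1 (fun s => lam * (s - t0)) lam.
    have := is_derive_mul (is_derive_cst lam s 1) (is_deriveB (is_derive_id s 1) (is_derive_cst t0 s 1)).
    by rewrite mul0r add0r subr0 mulr1.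
  have := @is_derive1_comp _ expR (fun s => lam * (s - t0)) s _ _ (is_derive_expR _) h1.
  by rewrite mulrC.
have aex : abs_continuous t0 t ex.
  apply: (ac_C1 t0t dex); apply: continuous_within.
  have cex := is_derive_continuous dex.
  by move=> s; apply: cvgM; [exact: cvg_cst|exact: cex].
have := ac_nonincreasing t0t (acM t0t aF aex).
rewrite (_ : ex t0 = 1) ?mulr1 => [h|]; last by rewrite /ex subrr mulr0 expR0.
suff h' : F t * ex t <= F t0.
  by rewrite -ler_pdivrMr ?expR_gt0 // -expRN mulNr opprK.
apply: h; apply: ae_imp dF => s ds t0s _; have [l dl le] := ds t0s.
exists (l * ex s + F s * (lam * ex s)); first exact: is_derive_mul.
rewrite (_ : _ + _ = (l + lam * F s) * ex s); last by ring.
by apply: mulr_le0_ge0; [lra|exact: expR_ge0].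
Qed.

Theorem theorem2 (R : realType) (n m p q nu : nat) (d delta mu : 'I_nu -> nat)
    (t0 : R) (S : plant R n m p q nu) (D : decomposition R n m p d delta mu)
    (L : factors R d delta mu)
    (J1 Jt : 'M[R]_m) (J2 : 'M[R]_(m, q)) (J3 : 'M[R]_q)
    (alpha : 'I_(beta d delta mu) -> R)
    (X P1 : 'M[R]_n) (P2 : 'M[R]_(n, (\sum_i d i) * n))
    (P3 : 'M[R]_((\sum_i d i) * n)) (Q Rr : 'I_nu -> 'M[R]_n)
    (V : 'M[R]_(p, n)) :
  [/\ (0 < n)%N, (0 < m)%N, (0 < p)%N, (0 < q)%N & (0 < nu)%N] ->
  (forall i, (0 < d i)%N) ->
  is_plant S ->
  [/\ issym J1, J1 \in unitmx, negdef (invmx J1),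
      negsemidef (Jt^T *m invmx J1 *m Jt) & issym J3] ->
  is_decomposition S D ->
  is_factors S D L ->
  [/\ issym X, issym P1, issym P3, (forall i, issym (Q i)) &
      (forall i, issym (Rr i))] ->
  posdef (block_mx P1 P2 P2^T P3
          + ((0 : 'M[R]_n) ⊕ diag_catn (fun i => (1%:M : 'M[R]_(d i)) ⊗ Q i))) ->
  posdef (diag_cat Q) ->
  posdef (diag_cat Rr) ->
  negdef
    (Sy (col_mx 1%:M
           (col_mx (col_mx (col_cat (fun i => (alpha i)%:M)) (0 : 'M[R]_(q, n)))
                   (0 : 'M[R]_(m, n)))
         *m row_mx (- X) (acPi S D L X V))
     + block_mx 0 (acP m q L P1 P2) (acP m q L P1 P2)^T
         (acPhi S D L J1 Jt J2 J3 X P2 P3 Q Rr V)) ->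
  dissipative S (V *m invmx X) t0 (supply J1 Jt J2 J3)
  /\ origin_GES S (V *m invmx X) t0.
Proof.
move=> _ _ hS [sJ1 uJ1 _ nJ _] hD hL [sX sP1 sP3 sQ sR] posP posQ posR lmi.
have uX := lmi_unit sX lmi.
have [lam lam0 rate] := dissipation_rate hS hD hL sJ1 uJ1 sP3 sR posR lmi.
pose stor := storage S D L P1 P2 P3 Q Rr.
have stor0P y : mxcont y -> 0 <= stor y by exact: (storage_ge0 hD hL sQ posP posQ posR).
split.
- exists (fun phi => stor (fun s => invmx X *m phi s)).
    exact: (storage_is_functional hS hD hL sQ posP posQ posR).
  move=> psi w x cpsi sw sol t1 t2 t01 t12.
  have [y [cy yx ay dy]] := trajectory hS hD hL uX sP1 sP3 rate cpsi sol.
  have hv t : t0 <= t -> stor (fun s => invmx X *m hist x t s) = stor (hist y t).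
    by move=> tt; apply: (storage_eq D L hS) => s sJ; rewrite /hist yx.
  rewrite !hv ?(le_trans t01) //.
  have [sz sw'] := output_L2 hS t2 cpsi sol sw t01.
  apply: (@ac_dissipation _ t1 t2 (fun t => stor (hist y t))
    (fun t => supply J1 Jt J2 J3 (closed_loop_output S (V *m invmx X) x w t) (w t)) t12 (ay _ _ t01 t12)).
    by apply: bilin_intg; [exact: measurable_itv|exact: L2_col|exact: L2_col].
  apply: ae_imp dy => t dt t1t _; have [l dl le] := dt (le_lt_trans t01 t1t).
  exists l => //; apply: (le_trans le); rewrite lerBlDr lerDl.
  by apply: mulr_ge0; [exact: ltW|apply: stor0P; exact: mxcont_shift].
have [c c0 cP] := storage_lower hD hL sQ posP posQ posR.
have [C C0 CP] := storage_sup hS hD hL P1 P2 P3 Q posR.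
have [K1 K10 K1P] := sqn_mulmx_le (invmx X).
have [K2 K20 K2P] := sqn_mulmx_le X.
pose B := K2 / c * (C * K1).
have B0 : 0 < B by rewrite /B !mulr_gt0 // invr_gt0.
(* the storage is quadratic in the state, hence the square roots *)
exists (Num.sqrt B), (lam / 2); split; [by rewrite sqrtr_gt0|by rewrite divr_gt0|].
move=> psi x cpsi sol t tt.
have [y [cy yx ay dy]] := trajectory hS hD hL uX sP1 sP3 rate cpsi sol.
have y0 r : t0 <= r -> y r = invmx X *m x r.
  by move=> rr; have := yx r 0 rr (Jset0 hS); rewrite addr0.
have decay : stor (hist y t) <= stor (hist y t0) * expR (- lam * (t - t0)).
  apply: (@exp_decay _ t0 t lam (fun t => stor (hist y t)) tt (ay t0 t (lexx _) tt)).
  apply: ae_imp dy => r dr rr; have [l dl le] := dr rr; exists l => //.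
  by apply: (le_trans le); have := supply_undisturbed_le0 J2 J3 (closed_loop_output S (V *m invmx X) x (fun=> 0) r) nJ; rewrite /stor; lra.
have init : stor (hist y t0) <= C * (K1 * supnorm S psi ^+ 2).
  apply: CP; [exact: mxcont_shift|by rewrite mulr_ge0 ?sqr_ge0 // ltW|].
  move=> s sJ; rewrite /hist yx //; apply: (le_trans (K1P _)); rewrite ler_pM2l //.
  by case: sol => ini _ _; rewrite ini //; exact: sqn_supnorm.
have low : c * sqn (y t) <= stor (hist y t).
  by have := cP _ (mxcont_shift cy : mxcont (hist y t)); rewrite /hist addr0.
have up : sqn (x t) <= K2 * sqn (y t).
  by apply: le_trans (K2P _); rewrite y0 // mulmxA mulmxV // mul1mx.
set ex := expR (- (lam / 2) * (t - t0)).
have ex2 : expR (- lam * (t - t0)) = ex ^+ 2.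
  by rewrite /ex expr2 -expRD; congr expR; field.
rewrite -(@ler_pXn2r _ 2) ?nnegrE ?sqrtr_ge0 ?mulr_ge0 ?expR_ge0 ?sqrtr_ge0 ?(supnorm_ge0 hS) //.
rewrite enormE !exprMn sqr_sqrtr ?(ltW B0) //.
apply: (le_trans up); rewrite /B -!mulrA ler_pM2l // ler_pdivlMl //.
apply: (le_trans low); apply: (le_trans decay).
rewrite ex2 (_ : C * _ = C * (K1 * supnorm S psi ^+ 2) * ex ^+ 2); last by ring.
by apply: ler_wpM2r; [exact: sqr_ge0|exact: init].
Qed.
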